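(* Let $\alpha>-1$, let $\Omega\subset\mathbb{C}$ be a simply connected domain of finite area, and let $h\in A^2_\alpha(\Omega)$ (in particular $h$ is analytic on $\Omega$). Then there exists a function $u\in L^2(\Omega,dA_\alpha)$ such that $\bar\partial u = h$ on $\Omega$ and $$\|u\|_{L^2(\Omega,dA_\alpha)}^2 \leq \frac{\operatorname{Area}(\Omega)}{(2+\alpha)\pi}\,\|h\|_{A^2_\alpha(\Omega)}^2.$$
   Context: Let $\phi:\Omega\to\mathbb{D}$ be a Riemann mapping (a univalent analytic map onto the unit disc $\mathbb{D}$), and put $$dA_\alpha(z) = (1+\alpha)\frac{(1-|\phi(z)|^2)^\alpha}{|\phi'(z)|^\alpha}\,\frac{dx\,dy}{\pi}.$$ $A^2_\alpha(\Omega)$ is the closed subspace of holomorphic functions in $L^2(\Omega,dA_\alpha)$, with the norm of $L^2(\Omega,dA_\alpha)$. $\operatorname{Area}(\Omega)$ is the (unnormalized) Lebesgue measure of $\Omega$. $\bar\partial = (\partial_x+i\partial_y)/2$ is the classical d-bar operator. *)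

(* Defs.v *)
(* Written with MathComp-Analysis: the reals are an arbitrary [R : realType]
   and the complex numbers are [R[i]]. *)
From HB Require Import structures.
From mathcomp Require Import all_boot all_order all_algebra.
From mathcomp Require Import complex.
From mathcomp Require Import all_classical all_reals all_analysis.

Set Implicit Arguments.
Unset Strict Implicit.
Unset Printing Implicit Defensive.

Import Order.TTheory GRing.Theory Num.Theory.
Import numFieldNormedType.Exports.

Local Open Scope classical_set_scope.
Local Open Scope ring_scope.
Local Open Scope complex_scope.

(* [R[i]] with its modulus topology, as a normed module over itself; hence
   [derivable f z 1] is complex differentiability of [f : R[i] -> R[i]]. *)
HB.instance Definition _ (R : realType) := PseudoPointedMetric.copy R[i] R[i]^o.
HB.instance Definition _ (R : realType) := NormedModule.copy R[i] R[i]^o.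

Section plane.
Context {R : realType}.
Implicit Types (D : set R[i]) (f u : R[i] -> R[i]) (z : R[i]).

(* The generic norm of [R[i]] is valued in [R[i]]; this one is valued in [R]. *)
Definition cabs z : R := Normc.normc z.

Definition unit_disc : set R[i] := [set z | cabs z < 1].

Definition of_xy (p : R * R) : R[i] := p.1 +i* p.2.

Definition to_xy z : R * R := (complex.Re z, complex.Im z).

(* Lebesgue measure of the plane, restricted to the Borel sets. Hence [in_L2]
   asks for Borel measurability, which loses nothing for holomorphic [f] or
   (real) differentiable [u]. *)
Local Notation plane_measure :=
  (@lebesgue_measure R \x @lebesgue_measure R)%E.

Definition area D : \bar R := plane_measure (of_xy @^-1` D).

Definition domain D := [/\ open D, D !=set0 & connected D].

Definition loop_in D (g : R -> R[i]) :=
  [/\ {within `[0, 1], continuous g},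
      forall t : R, t \in `[0, 1] -> D (g t) & g 0 = g 1].

(* [H (s, t)]: [s] is the deformation parameter, [t] the loop parameter. *)
Definition null_homotopic_in D (g : R -> R[i]) :=
  exists H : R * R -> R[i],
    [/\ {within `[0, 1] `*` `[0, 1], continuous H},
        forall s t : R, s \in `[0, 1] -> t \in `[0, 1] -> D (H (s, t)),
        forall t : R, t \in `[0, 1] -> H (0, t) = g t,
        forall t : R, t \in `[0, 1] -> H (1, t) = g 0 &
        forall s : R, s \in `[0, 1] -> H (s, 0) = g 0 /\ H (s, 1) = g 0].

Definition simply_connected_domain D :=
  domain D /\ forall g, loop_in D g -> null_homotopic_in D g.

Definition holomorphic_on D f := forall z, D z -> derivable f z 1.

Definition Riemann_mapping D (phi : R[i] -> R[i]) :=
  holomorphic_on D phi /\ set_bij D unit_disc phi.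

(* The density of dA_alpha with respect to dx dy / pi. *)
Definition weight (alpha : R) (phi : R[i] -> R[i]) z : R :=
  (1 + alpha) * ((1 - cabs (phi z) ^+ 2) `^ alpha / cabs (derive1 phi z) `^ alpha).

Definition sqnormL2 alpha phi D f : \bar R :=
  (\int[plane_measure]_(p in of_xy @^-1` D)
     (cabs (f (of_xy p)) ^+ 2 * (weight alpha phi (of_xy p) / pi))%:E)%E.

Definition in_L2 alpha phi D f :=
  [/\ measurable_fun (of_xy @^-1` D) (fun p => complex.Re (f (of_xy p))),
      measurable_fun (of_xy @^-1` D) (fun p => complex.Im (f (of_xy p))) &
      (sqnormL2 alpha phi D f < +oo)%E].

Definition in_Bergman alpha phi D f :=
  holomorphic_on D f /\ in_L2 alpha phi D f.

Definition real_differentiable u z :=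
  differentiable (fun p => complex.Re (u (of_xy p))) (to_xy z) /\
  differentiable (fun p => complex.Im (u (of_xy p))) (to_xy z).

Definition partial (v : R * R) u z : R[i] :=
  'D_v (fun p => complex.Re (u (of_xy p))) (to_xy z) +i*
  'D_v (fun p => complex.Im (u (of_xy p))) (to_xy z).

Definition dbar u z : R[i] :=
  (partial (1, 0) u z + (0 +i* 1) * partial (0, 1) u z) / 2.

(* Classical solution: without differentiability, ['D_v] may be the default
   value of a nonexistent limit. *)
Definition dbar_solution D u f :=
  forall z, D z -> real_differentiable u z /\ dbar u z = f z.

End plane.

(* Main.v *)
(* Let [psi = phi^-1] on the unit disc, let [L] be holomorphic with [|L| = |psi'|^(1 + alpha / 2)],
   and put [F = (h o psi) L], with Taylor expansions [psi = sum a_m w^m] and [F = sum b_n w^n].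
   Composition with [psi] and multiplication by [L] turn the norm of [L^2(Omega, dA_alpha)] into
   the norm of the disc with weight [(1 - |w|^2)^alpha], and a solution [u] into
   [conj(psi - psi 0) F - G] with [G] holomorphic. Take [G] to be the projection, that is
   [u = sum conj(a_m) b_n e_mn], where [e_mn] is the component of [w^n conj(w)^m] orthogonal to
   the holomorphic functions. Rotation invariance kills the scalar products of [e_mn] and [e_m'n']
   unless [n + m' = n' + m]; the remaining Gram matrices are nonnegative, because the moments
   [gamma_k] of [|w|^2] are log-convex, and a Schur test with weights [1 / gamma_n] applies, whose
   row sums are exactly [m / (2 + alpha)]. Hence
   [|u|^2 <= (2 + alpha)^-1 (sum m |a_m|^2) (sum gamma_n |b_n|^2)], and Bessel's inequality bounds
   the two sums by [Area(Omega) / pi] and the squared norm of [h]. The estimates are made on the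
   finite truncations of the double series; Fatou's lemma passes to the limit. *)

Require Import Defs.
From HB Require Import structures.
From mathcomp Require Import all_boot all_order all_algebra.
From mathcomp Require Import complex.
From mathcomp Require Import all_classical all_reals all_analysis.
From mathcomp Require Import measurable_realfun cyclic separable cyclotomic.
From mathcomp Require Import zify ring lra.

Set Implicit Arguments.
Unset Strict Implicit.
Unset Printing Implicit Defensive.

Import Order.TTheory GRing.Theory Num.Theory.
Import numFieldNormedType.Exports.
Local Open Scope classical_set_scope.
Local Open Scope ring_scope.
Local Open Scope complex_scope.

(** * Complex modulus, continuity and differentiability *)

Section cabs.
Context {R : realType}.
Local Notation C := R[i].
Implicit Types (z w : C) (x : R).

(** The constant comes from the identity [\sum_(k < n) gam n / gam k = n%:R / c] with
    [c = 2 + alpha]: the two halves of a row of the Gram matrix give [(n' + m) / c] and [n' / c],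
    and their difference is [m / c] whatever [n'] is. Nonnegativity of the entries is what allows
    the coefficients to be replaced by their moduli before the test. No polar coordinates occur. A
    truncation is a polynomial in w and conj(w), so averaging over enough roots of unity gives exact
    angular orthogonality; radial integration is the image of the planar measure under the squared
    modulus. The function G is found coefficient by coefficient: each coefficient is an absolutely
    convergent series with a bound that grows slowly enough for a power series on the disc, so no
    completeness of a function space is invoked. The transport rests on a change of variables for
    injective holomorphic maps, obtained by comparing two measures on ever smaller rectangles. The
    same bisection lemma yields Goursat's theorem and the boundedness of continuous functions on
    rectangles. *)

Lemma cabs_ge0 z : 0 <= cabs z.
Proof. by case: z => a b; exact: sqrtr_ge0. Qed.

Lemma sqr_cabs z : cabs z ^+ 2 = complex.Re z ^+ 2 + complex.Im z ^+ 2.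
Proof. by case: z => a b; rewrite /cabs /= sqr_sqrtr// addr_ge0// sqr_ge0. Qed.

Lemma cabs0 : cabs (0 : C) = 0. Proof. exact: Normc.normc0. Qed.
Lemma cabs1 : cabs (1 : C) = 1. Proof. exact: Normc.normc1. Qed.
Lemma cabsM z w : cabs (z * w) = cabs z * cabs w.
Proof. exact: Normc.normcM. Qed.
Lemma cabsV z : cabs z^-1 = (cabs z)^-1. Proof. exact: Normc.normcV. Qed.
Lemma ler_cabsD z w : cabs (z + w) <= cabs z + cabs w.
Proof. exact: le_normcD. Qed.
Lemma cabsN z : cabs (- z) = cabs z. Proof. exact: normcN. Qed.

Lemma ler_cabsB z w : cabs (z - w) <= cabs z + cabs w.
Proof. by rewrite -(cabsN w); exact: ler_cabsD. Qed.

Lemma cabs_distrC z w : cabs (z - w) = cabs (w - z).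
Proof. by rewrite -cabsN opprB. Qed.

Lemma cabsX z n : cabs (z ^+ n) = cabs z ^+ n.
Proof. by elim: n => [|n IH]; rewrite ?expr0 ?cabs1// !exprS cabsM IH. Qed.

Lemma cabs_eq0 z : (cabs z == 0) = (z == 0).
Proof.
by apply/idP/idP => /eqP; [move/Normc.eq0_normc => ->|move=> ->; rewrite cabs0].
Qed.

Lemma cabs_gt0 z : (0 < cabs z) = (z != 0).
Proof. by rewrite lt_def cabs_ge0 andbT cabs_eq0. Qed.

Lemma cabs_real x : cabs x%:C = `|x|.
Proof. by rewrite /cabs /= expr0n addr0 sqrtr_sqr. Qed.

Lemma cabsJ z : cabs z^* = cabs z.
Proof. by case: z => a b; rewrite /cabs /= sqrrN. Qed.

Lemma norm_Re_cabs z : `|complex.Re z| <= cabs z.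
Proof.
rewrite -(ler_pXn2r (n := 2))// ?nnegrE ?cabs_ge0 ?normr_ge0//.
by rewrite sqr_cabs real_normK ?num_real// lerDl sqr_ge0.
Qed.

Lemma norm_Im_cabs z : `|complex.Im z| <= cabs z.
Proof.
rewrite -(ler_pXn2r (n := 2))// ?nnegrE ?cabs_ge0 ?normr_ge0//.
by rewrite sqr_cabs real_normK ?num_real// lerDr sqr_ge0.
Qed.

Lemma cabs_ReIm z : cabs z <= `|complex.Re z| + `|complex.Im z|.
Proof.
rewrite -(ler_pXn2r (n := 2))// ?nnegrE ?cabs_ge0 ?addr_ge0 ?normr_ge0//.
rewrite sqr_cabs sqrrD !real_normK ?num_real//.
by rewrite lerD2r lerDl mulrn_wge0// mulr_ge0.
Qed.

Lemma cabs_mulJ z : (cabs z ^+ 2)%:C = z * z^*.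
Proof.
by rewrite sqr_cabs; case: z => a b; simpc; congr (_ +i* _); ring.
Qed.

Lemma normC_cabs z : `|z| = (cabs z)%:C.
Proof. by case: z. Qed.

Lemma cabs_triangle z w v : cabs (z - w) <= cabs (z - v) + cabs (v - w).
Proof. by rewrite -[z - w](subrKA v); exact: ler_cabsD. Qed.

Lemma ler_cabs_dist z w : cabs z - cabs w <= cabs (z - w).
Proof. by rewrite lerBlDr -{1}(subrK w z); exact: ler_cabsD. Qed.

Lemma ler_cabs_sum I (r : seq I) (P : pred I) (F : I -> C) :
  cabs (\sum_(i <- r | P i) F i) <= \sum_(i <- r | P i) cabs (F i).
Proof.
elim/big_ind2 : _ => [|x1 x2 y1 y2 h1 h2|//]; first by rewrite cabs0.
by apply: le_trans (ler_cabsD _ _) _; rewrite lerD.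
Qed.

Lemma complexP z w : complex.Re z = complex.Re w ->
  complex.Im z = complex.Im w -> z = w.
Proof. by case: z w => a b [c d] /= -> ->. Qed.

Lemma of_xyK : cancel (@of_xy R) (@to_xy R). Proof. by case. Qed.
Lemma to_xyK : cancel (@to_xy R) (@of_xy R). Proof. by case. Qed.

End cabs.

Section cderiv.
Context {R : realType}.
Local Notation C := R[i].
Implicit Types (f g : C -> C) (z w d : C).

(* The generic norm of [R[i]] being valued in [R[i]], continuity and differentiability are
   restated with real bounds. *)
Definition ccont f z := forall e : R, 0 < e ->
  exists2 r : R, 0 < r & forall k, cabs k < r -> cabs (f (z + k) - f z) < e.

Definition cderiv f z d := forall e : R, 0 < e -> exists2 r : R, 0 < r &
  forall k, cabs k < r -> cabs (f (z + k) - f z - d * k) <= e * cabs k.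

Lemma gtc0P (e : C) : 0 < e -> exists2 x : R, 0 < x & e = x%:C.
Proof.
case: e => a b; rewrite ltcE /= => /andP[/eqP -> a0].
by exists a.
Qed.

Lemma nbhs_cabs (z : C) (A : set C) :
  nbhs z A <-> exists2 r : R, 0 < r & forall w, cabs (w - z) < r -> A w.
Proof.
split.
  move=> /nbhs_ballP[e /= /gtc0P[x x0 ->] h]; exists x => // w hw.
  by apply: h; rewrite /ball/= normC_cabs ltcR cabs_distrC.
move=> [r r0 h]; apply/nbhs_ballP; exists r%:C => /=; first by rewrite ltcR.
by move=> w; rewrite /ball/= normC_cabs ltcR cabs_distrC; exact: h.
Qed.

Lemma openC_cabs (A : set C) : open A <->
  forall z, A z -> exists2 r : R, 0 < r & forall w, cabs (w - z) < r -> A w.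
Proof.
rewrite openE; split => h z Az; first by apply/nbhs_cabs; exact: h.
by apply/nbhs_cabs; exact: h.
Qed.

Lemma derivable_cderiv f z : derivable f z 1 -> cderiv f z (derive1 f z).
Proof.
move=> df e e0.
have : (fun h : C => h^-1 *: (f (h + z) - f z)) @ 0^' --> derive1 f z.
  have -> : (fun h : C => h^-1 *: (f (h + z) - f z)) =
    (fun h : C => h^-1 *: ((f \o shift z) (h *: 1) - f z)).
    by apply/funext => h /=; rewrite /GRing.scale/= mulr1.
  by rewrite derive1E; exact: df.
move/cvgrPdist_le => /(_ (e%:C)); rewrite ltcR => /(_ e0).
rewrite near_withinE => /nbhs_cabs[r r0 h]; exists r => // k kr.
have [->|k0] := eqVneq k 0; first by rewrite addr0 mulr0 !subr0 subrr cabs0 mulr0.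
have := h k; rewrite subr0 => /(_ kr k0).
rewrite normC_cabs lecR => hk.
have -> : f (z + k) - f z - derive1 f z * k
    = - (derive1 f z - k^-1 *: (f (k + z) - f z)) * k.
  by rewrite /GRing.scale/= mulNr mulrBl mulrAC mulVf// mul1r opprB addrC [k + z]addrC addrC.
by rewrite cabsM cabsN ler_wpM2r// cabs_ge0.
Qed.

Lemma cderiv_derivable f z d : cderiv f z d ->
  derivable f z 1 /\ derive1 f z = d.
Proof.
move=> df.
have h : (fun h : C => h^-1 *: ((f \o shift z) (h *: 1) - f z)) @ 0^' --> d.
  apply/cvgrPdist_le => _ /gtc0P[e e0 ->].
  have [r r0 h] := df e e0.
  rewrite near_withinE; apply/nbhs_cabs; exists r => // k.
  rewrite subr0 => kr k0; rewrite normC_cabs lecR /= /GRing.scale/= mulr1.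
  have k1 : 0 < cabs k by rewrite cabs_gt0.
  rewrite -(ler_pM2r k1) -cabsM; apply: le_trans (h k kr).
  rewrite -cabsN -mulNr opprB mulrBl mulrAC mulVf// mul1r [k + z]addrC.
  by rewrite lexx.
split; first by apply/cvg_ex; exists d.
by rewrite derive1E; exact: cvg_lim h.
Qed.

End cderiv.

Section ccont.
Context {R : realType}.
Local Notation C := R[i].
Implicit Types (f g q : C -> C) (z w d : C).

Lemma ccontP f z : ccont f z <-> {for z, continuous f}.
Proof.
split => [h|/cvgrPdist_lt h e e0].
  rewrite /prop_for /continuous_at; apply/(@cvgrPdist_lt _ _ _ (nbhs z)) => _ /gtc0P[e e0 ->].
  have [r r0 hr] := h e e0.
  apply/nbhs_cabs; exists r => // w /hr; rewrite subrKC => he.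
  by rewrite normC_cabs ltcR cabs_distrC.
have := h e%:C; rewrite ltcR => /(_ e0) /nbhs_cabs[r r0 hr]; exists r => // k kr.
by have := hr (z + k); rewrite addrC addKr normC_cabs ltcR cabs_distrC; apply.
Qed.

Lemma ccont_cst c z : ccont (fun=> c) z.
Proof. by apply/ccontP; exact: cst_continuous. Qed.

Lemma ccont_id z : ccont id z.
Proof. by apply/ccontP; exact: cvg_id. Qed.

Lemma ccontD f g z : ccont f z -> ccont g z -> ccont (fun x => f x + g x) z.
Proof. by move=> /ccontP hf /ccontP hg; apply/ccontP; exact: cvgD hf hg. Qed.

Lemma ccontN f z : ccont f z -> ccont (fun x => - f x) z.
Proof. by move=> /ccontP hf; apply/ccontP; exact: cvgN hf. Qed.

Lemma ccontB f g z : ccont f z -> ccont g z -> ccont (fun x => f x - g x) z.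
Proof. by move=> hf hg; apply: ccontD => //; exact: ccontN. Qed.

Lemma ccontM f g z : ccont f z -> ccont g z -> ccont (fun x => f x * g x) z.
Proof. by move=> /ccontP hf /ccontP hg; apply/ccontP; exact: cvgM hf hg. Qed.

Lemma ccontV f z : f z != 0 -> ccont f z -> ccont (fun x => (f x)^-1) z.
Proof. by move=> f0 /ccontP hf; apply/ccontP; exact: cvgV f0 hf. Qed.

Lemma ccont_comp f g z : ccont f z -> ccont g (f z) -> ccont (fun x => g (f x)) z.
Proof.
move=> hf hg e e0; have [r r0 hr] := hg e e0; have [s s0 hs] := hf r r0.
by exists s => // k /hs /hr; rewrite [f z + _]addrC subrK.
Qed.

Lemma ccont_shift f z w : ccont f (z + w) -> ccont (fun k => f (z + k)) w.
Proof.
by move=> hf; apply: ccont_comp hf; apply: ccontD; [exact: ccont_cst|exact: ccont_id].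
Qed.

(** Carathéodory's form of the derivative. The slope [q] is continuous at 0, so that the product,
    chain and quotient rules reduce to the calculus of continuous functions. *)
Lemma cderivP f z d : cderiv f z d <->
  exists q, [/\ q 0 = d, ccont q 0 & forall k, f (z + k) - f z = q k * k].
Proof.
split=> [h|[q [q0 cq fq]] e e0]; last first.
  have [r r0 hr] := cq e e0; exists r => // k /hr; rewrite add0r q0 => hk.
  by rewrite fq -mulrBl cabsM ler_wpM2r ?cabs_ge0// ltW.
exists (fun k => if k == 0 then d else (f (z + k) - f z) / k); split.
- by rewrite eqxx.
- move=> e e0; have e20 : 0 < e / 2 by rewrite divr_gt0.
  have [r r0 hr] := h _ e20; exists r => // k kr.
  rewrite add0r eqxx; case: eqVneq => [_|k0]; first by rewrite subrr cabs0.
  have k1 : 0 < cabs k by rewrite cabs_gt0.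
  rewrite -(ltr_pM2r k1) -cabsM mulrBl divfK//.
  apply: le_lt_trans (hr k kr) _; rewrite ltr_pM2r//; lra.
- by move=> k; case: eqVneq => [->|k0]; rewrite ?addr0 ?mulr0 ?subrr ?divfK.
Qed.

Lemma cderiv_cont f z d : cderiv f z d -> ccont f z.
Proof.
move=> /cderivP[q [_ cq fq]].
have h : ccont (fun k => f z + q k * k) 0.
  by apply: ccontD; [exact: ccont_cst|apply: ccontM => //; exact: ccont_id].
move=> e e0; have [r r0 hr] := h e e0; exists r => // k /hr.
by rewrite add0r mulr0 addr0 -fq [f z + _]addrC subrK.
Qed.

Lemma cderiv_cst c z : cderiv (fun=> c) z 0.
Proof. by move=> e e0; exists 1 => // k _; rewrite subrr mul0r subr0 cabs0 mulr_ge0 ?cabs_ge0 ?ltW. Qed.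

Lemma cderiv_id z : cderiv id z 1.
Proof. by move=> e e0; exists 1 => // k _; rewrite mul1r (addrC z) addrK subrr cabs0 mulr_ge0 ?cabs_ge0 ?ltW. Qed.

Lemma cderivD f g z c d : cderiv f z c -> cderiv g z d ->
  cderiv (fun x => f x + g x) z (c + d).
Proof.
move=> /cderivP[p [<- cp fp]] /cderivP[q [<- cq gq]]; apply/cderivP.
exists (fun k => p k + q k); split=> //; first exact: ccontD.
by move=> k; rewrite mulrDl -fp -gq; ring.
Qed.

Lemma cderivM f g z c d : cderiv f z c -> cderiv g z d ->
  cderiv (fun x => f x * g x) z (c * g z + f z * d).
Proof.
move=> hf hg; have cg := cderiv_cont hg.
move: hf hg => /cderivP[p [<- cp fp]] /cderivP[q [<- cq gq]]; apply/cderivP.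
exists (fun k => p k * g (z + k) + f z * q k); split=> //.
- by rewrite addr0.
- apply: ccontD; apply: ccontM => //; last exact: ccont_cst.
  by apply: ccont_shift; rewrite addr0.
- by move=> k; rewrite mulrDl mulrAC -fp -[_ * q k * k]mulrA -gq; ring.
Qed.

Lemma cderivZ f a z c : cderiv f z c -> cderiv (fun x => a * f x) z (a * c).
Proof.
move=> hf; have := cderivM (cderiv_cst a z) hf.
by rewrite mul0r add0r.
Qed.

Lemma cderivN f z c : cderiv f z c -> cderiv (fun x => - f x) z (- c).
Proof.
move=> /cderivP[p [<- cp fp]]; apply/cderivP; exists (fun k => - p k).
by split=> //; [exact: ccontN|move=> k; rewrite mulNr -fp opprB opprK addrC].
Qed.

Lemma cderivB f g z c d : cderiv f z c -> cderiv g z d ->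
  cderiv (fun x => f x - g x) z (c - d).
Proof. by move=> hf hg; apply: cderivD => //; exact: cderivN. Qed.

Lemma cderiv_comp f g z c d : cderiv f z c -> cderiv g (f z) d ->
  cderiv (fun x => g (f x)) z (d * c).
Proof.
move=> hf; have cf := cderiv_cont hf.
move: hf => /cderivP[p [<- cp fp]] /cderivP[q [<- cq gq]]; apply/cderivP.
exists (fun k => q (f (z + k) - f z) * p k); split=> //.
- by rewrite addr0 subrr.
- apply: ccontM => //; apply: ccont_comp; last by rewrite addr0 subrr.
  apply: ccontB; last exact: ccont_cst.
  by apply: ccont_shift; rewrite addr0.
- by move=> k; rewrite -mulrA -fp -gq [f z + _]addrC subrK.
Qed.

Lemma cderiv_eq f g z d : (exists2 r : R, 0 < r & forall k, cabs k < r -> f (z + k) = g (z + k)) ->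
  cderiv f z d -> cderiv g z d.
Proof.
move=> [r r0 fg] hf e e0; have [s s0 hs] := hf e e0.
exists (Num.min r s); first by rewrite lt_min r0.
move=> k; rewrite lt_min => /andP[kr ks].
by have := fg 0; rewrite cabs0 addr0 => /(_ r0) <-; rewrite -fg//; exact: hs.
Qed.

Lemma cderivV f z c : f z != 0 -> cderiv f z c ->
  cderiv (fun x => (f x)^-1) z (- c / f z ^+ 2).
Proof.
move=> f0 hf; have cf := cderiv_cont hf.
have := cf (cabs (f z)); rewrite cabs_gt0 => /(_ f0)[r r0 hr].
have fk0 k : cabs k < r -> f (z + k) != 0.
  move=> /hr; apply: contraTneq => ->.
  by rewrite sub0r cabsN ltxx.
move: hf => /cderivP[p [<- cp fp]].
(* The factorization must hold for every [k], also where [f (z + k)] vanishes and its inverse is 0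
   by convention; there the slope is the bare difference quotient. *)
pose G k := if f (z + k) == 0 then (if k == 0 then 0 else ((f (z + k))^-1 - (f z)^-1) / k)
  else - p k / (f (z + k) * f z).
apply/cderivP; exists G; split.
- by rewrite /G addr0 (negbTE f0) expr2.
- have h : ccont (fun k => - p k / (f (z + k) * f z)) 0.
    apply: ccontM; first exact: ccontN.
    apply: ccontV; first by rewrite addr0 mulf_neq0.
    apply: ccontM; last exact: ccont_cst.
    by apply: ccont_shift; rewrite addr0.
  move=> e e0; have [s s0 hs] := h e e0.
  exists (Num.min r s); first by rewrite lt_min r0.
  move=> k; rewrite lt_min => /andP[kr ks].
  rewrite /G add0r addr0 (negbTE f0) (negbTE (fk0 _ kr)).
  by have := hs k ks; rewrite add0r addr0.
- move=> k; rewrite /G; case: eqVneq => [E|fk].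
    case: eqVneq => [k0|k0]; last by rewrite divfK.
    by move: E; rewrite k0 addr0 => E; rewrite E eqxx in f0.
  rewrite mulrAC mulNr -fp; field.
  by rewrite fk f0.
Qed.

Lemma cderiv_unique f z c d : cderiv f z c -> cderiv f z d -> c = d.
Proof. by move=> /cderiv_derivable[_ <-] /cderiv_derivable[_ <-]. Qed.

Lemma cderivX f z c n : cderiv f z c ->
  cderiv (fun x => f x ^+ n) z (n%:R * f z ^+ n.-1 * c).
Proof.
move=> hf; elim: n => [|n IH].
  by rewrite mul0r mul0r; apply: cderiv_eq (cderiv_cst 1 z); exists 1.
have := cderivM hf IH; rewrite /=.
have -> : (fun x => f x * f x ^+ n) = (fun x => f x ^+ n.+1).
  by apply/funext => x; rewrite exprS.
suff -> : c * f z ^+ n + f z * (n%:R * f z ^+ n.-1 * c) = n.+1%:R * f z ^+ n * c by [].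
case: n {IH} => [|n] /=; first by rewrite mulrC; ring.
by rewrite exprS -[n.+2]addn1 natrD; ring.
Qed.

End ccont.

(** * Power series *)

Section real_sums.
Context {R : realType}.
Implicit Types (q e : R).

Lemma sum_geo_le q N : 0 <= q < 1 -> \sum_(n < N) q ^+ n <= (1 - q)^-1.
Proof.
move=> /andP[q0 q1]; have q2 : 0 < 1 - q by rewrite subr_gt0.
rewrite -(ler_pM2l q2) mulfV ?gt_eqF//.
have -> : (1 - q) * \sum_(n < N) q ^+ n = 1 - q ^+ N.
  by rewrite -opprB mulNr -subrX1 opprB.
by rewrite gerBl exprn_ge0.
Qed.

Lemma natmul_geo_le q n : 0 <= q < 1 -> n.+1%:R * q ^+ n <= (1 - q)^-1.
Proof.
move=> h; apply: le_trans (sum_geo_le n.+1 h).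
have /andP[q0 q1] := h.
have -> : n.+1%:R * q ^+ n = \sum_(i < n.+1) q ^+ n.
  by rewrite sumr_const card_ord mulr_natl.
by apply: ler_sum => i _; rewrite ler_wiXn2l ?q0 ?(ltW q1) ?leq_ord.
Qed.

(** The factor [n ^+ 2] is enlarged to [(n + 1) * (n + 2)], whose partial sums against [q ^+ n] have
    a closed form: [(1 - q) ^- 3] times the difference of 2 and a nonnegative remainder. *)
Lemma sum_sqr_geo_le q N : 0 <= q < 1 ->
  \sum_(n < N) (n%:R ^+ 2 * q ^+ n) <= 2 / (1 - q) ^+ 3.
Proof.
move=> /andP[q0 q1]; have q2 : 0 < 1 - q by rewrite subr_gt0.
rewrite ler_pdivlMr ?exprn_gt0//.
suff [E P] : (\sum_(n < N) ((n%:R + 1) * (n%:R + 2) * q ^+ n)) * (1 - q) ^+ 3 =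
    2 - q ^+ N * ((N%:R + 1) * (N%:R + 2) - 2 * N%:R * (N%:R + 2) * q + N%:R * (N%:R + 1) * q ^+ 2)
    /\ 0 <= (N%:R + 1) * (N%:R + 2) - 2 * N%:R * (N%:R + 2) * q + N%:R * (N%:R + 1) * q ^+ 2.
  apply: (@le_trans _ _ (2 - q ^+ N * ((N%:R + 1) * (N%:R + 2) - 2 * N%:R * (N%:R + 2) * q + N%:R * (N%:R + 1) * q ^+ 2))).
    rewrite -E ler_wpM2r ?exprn_ge0 ?(ltW q2)//; apply: ler_sum => i _.
    rewrite ler_wpM2r ?exprn_ge0//.
    have := ler0n R i; nra.
  by rewrite gerBl mulr_ge0// exprn_ge0.
split.
  elim: N => [|N IH]; first by rewrite big_ord0 expr0 mul0r; ring.
  by rewrite big_ord_recr/= mulrDl IH (exprS q N) -[N.+1]addn1 natrD; ring.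
have := ler0n R N; set n := N%:R => n0.
have -> : (n + 1) * (n + 2) - 2 * n * (n + 2) * q + n * (n + 1) * q ^+ 2 =
   n * (n + 1) * (1 - q) ^+ 2 + 2 * n * (1 - q) + 2 by ring.
have n1 : 0 <= n + 1 by lra.
by rewrite !addr_ge0 ?mulr_ge0 ?exprn_ge0 ?(ltW q2).
Qed.

Lemma expr_small q e : 0 <= q < 1 -> 0 < e ->
  exists N0, forall N, (N0 <= N)%N -> q ^+ N <= e.
Proof.
move=> /andP[q0 q1] e0.
have /cvgrPdist_le/(_ e e0) : (q ^+ n) @[n --> \oo] --> 0.
  by apply: cvg_expr; rewrite ger0_norm.
move=> [N0 _ h]; exists N0 => N hN; have := h N hN.
by rewrite sub0r normrN ger0_norm ?exprn_ge0.
Qed.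

End real_sums.

Section power_series.
Context {R : realType}.
Local Notation C := R[i].
Implicit Types (f g : C -> C) (a b : nat -> C) (z w d : C) (r s M : R).

Definition psum a N z := \sum_(n < N) a n * z ^+ n.

(** Only pointwise convergence is asked. Boundedness of the terms at smaller radii recovers the
    geometric rate and the uniformity on smaller discs. *)
Definition has_ps f a r := forall z, cabs z < r -> forall e : R, 0 < e ->
  exists N0, forall N, (N0 <= N)%N -> cabs (f z - psum a N z) <= e.

Definition coef_bounded a r := exists2 M : R, 0 <= M &
  forall n, cabs (a n) * r ^+ n <= M.

(** Each term at the point [s] is a difference of consecutive partial sums, hence at most 2 from
    some index on; the finitely many earlier terms are added to the bound. *)
Lemma has_ps_bounded f a r s : has_ps f a r -> 0 < s < r -> coef_bounded a s.
Proof.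
move=> fa /andP[s0 sr].
have sR : cabs s%:C < r by rewrite cabs_real gtr0_norm.
have [N0 hN] := fa _ sR 1 ltr01.
have big n : (N0 <= n)%N -> cabs (a n) * s ^+ n <= 2.
  move=> hn.
  have -> : cabs (a n) * s ^+ n = cabs (psum a n.+1 s%:C - psum a n s%:C).
    rewrite /psum big_ord_recr/= addrAC subrr add0r cabsM cabsX cabs_real.
    by rewrite gtr0_norm.
  apply: le_trans (cabs_triangle _ _ (f s%:C)) _.
  rewrite cabs_distrC -[2](@addrK _ 1) addrK -[2]/(1 + 1) lerD//.
    by apply: hN; rewrite leqW.
  exact: hN.
exists (2 + \sum_(n < N0) cabs (a n) * s ^+ n).
  by rewrite addr_ge0// sumr_ge0// => i _; rewrite mulr_ge0 ?cabs_ge0// exprn_ge0// ltW.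
move=> n; have pos i : 0 <= cabs (a i) * s ^+ i.
  by rewrite mulr_ge0 ?cabs_ge0// exprn_ge0// ltW.
case: (leqP N0 n) => [/big h|hn].
  by apply: le_trans h _; rewrite lerDl sumr_ge0.
rewrite (bigD1 (Ordinal hn))//= [X in _ <= _ + X]addrC addrA lerDr.
by rewrite addr_ge0// sumr_ge0.
Qed.

Lemma psum_tail a s M z m n : 0 < s -> 0 <= M -> cabs z < s ->
  (forall n, cabs (a n) * s ^+ n <= M) -> (n <= m)%N ->
  cabs (psum a m z - psum a n z) <= M * (cabs z / s) ^+ n / (1 - cabs z / s).
Proof.
move=> s0 M0 zs hM nm; set q := cabs z / s.
have q01 : 0 <= q < 1 by rewrite /q divr_ge0 ?cabs_ge0 ?(ltW s0)//= ltr_pdivrMr// mul1r.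
have -> : psum a m z - psum a n z = \sum_(i < m - n) a (n + i)%N * z ^+ (n + i).
  rewrite /psum -(subnKC nm) big_split_ord /= addrAC subrr add0r addKn.
  by [].
apply: le_trans (ler_cabs_sum _ _ _) _.
apply: (@le_trans _ _ (\sum_(i < m - n) M * q ^+ n * q ^+ i)).
  apply: ler_sum => i _; rewrite cabsM cabsX -mulrA -exprD.
  rewrite [X in _ * X <= _](_ : _ = s ^+ (n + i) * q ^+ (n + i)); last first.
    by rewrite -exprMn /q mulrC divfK// gt_eqF.
  rewrite mulrA ler_wpM2r ?exprn_ge0//; by case/andP: q01.
rewrite -mulr_sumr; apply: ler_wpM2l; last exact: sum_geo_le.
by rewrite mulr_ge0// exprn_ge0//; case/andP: q01.
Qed.

Lemma has_ps_rem f a r s M z n : has_ps f a r -> 0 < s <= r -> 0 <= M ->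
  cabs z < s -> (forall n, cabs (a n) * s ^+ n <= M) ->
  cabs (f z - psum a n z) <= M * (cabs z / s) ^+ n / (1 - cabs z / s).
Proof.
move=> fa /andP[s0 sr] M0 zs hM; apply/ler_addgt0Pr => e e0.
have [N0 hN] := fa z (lt_le_trans zs sr) e e0.
apply: le_trans (cabs_triangle _ _ (psum a (maxn N0 n) z)) _.
rewrite addrC lerD//; first by apply: psum_tail => //; rewrite leq_maxr.
by apply: hN; rewrite leq_maxl.
Qed.

Lemma has_ps_uniform f a r s : has_ps f a r -> 0 <= s < r ->
  forall e : R, 0 < e -> exists N0, forall N z, (N0 <= N)%N -> cabs z <= s ->
  cabs (f z - psum a N z) <= e.
Proof.
move=> fa /andP[s0 sr] e e0; pose t := (s + r) / 2.
have t0 : 0 < t by rewrite /t; lra.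
have tr : t < r by rewrite /t; lra.
have st : s < t by rewrite /t; lra.
have [|M M0 hM] := @has_ps_bounded f a r t fa; first by rewrite t0.
pose q := s / t.
have q01 : 0 <= q < 1 by rewrite /q divr_ge0 ?(ltW t0)//= ltr_pdivrMr// mul1r.
have q1 : 0 < 1 - q by rewrite subr_gt0; case/andP: q01.
have M1 : 0 < M + 1 by rewrite ltr_wpDl.
have E0 : 0 < e * (1 - q) / (M + 1) by rewrite divr_gt0// mulr_gt0.
have [N0 hN] := expr_small q01 E0.
exists N0 => N z hNN zs.
have zq : cabs z / t <= q by rewrite ler_pM2r ?invr_gt0.
have zq0 : 0 <= cabs z / t by rewrite divr_ge0 ?cabs_ge0 ?ltW.
have := @has_ps_rem f a r t M z N fa; rewrite t0 (ltW tr) => /(_ isT M0 (le_lt_trans zs st) hM).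
move=> /le_trans; apply.
apply: (@le_trans _ _ ((M + 1) * q ^+ N / (1 - q))); last first.
  by rewrite ler_pdivrMr// mulrC -ler_pdivlMr//; exact: hN.
apply: ler_pM.
- by rewrite mulr_ge0// exprn_ge0.
- by rewrite invr_ge0 subr_ge0 (le_trans zq)//; case/andP: q01 => _ /ltW.
- rewrite ler_pM ?exprn_ge0//; first by rewrite lerDl.
  by rewrite lerXn2r// nnegrE//; case/andP: q01.
- by rewrite lef_pV2 ?posrE ?(lt_le_trans q1)// lerD2l lerN2.
Qed.

Lemma cvgn_dominated (u : R^nat) (M q : R) : 0 <= q < 1 ->
  (forall n, `|u n| <= M * q ^+ n) -> cvgn (series u).
Proof.
move=> /andP[q0 q1] h; apply: normed_cvg.
apply: (@series_le_cvg _ _ (fun n => M * q ^+ n)) => //.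
- by move=> n /=.
- by move=> n; apply: le_trans (h n).
- by apply: is_cvg_geometric_series; rewrite ger0_norm.
Qed.

Lemma has_ps_exists a r : (forall s : R, 0 < s < r -> coef_bounded a s) ->
  exists f, has_ps f a r.
Proof.
move=> h.
exists (fun z => limn (series (fun n => complex.Re (a n * z ^+ n))) +i*
                 limn (series (fun n => complex.Im (a n * z ^+ n)))).
move=> z zr e e0; pose s := (cabs z + r) / 2.
have s0 : 0 < s by rewrite /s; have := cabs_ge0 z; lra.
have sr : s < r by rewrite /s; lra.
have zs : cabs z < s by rewrite /s; lra.
have [|M M0 hM] := h s; first by rewrite s0.
pose q := cabs z / s.
have q01 : 0 <= q < 1 by rewrite /q divr_ge0 ?cabs_ge0 ?(ltW s0)//= ltr_pdivrMr// mul1r.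
have dom n : cabs (a n * z ^+ n) <= M * q ^+ n.
  rewrite cabsM cabsX [cabs z](_ : _ = s * q); last by rewrite /q mulrC divfK// gt_eqF.
  by rewrite exprMn mulrA ler_wpM2r// exprn_ge0//; case/andP: q01.
have c1 : cvgn (series (fun n => complex.Re (a n * z ^+ n))).
  by apply: (cvgn_dominated q01) => n; exact: le_trans (norm_Re_cabs _) (dom n).
have c2 : cvgn (series (fun n => complex.Im (a n * z ^+ n))).
  by apply: (cvgn_dominated q01) => n; exact: le_trans (norm_Im_cabs _) (dom n).
have e20 : 0 < e / 2 by rewrite divr_gt0.
have /cvgrPdist_le/(_ _ e20)[N1 _ h1] := c1.
have /cvgrPdist_le/(_ _ e20)[N2 _ h2] := c2.
exists (maxn N1 N2) => N; rewrite geq_max => /andP[/h1/= H1 /h2/= H2].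
apply: le_trans (cabs_ReIm _) _.
have -> : e = e / 2 + e / 2 by lra.
have EP : psum a N z = (series (fun n => complex.Re (a n * z ^+ n)) N) +i*
     (series (fun n => complex.Im (a n * z ^+ n)) N).
  rewrite /psum !seriesEord; elim: (N) => [|k IH].
    by rewrite /= !big_ord0.
  by rewrite /= !big_ord_recr /= IH; apply: complexP => /=; case: (_ * _).
by rewrite EP lerD.
Qed.

(** The coefficients of the series differentiated term by term. *)
Definition pshift a n := n.+1%:R * a n.+1.

Lemma coef_bounded_shift a r : (forall s : R, 0 < s < r -> coef_bounded a s) ->
  forall s : R, 0 < s < r -> coef_bounded (pshift a) s.
Proof.
move=> h s /andP[s0 sr]; pose t := (s + r) / 2.
have st : s < t by rewrite /t; lra.
have tr : t < r by rewrite /t; lra.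
have t0 : 0 < t by exact: lt_trans st.
have [|M M0 hM] := h t; first by rewrite t0.
pose q := s / t.
have q01 : 0 <= q < 1 by rewrite /q divr_ge0 ?(ltW s0) ?(ltW t0)//= ltr_pdivrMr// mul1r.
exists (M / t / (1 - q)).
  apply: divr_ge0; first by rewrite divr_ge0// ltW.
  by rewrite subr_ge0; case/andP: q01 => _ /ltW.
move=> n; rewrite /pshift cabsM.
have -> : cabs (n.+1%:R : C) = n.+1%:R.
  by have := cabs_real (n.+1%:R : R); rewrite rmorph_nat ger0_norm.
have -> : s ^+ n = t ^+ n.+1 / t * q ^+ n.
  rewrite [t ^+ n.+1]exprS [t * _]mulrC mulfK ?gt_eqF// -exprMn.
  by rewrite /q mulrC divfK// gt_eqF.
rewrite (_ : _ * _ = (cabs (a n.+1) * t ^+ n.+1) / t * (n.+1%:R * q ^+ n)); last by ring.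
apply: ler_pM; rewrite ?mulr_ge0 ?invr_ge0 ?cabs_ge0 ?exprn_ge0 ?(ltW t0)//.
- by case/andP: q01.
- by rewrite ler_wpM2r// invr_ge0 ltW.
- exact: natmul_geo_le.
Qed.

(** By induction: the remainder for [n.+1] is [z + k] times that for [n], plus
    [n%:R * z ^+ n.-1 * k ^+ 2]. The factor [s ^+ 2] stands on the left to avoid the exponent
    [n - 2]. *)
Lemma powD_remainder (z k : C) (s : R) n : 0 < s -> cabs z <= s -> cabs (z + k) <= s ->
  s ^+ 2 * cabs ((z + k) ^+ n - z ^+ n - n%:R * z ^+ n.-1 * k)
  <= n%:R ^+ 2 * s ^+ n * cabs k ^+ 2.
Proof.
move=> s0 zs zks; elim: n => [|n IH].
  by rewrite !expr0 subrr !mul0r subr0 cabs0 mulr0 expr0n/= !mul0r.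
have -> : (z + k) ^+ n.+1 - z ^+ n.+1 - n.+1%:R * z ^+ n * k =
   (z + k) * ((z + k) ^+ n - z ^+ n - n%:R * z ^+ n.-1 * k) + n%:R * z ^+ n.-1 * k ^+ 2.
  case: n {IH} => [|n] /=; first by rewrite !expr0 !expr1; ring.
  by rewrite !exprS -[n.+2]addn1 natrD; ring.
apply: le_trans (ler_wpM2l _ (ler_cabsD _ _)) _; first by rewrite exprn_ge0// ltW.
rewrite mulrDr.
have h1 : s ^+ 2 * cabs ((z + k) * ((z + k) ^+ n - z ^+ n - n%:R * z ^+ n.-1 * k))
   <= s * (n%:R ^+ 2 * s ^+ n * cabs k ^+ 2).
  rewrite cabsM mulrCA; apply: ler_pM; rewrite ?cabs_ge0// mulr_ge0 ?cabs_ge0// exprn_ge0//.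
  by rewrite ltW.
have h2 : s ^+ 2 * cabs (n%:R * z ^+ n.-1 * k ^+ 2) <= n%:R * s ^+ n.+1 * cabs k ^+ 2.
  rewrite !cabsM !cabsX.
  have -> : cabs (n%:R : C) = n%:R.
    by have := cabs_real (n%:R : R); rewrite rmorph_nat ger0_norm.
  rewrite mulrA ler_wpM2r ?mulr_ge0 ?exprn_ge0 ?cabs_ge0//.
  case: n {IH h1} => [|n]; first by rewrite !mul0r mulr0.
  rewrite /= mulrCA ler_wpM2l//.
  have -> : s ^+ n.+2 = s ^+ 2 * s ^+ n by rewrite -exprD.
  by rewrite ler_wpM2l ?exprn_ge0 ?(ltW s0)// lerXn2r ?nnegrE ?cabs_ge0 ?(ltW s0).
apply: le_trans (lerD h1 h2) _.
rewrite (_ : _ + _ = (n%:R ^+ 2 + n%:R) * s ^+ n.+1 * cabs k ^+ 2); last by rewrite (exprS s n); ring.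
rewrite ler_wpM2r ?exprn_ge0 ?cabs_ge0// ler_wpM2r ?exprn_ge0 ?(ltW s0)//.
by rewrite -[n.+1]addn1 natrD; have := ler0n R n; nra.
Qed.

Lemma psum_shift a N z k : psum a N.+1 (z + k) - psum a N.+1 z - psum (pshift a) N z * k =
  \sum_(n < N.+1) a n * ((z + k) ^+ n - z ^+ n - n%:R * z ^+ n.-1 * k).
Proof.
have -> : psum (pshift a) N z * k = \sum_(n < N.+1) a n * (n%:R * z ^+ n.-1 * k).
  rewrite big_ord_recl /= !mul0r mulr0 add0r /psum mulr_suml.
  by apply: eq_bigr => i _; rewrite /pshift /bump /=; ring.
rewrite /psum -!sumrB; apply: eq_bigr => i _; ring.
Qed.

(** The quadratic remainders of the monomials add up to at most [K * cabs k ^+ 2], with [K]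
    independent of the truncation. The errors of truncating [f] at two points and [g] at one take a
    third of [e] each. *)
Lemma has_ps_cderiv f g a r z : has_ps f a r -> has_ps g (pshift a) r ->
  cabs z < r -> cderiv f z (g z).
Proof.
move=> fa ga zr.
(* Both radii lie strictly between [cabs z] and [r]: the points [z + k] stay within [s], the
   coefficients are controlled at [t], and the ratio [s / t] is the geometric rate. *)
pose s := (2 * cabs z + r) / 3. pose t := (cabs z + 2 * r) / 3.
have z0 := cabs_ge0 z.
have s0 : 0 < s by rewrite /s; lra.
have st : s < t by rewrite /s /t; lra.
have t0 : 0 < t by rewrite /t; lra.
have tr : t < r by rewrite /t; lra.
have sr : s < r by exact: lt_trans tr.
have [|M M0 hM] := has_ps_bounded fa (_ : 0 < t < r); first by rewrite t0.
pose q := s / t.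
have q01 : 0 <= q < 1 by rewrite /q divr_ge0 ?(ltW s0) ?(ltW t0)//= ltr_pdivrMr// mul1r.
pose K := M / s ^+ 2 * (2 / (1 - q) ^+ 3).
have K0 : 0 <= K.
  by rewrite /K mulr_ge0// divr_ge0// exprn_ge0// ?(ltW s0)// subr_ge0; case/andP: q01 => _ /ltW.
have main k : cabs k < s - cabs z -> cabs (f (z + k) - f z - g z * k) <= K * cabs k ^+ 2.
  move=> ks; have zs : cabs z <= s by rewrite /s; lra.
  apply/ler_addgt0Pr => e e0.
  have zks : cabs (z + k) <= s by apply: le_trans (ler_cabsD _ _) _; lra.
  have k1 : 0 < cabs k + 1 by rewrite ltr_wpDl ?cabs_ge0.
  have e3 : 0 < e / 3 / (cabs k + 1) by rewrite !divr_gt0.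
  have e4 : 0 < e / 3 by rewrite divr_gt0.
  have [N1 h1] := fa (z + k) (le_lt_trans zks sr) _ e4.
  have [N2 h2] := fa z zr _ e4.
  have [N3 h3] := ga z zr _ e3.
  pose N := maxn N1 (maxn N2 N3).
  have {}h1 := h1 N.+1 (leqW (leq_maxl _ _)).
  have {}h2 := h2 N.+1 (leqW (leq_trans (leq_maxl _ _) (leq_maxr _ _))).
  have {}h3 := h3 N (leq_trans (leq_maxr _ _) (leq_maxr _ _)).
  rewrite (_ : f (z + k) - f z - g z * k =
     \sum_(n < N.+1) a n * ((z + k) ^+ n - z ^+ n - n%:R * z ^+ n.-1 * k) +
     ((f (z + k) - psum a N.+1 (z + k)) - (f z - psum a N.+1 z) -
      (g z - psum (pshift a) N z) * k)); last by rewrite -psum_shift; ring.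
  apply: le_trans (ler_cabsD _ _) _; apply: lerD.
    apply: le_trans (ler_cabs_sum _ _ _) _.
    apply: (@le_trans _ _ (\sum_(n < N.+1) M / s ^+ 2 * cabs k ^+ 2 * (n%:R ^+ 2 * q ^+ n))).
      apply: ler_sum => i _; rewrite cabsM.
      have := @powD_remainder z k s i s0 zs zks; rewrite -ler_pdivlMl ?exprn_gt0// => hr.
      apply: le_trans (ler_wpM2l (cabs_ge0 _) hr) _.
      rewrite [s ^+ i](_ : _ = t ^+ i * q ^+ i); last by rewrite -exprMn /q mulrC divfK// gt_eqF.
      rewrite [X in X <= _](_ : _ = (cabs (a i) * t ^+ i) * ((s ^+ 2)^-1 * cabs k ^+ 2 * (i%:R ^+ 2 * q ^+ i))); last by ring.
      rewrite [X in _ <= X](_ : _ = M * ((s ^+ 2)^-1 * cabs k ^+ 2 * (i%:R ^+ 2 * q ^+ i))); last by ring.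
      rewrite ler_wpM2r// !mulr_ge0 ?invr_ge0 ?exprn_ge0 ?cabs_ge0 ?(ltW s0) ?ler0n//.
      by case/andP: q01.
    rewrite -mulr_sumr [X in X <= _]mulrAC /K ler_wpM2r ?exprn_ge0 ?cabs_ge0//.
    rewrite ler_wpM2l ?divr_ge0 ?exprn_ge0 ?(ltW s0)//.
    exact: sum_sqr_geo_le.
  apply: le_trans (ler_cabsB _ _) _; rewrite (_ : e = e / 3 + e / 3 + e / 3); last by lra.
  apply: lerD; first by apply: le_trans (ler_cabsB _ _) _; exact: lerD.
  rewrite cabsM; apply: (@le_trans _ _ (e / 3 / (cabs k + 1) * (cabs k + 1))).
    by apply: ler_pM; rewrite ?cabs_ge0// lerDl.
  by rewrite divfK// gt_eqF.
move=> e e0; exists (Num.min (s - cabs z) (e / (K + 1))).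
  rewrite lt_min; apply/andP; split; first by rewrite /s; lra.
  by rewrite divr_gt0// ltr_wpDl.
move=> k; rewrite lt_min => /andP[k1 k2]; apply: le_trans (main k k1) _.
rewrite expr2 mulrA ler_wpM2r ?cabs_ge0//.
apply: (@le_trans _ _ ((K + 1) * cabs k)); first by rewrite ler_wpM2r ?cabs_ge0// lerDl.
by rewrite mulrC -ler_pdivlMr ?ltr_wpDl// ltW.
Qed.

Lemma has_ps_deriv f a r : has_ps f a r -> exists2 g, has_ps g (pshift a) r &
  forall z, cabs z < r -> cderiv f z (g z).
Proof.
move=> fa; have [g hg] : exists g, has_ps g (pshift a) r.
  by apply/has_ps_exists/coef_bounded_shift => s hs; exact: has_ps_bounded fa hs.
by exists g => // z zr; exact: has_ps_cderiv fa hg zr.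
Qed.

Lemma has_ps_eq f g a r : (forall z, cabs z < r -> f z = g z) -> has_ps f a r -> has_ps g a r.
Proof. by move=> fg h z zr; rewrite -fg//; exact: h. Qed.

Lemma has_ps0 f a r : 0 < r -> has_ps f a r -> f 0 = a 0%N.
Proof.
move=> r0 h; apply/eqP; rewrite -subr_eq0 -cabs_eq0 eq_le cabs_ge0 andbT.
apply/ler_addgt0Pr => e e0; rewrite add0r.
have [|N0 hN] := h 0 _ e e0; first by rewrite cabs0.
have := hN N0.+1 (leqnSn _); rewrite /psum big_ord_recl big1 ?expr0 ?mulr1 ?addr0// => i _.
by rewrite /= /bump exprS mul0r mulr0.
Qed.

(** The value at 0 gives the constant coefficient, and differentiation lowers the index of the
    others. *)
Lemma has_ps_unique f a b r : 0 < r -> has_ps f a r -> has_ps f b r -> a =1 b.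
Proof.
move=> r0 fa fb n; elim: n f a b fa fb => [|n IH] f a b fa fb.
  by rewrite -(has_ps0 r0 fa) -(has_ps0 r0 fb).
have [g ga hg] := has_ps_deriv fa; have [h hb hh] := has_ps_deriv fb.
have gh z : cabs z < r -> h z = g z.
  by move=> zr; apply: cderiv_unique (hh z zr) (hg z zr).
have := IH g _ _ ga (has_ps_eq gh hb); rewrite /pshift => /mulfI; apply.
by rewrite pnatr_eq0.
Qed.

End power_series.

(** * A bisection lemma and integration of complex functions of a real variable *)

Section bisection.
Context {R : realType}.
Implicit Types (Q : (R * R) * (R * R)).

(* [T] is a defect on rectangles [a, b] x [c, d]. *)
Lemma bisection_le0 (T : (R * R) * (R * R) -> R) (a b c d : R) :
  a <= b -> c <= d ->
  (forall a' b' c' d' : R, a <= a' -> a' <= b' -> b' <= b -> c <= c' -> c' <= d' -> d' <= d ->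
    let m := (a' + b') / 2 in let n := (c' + d') / 2 in
    T ((a', b'), (c', d')) <= T ((a', m), (c', n)) + T ((m, b'), (c', n)) +
                              T ((a', m), (n, d')) + T ((m, b'), (n, d'))) ->
  (forall x y : R, a <= x <= b -> c <= y <= d -> forall e : R, 0 < e ->
    exists2 r : R, 0 < r & forall a' b' c' d' : R,
      a <= a' <= x -> x <= b' <= b -> c <= c' <= y -> y <= d' <= d ->
      b' - a' < r -> d' - c' < r ->
      T ((a', b'), (c', d')) <= e * ((b' - a') + (d' - c')) ^+ 2) ->
  T ((a, b), (c, d)) <= 0.
Proof.
move=> ab cd hsub hloc; rewrite leNgt; apply/negP => T0.
pose S Q := (Q.1.2 - Q.1.1) + (Q.2.2 - Q.2.1).
pose Q0 := ((a, b), (c, d)) : (R * R) * (R * R).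
(* Small enough for the initial rectangle to violate [T Q <= e * S Q ^+ 2]; the [+ 1] avoids a
   division by 0 when the rectangle is a point. *)
pose e := T Q0 / (S Q0 ^+ 2 + 1).
have S1 : 0 < S Q0 ^+ 2 + 1 by rewrite ltr_wpDl// sqr_ge0.
have e0 : 0 < e by rewrite divr_gt0.
pose bad Q := e * S Q ^+ 2 < T Q.
have bad0 : bad Q0.
  rewrite /bad /e mulrAC ltr_pdivrMr// ltr_pM2l// ltrDl; lra.
pose ch (i j : bool) Q : (R * R) * (R * R) :=
  let m := (Q.1.1 + Q.1.2) / 2 in let n := (Q.2.1 + Q.2.2) / 2 in
  (if i then (m, Q.1.2) else (Q.1.1, m), if j then (n, Q.2.2) else (Q.2.1, n)).
(* The last quarter is chosen untested: it is necessarily bad when the other three are not. *)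
pose nx Q := if bad (ch false false Q) then ch false false Q
  else if bad (ch true false Q) then ch true false Q
  else if bad (ch false true Q) then ch false true Q else ch true true Q.
pose I Q := [/\ a <= Q.1.1, Q.1.1 <= Q.1.2, Q.1.2 <= b & [/\ c <= Q.2.1, Q.2.1 <= Q.2.2 & Q.2.2 <= d]].
pose q n := iter n nx Q0.
have nxch Q : exists i j, nx Q = ch i j Q.
  rewrite /nx; case: ifP => _; first by exists false, false.
  case: ifP => _; first by exists true, false.
  by case: ifP => _; [exists false, true|exists true, true].
have chI i j Q : I Q -> I (ch i j Q).
  case: Q => [[a' b'] [c' d']] [/= h1 h2 h3 [h4 h5 h6]].
  have [m1 m2] : a' <= (a' + b') / 2 /\ (a' + b') / 2 <= b' by lra.
  have [n1 n2] : c' <= (c' + d') / 2 /\ (c' + d') / 2 <= d' by lra.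
  by case: i; case: j; split => //=; (try split => //); apply: le_trans; eassumption.
(* [S] is halved in each quarter, so its square is divided by four and the bounds of the four
   quarters add up to the bound of [Q]. *)
have badnx Q : I Q -> bad Q -> bad (nx Q).
  move=> IQ bQ; rewrite /nx; case: ifP => // n1; case: ifP => // n2; case: ifP => // n3.
  apply/negPn/negP => n4; move: bQ; rewrite /bad ltNge => /negP; apply.
  case: Q IQ n1 n2 n3 n4 => [[a' b'] [c' d']] [/= h1 h2 h3 [h4 h5 h6]].
  rewrite /bad => /negbT; rewrite -leNgt => n1 /negbT; rewrite -leNgt => n2.
  move=> /negbT; rewrite -leNgt => n3; rewrite -leNgt => n4.
  have := hsub a' b' c' d' h1 h2 h3 h4 h5 h6; cbv zeta; move=> hs.
  apply: le_trans hs _; move: n1 n2 n3 n4; rewrite /ch /S /=.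
  move=> n1 n2 n3 n4; apply: le_trans (lerD (lerD (lerD n1 n2) n3) n4) _.
  rewrite le_eqVlt; apply/orP; left; apply/eqP; by field.
have Iq n : I (q n).
  elim: n => [|n IH]; first by split=> //=; split.
  by rewrite /q /= -/(q n); have [i [j ->]] := nxch (q n); exact: chI.
have badq n : bad (q n).
  by elim: n => [|n IH]; [exact: bad0|apply: badnx; [exact: Iq|exact: IH]].
have Sq n : (q n).1.2 - (q n).1.1 = (b - a) / 2 ^+ n /\
            (q n).2.2 - (q n).2.1 = (d - c) / 2 ^+ n.
  elim: n => [|n [IH1 IH2]]; first by rewrite /= expr0 !divr1.
  rewrite /q /= -/(q n); have [i [j ->]] := nxch (q n).
  rewrite exprS !invfM ![(_ - _) * (_ * _)]mulrCA -IH1 -IH2.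
  by case: i; case: j => /=; split; field.
have mono n : (q n).1.1 <= (q n.+1).1.1 /\ (q n.+1).1.2 <= (q n).1.2 /\
              (q n).2.1 <= (q n.+1).2.1 /\ (q n.+1).2.2 <= (q n).2.2.
  have [h1 h2 h3 [h4 h5 h6]] := Iq n.
  rewrite /q /= -/(q n); have [i [j ->]] := nxch (q n).
  by case: i; case: j => /=; lra.
have nest (u v : nat -> R) : (forall n, u n <= u n.+1) -> (forall n, v n.+1 <= v n) ->
    (forall n, u n <= v n) -> exists x, forall n, u n <= x <= v n.
  move=> hu hv huv.
  have um m n : (m <= n)%N -> u m <= u n.
    move=> /subnK <-; elim: (n - m)%N => [|k IH]; first by rewrite add0n.
    by rewrite addSn; exact: le_trans IH (hu _).
  have vm m n : (m <= n)%N -> v n <= v m.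
    move=> /subnK <-; elim: (n - m)%N => [|k IH]; first by rewrite add0n.
    by rewrite addSn; exact: le_trans (hv _) IH.
  have uv m n : u m <= v n.
    apply: le_trans (um m (maxn m n) (leq_maxl _ _)) _.
    by apply: le_trans (huv _) (vm n _ (leq_maxr _ _)).
  have hs : has_sup (range u).
    by split; [exists (u 0%N), 0%N|exists (v 0%N) => _ [m _ <-]; exact: uv].
  exists (sup (range u)) => n; apply/andP; split.
    by apply: ub_le_sup; [case: hs|exists n].
  by apply: ge_sup; [case: hs|move=> _ [m _ <-]; exact: uv].
have [x hx] := nest (fun n => (q n).1.1) (fun n => (q n).1.2) (fun n => (mono n).1)
  (fun n => (mono n).2.1) (fun n => let: And4 _ h _ _ := Iq n in h).
have [y hy] := nest (fun n => (q n).2.1) (fun n => (q n).2.2) (fun n => (mono n).2.2.1)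
  (fun n => (mono n).2.2.2) (fun n => let: And4 _ _ _ (And3 _ h _) := Iq n in h).
(* At the common point of the nested rectangles the local hypothesis, for the same [e], contradicts
   their badness once their sides are shorter than [r]. *)
have [r r0 hr] := hloc x y (hx 0%N) (hy 0%N) e e0.
have half01 : 0 <= (2^-1 : R) < 1 by lra.
have M0 : 0 < (b - a) + (d - c) + 1 by lra.
have [n hn] := expr_small half01 (divr_gt0 r0 (mulr_gt0 (ltr0n R 2) M0)).
have {}hn := hn n (leqnn n).
have [E1 E2] := Sq n.
have p0 : 0 < (2^-1 : R) ^+ n by rewrite exprn_gt0.
have small u : 0 <= u -> u <= (b - a) + (d - c) -> u / 2 ^+ n < r.
  move=> u0 uM; rewrite -exprVn.
  apply: (@le_lt_trans _ _ (((b - a) + (d - c) + 1) * (2^-1) ^+ n)).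
    by rewrite ler_wpM2r ?(ltW p0)//; lra.
  rewrite mulrC -ltr_pdivlMr//; apply: le_lt_trans hn _.
  rewrite invfM mulrA ltr_pM2r ?invr_gt0//; lra.
have [h1 h2 h3 [h4 h5 h6]] := Iq n.
have := badq n; rewrite /bad ltNge => /negP; apply.
move: h1 h2 h3 h4 h5 h6 E1 E2 (hx n) (hy n); rewrite /S.
case: (q n) => [[a' b'] [c' d']] /= h1 h2 h3 h4 h5 h6 E1 E2 /andP[x1 x2] /andP[y1 y2].
apply: hr; rewrite ?h1 ?x1 ?x2 ?h3 ?h4 ?y1 ?y2 ?h6//.
  by rewrite E1; apply: small; lra.
by rewrite E2; apply: small; lra.
Qed.

End bisection.

(** * Integrals of complex functions of a real variable *)

Section complex_integral.
Context {R : realType}.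
Local Notation C := R[i].
Local Notation mu := (@lebesgue_measure R).
Implicit Types (g h : R -> C) (a b c x : R).

Definition ccon g x := {for x, continuous g}.

Lemma cconP g x : ccon g x <-> forall e : R, 0 < e -> \forall y \near x, cabs (g y - g x) < e.
Proof.
split => [/cvgrPdist_lt h e e0|h].
  have := h e%:C; rewrite ltcR => /(_ e0); apply: filterS => y.
  by rewrite normC_cabs ltcR cabs_distrC.
rewrite /ccon /prop_for /continuous_at; apply/(@cvgrPdist_lt _ _ _ (nbhs x)) => _ /gtc0P[e e0 ->].
by apply: filterS (h e e0) => y; rewrite normC_cabs ltcR cabs_distrC.
Qed.

Lemma ccon_Re g x : ccon g x -> {for x, continuous (fun y => complex.Re (g y))}.
Proof.
move=> /cconP h; apply/(@cvgrPdist_lt _ _ _ (nbhs x)) => e e0.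
apply: filterS (h e e0) => y; apply: le_lt_trans.
by rewrite distrC; have := norm_Re_cabs (g y - g x); case: (g y) (g x) => ? ? [].
Qed.

Lemma ccon_Im g x : ccon g x -> {for x, continuous (fun y => complex.Im (g y))}.
Proof.
move=> /cconP h; apply/(@cvgrPdist_lt _ _ _ (nbhs x)) => e e0.
apply: filterS (h e e0) => y; apply: le_lt_trans.
by rewrite distrC; have := norm_Im_cabs (g y - g x); case: (g y) (g x) => ? ? [].
Qed.

Lemma ccon_ReIm g x : {for x, continuous (fun y => complex.Re (g y))} ->
  {for x, continuous (fun y => complex.Im (g y))} -> ccon g x.
Proof.
move=> /cvgrPdist_lt h1 /cvgrPdist_lt h2; apply/cconP => e e0.
have e20 : 0 < e / 2 by rewrite divr_gt0.
apply: filterS2 (h1 _ e20) (h2 _ e20) => y.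
rewrite distrC => H1; rewrite distrC => H2; apply: le_lt_trans (cabs_ReIm _) _.
rewrite (_ : e = e / 2 + e / 2); last by lra.
by apply: ltrD; [move: H1|move: H2]; case: (g y) (g x) => ? ? [].
Qed.

Lemma ccon_cst (z : C) x : ccon (fun=> z) x.
Proof. exact: cst_continuous. Qed.

Lemma cconD g h x : ccon g x -> ccon h x -> ccon (fun y => g y + h y) x.
Proof. exact: cvgD. Qed.

Lemma cconB g h x : ccon g x -> ccon h x -> ccon (fun y => g y - h y) x.
Proof. exact: cvgB. Qed.

Lemma cconM g h x : ccon g x -> ccon h x -> ccon (fun y => g y * h y) x.
Proof. exact: cvgM. Qed.

Lemma cconV g x : g x != 0 -> ccon g x -> ccon (fun y => (g y)^-1) x.
Proof. exact: cvgV. Qed.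

Lemma ccon_comp (f : C -> C) g x : ccon g x -> ccont f (g x) -> ccon (fun y => f (g y)) x.
Proof.
move=> /cconP hg hf; apply/cconP => e e0; have [r r0 hr] := hf e e0.
by apply: filterS (hg r r0) => y /hr; rewrite subrKC.
Qed.

Lemma ccon_real x : ccon (fun y : R => y%:C) x.
Proof. by apply: ccon_ReIm; [exact: cvg_id|exact: cst_continuous]. Qed.

Lemma ccon_cabs g x : ccon g x -> {for x, continuous (fun y => cabs (g y))}.
Proof.
move=> /cconP h; apply/(@cvgrPdist_lt _ _ _ (nbhs x)) => e e0.
apply: filterS (h e e0) => y; apply: le_lt_trans.
rewrite ler_norml; apply/andP; split.
  by rewrite lerNl opprB; exact: ler_cabs_dist.
by rewrite cabs_distrC; exact: ler_cabs_dist.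
Qed.

Lemma ccon_bounded g a b : a <= b -> (forall x, a <= x <= b -> ccon g x) ->
  exists2 M : R, 0 <= M & forall x, a <= x <= b -> cabs (g x) <= M.
Proof.
move=> ab hg.
have hc : {within `[a, b], continuous (fun x => cabs (g x))}.
  apply: continuous_in_subspaceT => x; rewrite inE/= in_itv/= => xab.
  exact/ccon_cabs/hg.
have [m _ hm] := EVT_max ab hc.
exists (cabs (g m)); first exact: cabs_ge0.
by move=> x xab; apply: hm; rewrite in_itv.
Qed.

Definition cint a b g : C :=
  (\int[mu]_(x in `[a, b]) complex.Re (g x))%R +i* (\int[mu]_(x in `[a, b]) complex.Im (g x))%R.

Definition on_itv (P : R -> Prop) a b := forall x, a <= x <= b -> P x.

Lemma ccon_integrable g a b : on_itv (ccon g) a b ->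
  mu.-integrable `[a, b] (EFin \o (fun x => complex.Re (g x))) /\
  mu.-integrable `[a, b] (EFin \o (fun x => complex.Im (g x))).
Proof.
move=> hg; split; apply: continuous_compact_integrable; try exact: segment_compact;
  apply: continuous_in_subspaceT => x; rewrite inE/= in_itv/= => xab.
  exact/ccon_Re/hg.
exact/ccon_Im/hg.
Qed.

Lemma eq_cint g h a b : (forall x, a <= x <= b -> g x = h x) -> cint a b g = cint a b h.
Proof.
move=> gh; rewrite /cint; congr (_ +i* _); apply: eq_Rintegral => x;
  by rewrite inE/= in_itv/= => /gh ->.
Qed.

Lemma cintD g h a b : on_itv (ccon g) a b -> on_itv (ccon h) a b ->
  cint a b (fun x => g x + h x) = cint a b g + cint a b h.
Proof.
move=> /ccon_integrable[g1 g2] /ccon_integrable[h1 h2]; rewrite /cint.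
apply: complexP => /=; rewrite -RintegralD//; apply: eq_Rintegral => x _;
  by case: (g x) (h x) => ? ? [].
Qed.

Lemma cintZ g (z : C) a b : on_itv (ccon g) a b ->
  cint a b (fun x => z * g x) = z * cint a b g.
Proof.
move=> /ccon_integrable[g1 g2]; rewrite /cint; case: z => u v.
have Z (r : R) (F : R -> R) : mu.-integrable `[a, b] (EFin \o F) ->
    mu.-integrable `[a, b] (EFin \o (fun x => r * F x)).
  by move=> hF; exact: (integrableZl _ r hF).
apply: complexP => /=.
  rewrite -!RintegralZl// -RintegralB//; [|exact: Z|exact: Z].
  by apply: eq_Rintegral => x _; case: (g x).
rewrite -!RintegralZl// -RintegralD//; [|exact: Z|exact: Z].
by apply: eq_Rintegral => x _; case: (g x).
Qed.

Lemma cintB g h a b : on_itv (ccon g) a b -> on_itv (ccon h) a b ->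
  cint a b (fun x => g x - h x) = cint a b g - cint a b h.
Proof.
move=> hg hh; have <- : cint a b (fun x => -1 * h x) = - cint a b h by rewrite cintZ// mulN1r.
transitivity (cint a b (fun x => g x + -1 * h x)).
  by apply: eq_cint => x _; rewrite mulN1r.
apply: (cintD hg) => x xab.
by apply: cconM; [exact: ccon_cst|exact: hh].
Qed.

Lemma cint_split g a b c : a <= c <= b -> on_itv (ccon g) a b ->
  cint a b g = cint a c g + cint c b g.
Proof.
move=> /andP[ac cb] /ccon_integrable[g1 g2]; rewrite /cint.
have sub (F : R -> R) : mu.-integrable `[a, b] (EFin \o F) ->
  (\int[mu]_(x in `[a, b]) F x = \int[mu]_(x in `[a, c]) F x + \int[mu]_(x in `[c, b]) F x)%R.
  move=> hF; have := @Rintegral_itvB _ F (BLeft a) (BRight b) c hF.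
  rewrite !bnd_simp => /(_ ac cb) => H.
  rewrite -[RHS]/(_ + _) -(@Rintegral_itv_obnd_cbnd _ c (BRight b)); last first.
    by apply: integrableS hF => //; apply: subset_itvr; rewrite bnd_simp.
  by rewrite -H addrC subrK.
by apply: complexP; rewrite /= -sub.
Qed.

(** Bounding the real and imaginary parts separately would lose a constant. With [I] the integral,
    [cabs I ^+ 2] is the real part of the integral of [I^* * g]. *)
Lemma cint_bound g a b (M : R) : a <= b -> on_itv (ccon g) a b ->
  (forall x, a <= x <= b -> cabs (g x) <= M) -> cabs (cint a b g) <= M * (b - a).
Proof.
move=> ab hg hM; set I := cint a b g.
have [I0|I0] := eqVneq I 0.
  rewrite I0 cabs0 mulr_ge0 ?subr_ge0//.
  by apply: le_trans (cabs_ge0 _) (hM a _); rewrite lexx.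
have I1 : 0 < cabs I by rewrite cabs_gt0.
rewrite -(ler_pM2l I1).
have -> : cabs I * cabs I = complex.Re (cint a b (fun x => I^* * g x)).
  by rewrite cintZ// -/I [I^* * I]mulrC -cabs_mulJ -expr2.
have h2 : on_itv (ccon (fun x => I^* * g x)) a b.
  by move=> x xab; apply: cconM; [exact: ccon_cst|exact: hg].
have [g1 _] := ccon_integrable h2.
rewrite [X in X <= _]/= mulrA.
apply: (@le_trans _ _ (\int[mu]_(x in `[a, b]) (cabs I * M))%R).
  apply: le_Rintegral => //.
    apply: continuous_compact_integrable; first exact: segment_compact.
    by apply: continuous_subspaceT => x; exact: cst_continuous.
  move=> x /=; rewrite in_itv/= => xab.
  apply: le_trans (ler_norm _) _; apply: le_trans (norm_Re_cabs _) _.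
  by rewrite cabsM cabsJ ler_wpM2l ?cabs_ge0// hM.
rewrite Rintegral_cst//= lebesgue_measure_itv/= lte_fin.
case: ltP => [_|ba]; first by rewrite /= lexx.
by have -> : a = b by [apply/eqP; rewrite eq_le ab]; rewrite subrr.
Qed.

End complex_integral.

(** * Cauchy's formula, Taylor expansion and the maximum principle *)

Section cis.
Context {R : realType}.
Local Notation C := R[i].
Implicit Types (a b x y : R).

Definition cis x : C := cos x +i* sin x.

Lemma cisD x y : cis (x + y) = cis x * cis y.
Proof. by rewrite /cis cosD sinD; simpc; congr (_ +i* _); ring. Qed.

Lemma cis0 : cis 0 = 1.
Proof. by rewrite /cis cos0 sin0. Qed.

Lemma cabs_cis x : cabs (cis x) = 1.
Proof. by rewrite /cabs /= cos2Dsin2 sqrtr1. Qed.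

Lemma cis_neq0 x : cis x != 0.
Proof. by rewrite -cabs_gt0 cabs_cis. Qed.

Lemma cisN x : cis (- x) = (cis x)^-1.
Proof. by apply: (mulfI (cis_neq0 x)); rewrite -cisD subrr cis0 mulfV// cis_neq0. Qed.

Lemma cisX x n : cis x ^+ n = cis (n%:R * x).
Proof.
elim: n => [|n IH]; first by rewrite mul0r cis0.
by rewrite exprS IH -cisD -[n.+1]addn1 natrD mulrDl mul1r addrC.
Qed.

Lemma cis2pi : cis (2 * pi) = 1.
Proof. by rewrite /cis mulr_natl cos2pi sin2pi. Qed.

Lemma ccon_cis x : ccon cis x.
Proof. by apply: ccon_ReIm; [exact: continuous_cos|exact: continuous_sin]. Qed.

Lemma cint_FTC (G g : R -> C) a b : a <= b -> (forall x, ccon g x) ->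
  (forall x, is_derive x 1 (fun y => complex.Re (G y)) (complex.Re (g x))) ->
  (forall x, is_derive x 1 (fun y => complex.Im (G y)) (complex.Im (g x))) ->
  cint a b g = G b - G a.
Proof.
rewrite le_eqVlt => /predU1P[->|ab] cg dR dI.
  by rewrite subrr /cint set_itv1 !Rintegral_set1.
have F (u v : R -> R) : (forall x, is_derive x 1 u (v x)) -> (forall x, {for x, continuous v}) ->
    (\int[lebesgue_measure]_(x in `[a, b]) v x = u b - u a)%R.
  move=> du cv; have cu x : {for x, continuous u}.
    by apply: differentiable_continuous; apply/derivable1_diffP; exact: ex_derive.
  rewrite /Rintegral (@continuous_FTC2 _ v u)//.
  - by apply: continuous_subspaceT => x; exact: cv.
  - split; first by move=> x _; exact: ex_derive.
      by apply: cvg_at_right_filter; exact: cu.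
    by apply: cvg_at_left_filter; exact: cu.
  - by move=> x _; rewrite derive1E; exact: derive_val.
rewrite /cint (F _ _ dR) 1?(F _ _ dI)//.
- by case: (G b) (G a) => ? ? [].
- by move=> x; exact: ccon_Im.
- by move=> x; exact: ccon_Re.
Qed.

Lemma ccon_cisM (k x : R) : ccon (fun t => cis (k * t)) x.
Proof.
apply: ccon_ReIm => /=.
  by apply: (@continuous_comp _ _ _ (fun t => k * t) cos); [exact: mulrl_continuous|exact: continuous_cos].
by apply: (@continuous_comp _ _ _ (fun t => k * t) sin); [exact: mulrl_continuous|exact: continuous_sin].
Qed.

Lemma is_deriveMk (k x : R) : is_derive x 1 (fun t => k * t) k.
Proof.
have := @is_deriveZ _ _ _ id k x 1 1 _.
by rewrite /GRing.scale /= mulr1; apply.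
Qed.

Lemma cint_cis (k a b : R) : a <= b ->
  cint a b (fun t => (0 +i* k) * cis (k * t)) = cis (k * b) - cis (k * a).
Proof.
move=> ab; apply: (cint_FTC (G := fun t => cis (k * t))) => //.
- by move=> x; apply: cconM; [exact: ccon_cst|exact: ccon_cisM].
- move=> x /=; have -> : 0 * cos (k * x) - k * sin (k * x) = (- sin (k * x)) * k by ring.
  apply: (@is_derive1_comp _ cos (fun t => k * t)).
  exact: is_deriveMk.
- move=> x /=; have -> : 0 * sin (k * x) + k * cos (k * x) = cos (k * x) * k by ring.
  apply: (@is_derive1_comp _ sin (fun t => k * t)).
  exact: is_deriveMk.
Qed.

Lemma cis_lipschitz x y : cabs (cis x - cis y) <= `|x - y|.
Proof.
wlog yx : x y / y <= x.
  move=> h; case: (leP y x) => [/h//|/ltW /h].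
  by rewrite cabs_distrC distrC.
have := @cint_cis 1 y x yx; rewrite !mul1r => <-.
have c x0 : ccon (fun t => (0 +i* 1) * cis (1 * t)) x0.
  by apply: cconM; [exact: ccon_cst|exact: ccon_cisM].
rewrite ger0_norm ?subr_ge0// -[leRHS]mul1r.
apply: cint_bound => // t _.
by rewrite cabsM cabs_cis mulr1 /cabs/= expr0n/= add0r expr1n sqrtr1.
Qed.

Lemma cint1 a b : a <= b -> cint a b (fun=> 1) = (b - a)%:C.
Proof.
move=> ab; rewrite rmorphB; apply: (cint_FTC (G := fun x => x%:C)) => //.
  by move=> x; exact: ccon_cst.
by move=> x /=; exact: is_derive_cst.
Qed.

Lemma cint_cis_period n : cint 0 (2 * pi) (fun t => (cis t)^-1 ^+ n) =
  if n == 0%N then (2 * pi)%:C else 0.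
Proof.
have p0 : 0 <= 2 * pi :> R by rewrite mulr_ge0// pi_ge0.
case: eqP => [->|/eqP n0].
  rewrite (@eq_cint _ _ (fun=> 1)); last by move=> x _; rewrite expr0.
  by rewrite cint1// subr0.
pose k : R := - n%:R.
have k0 : (0 +i* k : C) != 0 by rewrite eq_complex /= oppr_eq0 pnatr_eq0 (negbTE n0) andbF.
have E t : (cis t)^-1 ^+ n = cis (k * t).
  by rewrite -cisN cisX /k mulrN mulNr.
rewrite (@eq_cint _ _ (fun t => cis (k * t))); last by move=> t _; exact: E.
apply: (mulfI k0); rewrite mulr0 -cintZ; last by move=> x _; exact: ccon_cisM.
rewrite cint_cis// mulr0 cis0 -E.
by rewrite cis2pi invr1 expr1n subrr.
Qed.

End cis.

(** * Cauchy's formula in the unit disc, by contracting the circle to a point *)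

Section cauchy.
Context {R : realType}.
Local Notation C := R[i].
Variables (f : C -> C) (r0 : R) (w : C).
Hypothesis r1 : 1 < r0.
Hypothesis df : forall z, cabs z < r0 -> exists d, cderiv f z d.
Hypothesis w1 : cabs w < 1.
Implicit Types (g h : C -> C) (a b c d m n t x y : R).

(** The homothety [H] contracts the unit circle to [w]. Along it the form dz / (z - w) becomes
    [dt / t + k x dx], so [J g a b c d] is the integral of g(z) dz / (z - w) over the positively
    oriented boundary of [[a, b] x [c, d]] in the coordinates [(t, x)]. *)
Let H t x : C := w + t%:C * (cis x - w).
Let k x : C := (0 +i* 1) * cis x / (cis x - w).
Let U (g : C -> C) t c d := cint c d (fun x => g (H t x) * k x).
Let V (g : C -> C) x a b := cint a b (fun t => g (H t x) / t%:C).
Let J g a b c d := (U g b c d - U g a c d) - (V g d a b - V g c a b).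

Let cisw x : cis x - w != 0.
Proof.
rewrite subr_eq0; apply: contraTneq w1 => <-.
by rewrite cabs_cis ltxx.
Qed.

Let H1 t x : 0 <= t <= 1 -> cabs (H t x) <= 1.
Proof.
move=> /andP[t0 t1]; have -> : H t x = (1 - t)%:C * w + t%:C * cis x.
  by rewrite /H rmorphB /=; ring.
apply: le_trans (ler_cabsD _ _) _.
rewrite !cabsM !cabs_real cabs_cis !ger0_norm ?subr_ge0//.
have h : (1 - t) * cabs w <= (1 - t) * 1 by rewrite ler_wpM2l ?subr_ge0// ltW.
lra.
Qed.

Let ck x : ccon k x.
Proof.
apply: cconM; first by apply: cconM; [exact: ccon_cst|exact: ccon_cis].
by apply: cconV => //; apply: cconB; [exact: ccon_cis|exact: ccon_cst].
Qed.

Let cHx t x : ccon (H t) x.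
Proof.
apply: cconD; first exact: ccon_cst.
apply: cconM; first exact: ccon_cst.
by apply: cconB; [exact: ccon_cis|exact: ccon_cst].
Qed.

Let cHt t x : ccon (fun t => H t x) t.
Proof.
apply: cconD; first exact: ccon_cst.
by apply: cconM; [exact: ccon_real|exact: ccon_cst].
Qed.

Definition cont1 (g : C -> C) := forall z, cabs z <= 1 -> ccont g z.

Let cU g t x : cont1 g -> 0 <= t <= 1 -> ccon (fun x => g (H t x) * k x) x.
Proof.
move=> cg t01; apply: cconM => //; apply: ccon_comp => //; exact/cg/H1.
Qed.

Let cV g t x : cont1 g -> 0 < t <= 1 -> ccon (fun t => g (H t x) / t%:C) t.
Proof.
move=> cg /andP[t0 t1]; apply: cconM.
  by apply: ccon_comp => //; apply/cg/H1; rewrite ltW.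
apply: cconV; last exact: ccon_real.
by rewrite -cabs_gt0 cabs_real normr_gt0 gt_eqF.
Qed.

Let JD g h a b c d : cont1 g -> cont1 h -> 0 < a <= b -> b <= 1 -> c <= d ->
  J (fun z => g z + h z) a b c d = J g a b c d + J h a b c d.
Proof.
move=> cg ch /andP[a0 ab] b1 cd.
have UE t : 0 <= t <= 1 -> U (fun z => g z + h z) t c d = U g t c d + U h t c d.
  move=> t01; rewrite /U -cintD; [|by move=> x _; exact: cU..].
  by apply: eq_cint => x _; rewrite mulrDl.
have VE x : V (fun z => g z + h z) x a b = V g x a b + V h x a b.
  rewrite /V -cintD; first by apply: eq_cint => t _; rewrite mulrDl.
    by move=> t /andP[? ?]; apply: cV => //; lra.
  by move=> t /andP[? ?]; apply: cV => //; lra.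
have a01 : 0 <= a <= 1 by lra.
have b01 : 0 <= b <= 1 by lra.
by rewrite /J !UE// !VE; ring.
Qed.

Let J_split g a b c d m n : cont1 g -> 0 < a <= m -> m <= b <= 1 -> c <= n <= d ->
  J g a b c d = J g a m c n + J g m b c n + J g a m n d + J g m b n d.
Proof.
move=> cg am /andP[mb b1] cnd.
have UE t : 0 <= t <= 1 -> U g t c d = U g t c n + U g t n d.
  by move=> t01; apply: cint_split => // x _; exact: cU.
have VE x : V g x a b = V g x a m + V g x m b.
  by apply: cint_split => [|t tab]; [lra|apply: cV => //; lra].
have a01 : 0 <= a <= 1 by lra.
have b01 : 0 <= b <= 1 by lra.
rewrite /J !UE// !VE.
move: (U g b c n) (U g b n d) (U g a c n) (U g a n d) (U g m c n) (U g m n d).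
move: (V g d a m) (V g d m b) (V g c a m) (V g c m b) (V g n a m) (V g n m b).
by move=> *; ring.
Qed.

Let J_cst A a b c d : J (fun=> A) a b c d = 0.
Proof. by rewrite /J /U /V !subrr. Qed.

Let cont1_id : cont1 id.
Proof. by move=> z _; exact: ccont_id. Qed.

Let J_id a b c d : 0 < a <= b -> b <= 1 -> c <= d -> J id a b c d = 0.
Proof.
move=> /andP[a0 ab] b1 cd; rewrite /J.
have -> : U id b c d - U id a c d = (b - a)%:C * (cis d - cis c).
  rewrite /U -cintB; [|by move=> x _; apply: (@cU id _ _ cont1_id); lra..].
  rewrite -[cis d]/(_ ) -[d]mul1r -[c]mul1r -cint_cis// !mul1r -cintZ; last first.
    by move=> x _; apply: cconM; [exact: ccon_cst|exact: ccon_cisM].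
  apply: eq_cint => x _; rewrite mul1r /H /k rmorphB /=; field.
  exact: cisw.
have -> : V id d a b - V id c a b = (b - a)%:C * (cis d - cis c).
  rewrite /V -cintB; [|by move=> t ?; apply: (@cV id _ _ cont1_id); lra..].
  rewrite (@eq_cint _ _ (fun=> (cis d - cis c) * 1)); last first.
    move=> t /andP[? ?]; rewrite /H; field.
    by rewrite -cabs_gt0 cabs_real normr_gt0; lra.
  rewrite cintZ; last by move=> x _; exact: ccon_cst.
  by rewrite cint1// mulrC.
by rewrite subrr.
Qed.

(** These are the functions subtracted in Goursat's argument. For a constant, opposite sides cancel;
    for [id], both differences of opposite sides equal [(b - a)%:C * (cis d - cis c)]. *)
Let J_affine A B a b c d : 0 < a <= b -> b <= 1 -> c <= d ->
  J (fun z => A + B * z) a b c d = 0.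
Proof.
move=> ab b1 cd.
have cB : cont1 (fun z => B * z).
  by move=> z _; apply: ccontM; [exact: ccont_cst|exact: ccont_id].
rewrite (@JD (fun=> A) (fun z => B * z)) ?J_cst ?add0r//; last first.
  by move=> z _; exact: ccont_cst.
have -> : J (fun z => B * z) a b c d = B * J id a b c d.
  case/andP: (ab) => a0 a1.
  have UE t : 0 <= t <= 1 -> U (fun z => B * z) t c d = B * U id t c d.
    move=> t01; rewrite /U -cintZ; last by move=> x _; exact: (@cU id _ _ cont1_id).
    by apply: eq_cint => x _; rewrite mulrA.
  have VE x : V (fun z => B * z) x a b = B * V id x a b.
    rewrite /V -cintZ; last by move=> t ?; apply: (@cV id _ _ cont1_id); lra.
    by apply: eq_cint => t _; rewrite mulrA.
  have a01 : 0 <= a <= 1 by lra.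
  have b01 : 0 <= b <= 1 by lra.
  by rewrite /J !UE// !VE; ring.
by rewrite J_id// mulr0.
Qed.

Let K := (1 - cabs w)^-1.

Let kK x : cabs (k x) <= K.
Proof.
rewrite /k cabsM cabsV cabsM cabs_cis mulr1 /cabs/= expr0n/= add0r expr1n sqrtr1 mul1r.
rewrite lef_pV2 ?posrE ?subr_gt0//; last by rewrite cabs_gt0.
by apply: le_trans (ler_cabs_dist _ _); rewrite cabs_cis.
Qed.

Let K0 : 0 < K. Proof. by rewrite invr_gt0 subr_gt0. Qed.

Let J_small g (E tau a b c d : R) : cont1 g -> 0 < tau -> tau <= a -> a <= b -> b <= 1 -> c <= d ->
  0 <= E -> (forall t x, a <= t <= b -> c <= x <= d -> cabs (g (H t x)) <= E) ->
  cabs (J g a b c d) <= 2 * E * (K * (d - c) + tau^-1 * (b - a)).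
Proof.
move=> cg tau0 taua ab b1 cd E0 hE.
have UB t : a <= t <= b -> cabs (U g t c d) <= E * K * (d - c).
  move=> tab; apply: cint_bound => //.
    by move=> x _; apply: cU => //; lra.
  by move=> x xcd; rewrite cabsM ler_pM ?cabs_ge0// hE.
have VB x : c <= x <= d -> cabs (V g x a b) <= E * tau^-1 * (b - a).
  move=> xcd; apply: cint_bound => //.
    by move=> t tab; apply: cV => //; lra.
  move=> t tab; rewrite cabsM ler_pM ?cabs_ge0// ?hE//.
  rewrite cabsV cabs_real ger0_norm; last by lra.
  by rewrite lef_pV2 ?posrE; lra.
rewrite (_ : 2 * E * _ = (E * K * (d - c) + E * K * (d - c)) +
   (E * tau^-1 * (b - a) + E * tau^-1 * (b - a))); last by ring.
apply: le_trans (ler_cabsB _ _) _; apply: lerD.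
  by apply: le_trans (ler_cabsB _ _) _; apply: lerD; apply: UB; rewrite lexx ?andbT.
by apply: le_trans (ler_cabsB _ _) _; apply: lerD; apply: VB; rewrite lexx ?andbT.
Qed.

Let cf : cont1 f.
Proof.
move=> z z1; have [|d /cderiv_cont] := df (z := z); first exact: le_lt_trans z1 r1.
by [].
Qed.

(** Goursat's argument in the coordinates [(t, x)]. The lower limit [tau] keeps the contour away
    from the pole, which lies at [t = 0]. *)
Let J0 (tau : R) : 0 < tau <= 1 -> J f tau 1 0 (2 * pi) = 0.
Proof.
move=> /andP[tau0 tau1]; have p0 : 0 <= 2 * pi :> R by rewrite mulr_ge0// pi_ge0.
apply/eqP; rewrite -cabs_eq0 eq_le cabs_ge0 andbT.
apply: (@bisection_le0 R (fun Q => cabs (J f Q.1.1 Q.1.2 Q.2.1 Q.2.2)) tau 1 0 (2 * pi) tau1 p0);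
  cbn [fst snd].
  move=> a b c d h1 h2 h3 h4 h5 h6; set m := (a + b) / 2; set n := (c + d) / 2.
  have hm : a <= m <= b by rewrite /m; lra.
  have hn : c <= n <= d by rewrite /n; lra.
  rewrite (@J_split f a b c d m n)//; [|lra..].
  by apply: le_trans (ler_cabsD _ _) _; rewrite lerD2r; apply: le_trans (ler_cabsD _ _) _;
    rewrite lerD2r; exact: ler_cabsD.
move=> x y x01 yp e e0; pose z0 := H x y.
have z1 : cabs z0 <= 1 by apply: H1; lra.
have [B dB] := df (le_lt_trans z1 r1).
pose L := K + tau^-1.
have L0 : 0 < L by rewrite addr_gt0// invr_gt0.
(* Points of the small rectangle are within [2 * S] of [z0], and [J_small] costs a factor
   [2 * L * S]; together these consume [4 * L] and leave [e * S ^+ 2]. *)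
have [r rp hr] := dB (e / (4 * L)) ltac:(by rewrite divr_gt0// mulr_gt0).
exists (r / 4); first by rewrite divr_gt0.
move=> a b c d /andP[ha1 ha2] /andP[hb1 hb2] /andP[hc1 hc2] /andP[hd1 hd2] sr s'r.
have ab : a <= b by lra.
have cd : c <= d by lra.
pose g z := f z + (- (f z0 - B * z0) + (- B) * z).
have cA : cont1 (fun z => - (f z0 - B * z0) + (- B) * z).
  move=> z _; apply: ccontD; first exact: ccont_cst.
  by apply: ccontM; [exact: ccont_cst|exact: ccont_id].
have cg : cont1 g by move=> z z1'; apply: ccontD; [exact: cf|exact: cA].
have -> : J f a b c d = J g a b c d.
  by rewrite (@JD f (fun z => - (f z0 - B * z0) + (- B) * z))// ?J_affine ?addr0//; lra.
pose S := (b - a) + (d - c).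
have S0 : 0 <= S by rewrite /S; lra.
have bound t u : a <= t <= b -> c <= u <= d -> cabs (g (H t u)) <= e / (4 * L) * (2 * S).
  move=> tab ucd.
  have hH : cabs (H t u - z0) <= 2 * S.
    have -> : H t u - z0 = (t - x)%:C * (cis u - w) + x%:C * (cis u - cis y).
      by rewrite /z0 /H rmorphB /=; ring.
    apply: le_trans (ler_cabsD _ _) _; rewrite !cabsM !cabs_real.
    have h1 : cabs (cis u - w) <= 2.
      by apply: le_trans (ler_cabsB _ _) _; rewrite cabs_cis; move: w1; lra.
    have h2 := cis_lipschitz u y.
    have h3 : `|t - x| <= b - a by rewrite ler_norml; lra.
    have h4 : `|u - y| <= d - c by rewrite ler_norml; lra.
    have h5 : `|x| <= 1 by rewrite ler_norml; lra.
    apply: (@le_trans _ _ ((b - a) * 2 + 1 * (d - c))).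
      by apply: lerD; apply: ler_pM; rewrite ?cabs_ge0//; exact: le_trans h2 h4.
    by rewrite /S; lra.
  have := hr (H t u - z0); rewrite subrKC.
  have -> : f (H t u) - f z0 - B * (H t u - z0) = g (H t u) by rewrite /g; ring.
  move=> h; apply: le_trans (h _) _.
    by apply: le_lt_trans hH _; rewrite /S; lra.
  by rewrite ler_wpM2l// divr_ge0 ?(ltW e0)// mulr_ge0 ?(ltW L0).
have eL0 : 0 <= e / (4 * L) * (2 * S).
  by rewrite !mulr_ge0 ?invr_ge0 ?mulr_ge0 ?(ltW e0) ?(ltW L0).
apply: le_trans (J_small cg tau0 ha1 ab hb2 cd eL0 bound) _.
apply: (@le_trans _ _ (2 * (e / (4 * L) * (2 * S)) * (L * S))).
  apply: ler_wpM2l; first by rewrite mulr_ge0.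
  rewrite /L mulrDl; apply: lerD.
    by rewrite ler_wpM2l ?(ltW K0)// /S; lra.
  by rewrite ler_wpM2l ?invr_ge0 ?(ltW tau0)// /S; lra.
rewrite le_eqVlt; apply/orP; left; apply/eqP; rewrite -/S; field.
by rewrite gt_eqF.
Qed.

(** By [J0] the integral over the circle of parameter [t] does not depend on [t], since the radial
    sides at the angles 0 and [2 * pi] coincide. As [t] tends to 0 the circle shrinks to [w], where
    [f] is continuous. *)
Lemma cauchy_kernel :
  cint 0 (2 * pi) (fun x => f (cis x) * k x) = f w * cint 0 (2 * pi) k.
Proof.
have p0 : 0 <= 2 * pi :> R by rewrite mulr_ge0// pi_ge0.
have -> : cint 0 (2 * pi) (fun x => f (cis x) * k x) = U f 1 0 (2 * pi).
  by apply: eq_cint => x _; rewrite /H mul1r subrKC.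
have Utau t : 0 < t <= 1 -> U f 1 0 (2 * pi) = U f t 0 (2 * pi).
  move=> t01; apply/eqP; rewrite -subr_eq0; apply/eqP.
  have := J0 t01; rewrite /J.
  suff -> : V f (2 * pi) t 1 = V f 0 t 1 by rewrite subrr subr0.
  by apply: eq_cint => x _; rewrite /H cis2pi cis0.
apply/eqP; rewrite -subr_eq0 -cabs_eq0 eq_le cabs_ge0 andbT.
apply/ler_addgt0Pr => e e0; rewrite add0r.
have KP : 0 < K * (2 * pi) + 1 by rewrite ltr_wpDl// mulr_ge0 ?(ltW K0).
have [r rp hr] := cf (ltW w1) (divr_gt0 e0 KP).
(* [cabs (cis x - w) <= 2], so the whole circle of parameter [t] lies within [r] of [w]. *)
pose t := Num.min 1 (r / 4).
have t0 : 0 < t by rewrite lt_min ltr01 divr_gt0.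
have t1 : t <= 1 by rewrite ge_min lexx.
have tr : t <= r / 4 by rewrite ge_min lexx orbT.
rewrite (Utau t); last by rewrite t0.
have t01 : 0 <= t <= 1 by rewrite ltW.
rewrite -cintZ// -cintB; last first.
- by move=> x _; apply: cconM => //; exact: ccon_cst.
- by move=> x _; exact: cU.
apply: (@le_trans _ _ (e / (K * (2 * pi) + 1) * K * (2 * pi - 0))); last first.
  rewrite subr0 -mulrA -mulrA mulrCA mulrC -mulrA ger_pMr// mulrC.
  by rewrite mulrC (ler_pdivrMr _ _ KP) mul1r lerDl.
apply: cint_bound => //.
  move=> x _; apply: cconB; first exact: cU.
  by apply: cconM => //; exact: ccon_cst.
move=> x _; rewrite -mulrBl cabsM ler_pM ?cabs_ge0//.
apply: ltW; rewrite /H; apply: hr.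
rewrite cabsM cabs_real ger0_norm ?(ltW t0)//.
apply: (@le_lt_trans _ _ (t * 2)); last by lra.
rewrite ler_wpM2l ?(ltW t0)//.
by apply: le_trans (ler_cabsB _ _) _; rewrite cabs_cis; move: w1; lra.
Qed.

End cauchy.

(** * Taylor expansion on discs, and the maximum principle at the centre *)

Section taylor.
Context {R : realType}.
Local Notation C := R[i].
Implicit Types (f g : C -> C) (z w : C) (x r : R).

Definition holo_disc f r := forall z, cabs z < r -> exists d, cderiv f z d.

Lemma holo_cont f r z : holo_disc f r -> cabs z < r -> ccont f z.
Proof. by move=> hf /hf[d /cderiv_cont]. Qed.

Definition circle_coef f n : C :=
  ((2 * pi)%:C)^-1 * cint 0 (2 * pi) (fun x => f (cis x) * (cis x)^-1 ^+ n).

Let kap w x : C := cis x / (cis x - w).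

Let cis_sub_neq0 w x : cabs w < 1 -> cis x - w != 0.
Proof.
move=> w1; rewrite subr_eq0; apply: contraTneq w1 => <-.
by rewrite cabs_cis ltxx.
Qed.

Let ckap w x : cabs w < 1 -> ccon (kap w) x.
Proof.
move=> w1; apply: cconM; first exact: ccon_cis.
apply: cconV; first exact: cis_sub_neq0.
by apply: cconB; [exact: ccon_cis|exact: ccon_cst].
Qed.

Let kapK w x : cabs w < 1 -> cabs (kap w x) <= (1 - cabs w)^-1.
Proof.
move=> w1; rewrite /kap cabsM cabsV cabs_cis mul1r.
rewrite lef_pV2 ?posrE ?subr_gt0//; last by rewrite cabs_gt0 cis_sub_neq0.
by apply: le_trans (ler_cabs_dist _ _); rewrite cabs_cis.
Qed.

Let kapE w x N : cabs w < 1 ->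
  kap w x = \sum_(n < N) w ^+ n * (cis x)^-1 ^+ n + (w * (cis x)^-1) ^+ N * kap w x.
Proof.
move=> w1; have h := cis_sub_neq0 x w1; have c0 := @cis_neq0 R x.
apply/eqP; rewrite -subr_eq -{1}[kap w x]mul1r -mulrBl.
have -> : 1 - (w * (cis x)^-1) ^+ N = (1 - w / cis x) * \sum_(n < N) (w / cis x) ^+ n.
  by rewrite -opprB subrX1 -mulNr opprB.
rewrite mulrC mulrA (_ : kap w x * _ = 1) ?mul1r; last by rewrite /kap; field; rewrite h c0.
by apply/eqP; apply: eq_bigr => i _; rewrite exprMn.
Qed.

Let cont_circle f := forall x, ccon (fun x => f (cis x)) x.

Let cpow (n : nat) x : ccon (fun x => (cis x)^-1 ^+ n : C) x.
Proof.
rewrite (_ : (fun x => _) = (fun x => cis (- n%:R * x))); first exact: ccon_cisM.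
by apply/funext => y; rewrite -cisN cisX mulrN mulNr.
Qed.

Let p0 : 0 <= 2 * pi :> R. Proof. by rewrite mulr_ge0// pi_ge0. Qed.
Let pC0 : (2 * pi)%:C != 0 :> C.
Proof. by rewrite -cabs_gt0 cabs_real normr_gt0 mulf_neq0// gt_eqF// pi_gt0. Qed.

Lemma cabs_circle_coef f n (M : R) : cont_circle f ->
  (forall x, 0 <= x <= 2 * pi -> cabs (f (cis x)) <= M) -> cabs (circle_coef f n) <= M.
Proof.
move=> cf hM; rewrite /circle_coef cabsM cabsV cabs_real ger0_norm//.
have p1 : 0 < 2 * pi :> R by rewrite mulr_gt0// pi_gt0.
rewrite mulrC ler_pdivrMr// -[X in M * X](subr0).
apply: cint_bound => //.
  by move=> x _; apply: cconM.
by move=> x x2; rewrite cabsM cabsX cabsV cabs_cis invr1 expr1n mulr1 hM.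
Qed.

(** The Cauchy kernel is a finite geometric sum in [w * (cis x)^-1] plus a remainder carrying the
    factor [(w * (cis x)^-1) ^+ N]; finite sums make termwise integration immediate. *)
Let kernel_expansion f w N (M : R) : cabs w < 1 -> cont_circle f ->
  (forall x, 0 <= x <= 2 * pi -> cabs (f (cis x)) <= M) ->
  cabs (cint 0 (2 * pi) (fun x => f (cis x) * kap w x) - (2 * pi)%:C * psum (circle_coef f) N w)
   <= M / (1 - cabs w) * (2 * pi) * cabs w ^+ N.
Proof.
move=> w1 cf hM.
have cfw n x : ccon (fun x => f (cis x) * (cis x)^-1 ^+ n) x by apply: cconM.
have crem x : ccon (fun x => f (cis x) * ((w * (cis x)^-1) ^+ N * kap w x)) x.
  apply: cconM => //; apply: cconM; last exact: ckap.
  rewrite (_ : (fun x => _) = (fun x => w ^+ N * (cis x)^-1 ^+ N)); last first.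
    by apply/funext => y; rewrite exprMn.
  by apply: cconM => //; exact: ccon_cst.
have csum m x : ccon (fun x => \sum_(n < m) w ^+ n * (f (cis x) * (cis x)^-1 ^+ n)) x.
  elim: m => [|m IH].
    rewrite (_ : (fun x => _) = fun=> 0); first exact: ccon_cst.
    by apply/funext => y; rewrite big_ord0.
  rewrite (_ : (fun x => _) = (fun x => \sum_(n < m) w ^+ n * (f (cis x) * (cis x)^-1 ^+ n) +
     w ^+ m * (f (cis x) * (cis x)^-1 ^+ m))); last first.
    by apply/funext => y; rewrite big_ord_recr.
  apply: cconD; first exact: IH.
  by apply: cconM; [exact: ccon_cst|exact: cfw].
have S m : cint 0 (2 * pi) (fun x => \sum_(n < m) w ^+ n * (f (cis x) * (cis x)^-1 ^+ n)) =
    (2 * pi)%:C * psum (circle_coef f) m w.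
  elim: m => [|m IH].
    rewrite /psum big_ord0 mulr0 (@eq_cint _ _ (fun=> 0 * 0)); last first.
      by move=> x _; rewrite big_ord0 mulr0.
    by rewrite cintZ ?mul0r// => x _; exact: ccon_cst.
  have -> : psum (circle_coef f) m.+1 w = psum (circle_coef f) m w + circle_coef f m * w ^+ m.
    by rewrite /psum big_ord_recr.
  rewrite (mulrDr (2 * pi)%:C) -IH.
  have -> : (2 * pi)%:C * (circle_coef f m * w ^+ m) =
      w ^+ m * cint 0 (2 * pi) (fun x => f (cis x) * (cis x)^-1 ^+ m).
    by rewrite /circle_coef mulrA mulrA mulfV// mul1r mulrC.
  rewrite -cintZ; last by move=> x _; exact: cfw.
  rewrite -cintD; [|by move=> x _; exact: csum|].
    by apply: eq_cint => x _; rewrite big_ord_recr.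
  by move=> x _; apply: cconM; [exact: ccon_cst|exact: cfw].
rewrite -S -cintB; last by move=> x _; exact: csum.
  rewrite (@eq_cint _ _ (fun x => f (cis x) * ((w * (cis x)^-1) ^+ N * kap w x))); last first.
    move=> x _; rewrite {1}(kapE x N w1) mulrDr addrAC [X in X + _](_ : _ = 0) ?add0r//.
    apply/eqP; rewrite subr_eq0 mulr_sumr; apply/eqP; apply: eq_bigr => i _.
    by rewrite mulrCA.
  rewrite mulrAC -{2}[2 * pi](subr0).
  apply: cint_bound => // x x2.
  rewrite cabsM cabsM cabsX cabsM cabsV cabs_cis invr1 mulr1.
  rewrite mulrCA mulrC ler_wpM2r ?exprn_ge0 ?cabs_ge0//.
  by apply: ler_pM; rewrite ?cabs_ge0 ?hM ?kapK.
by move=> x _; apply: cconM => //; exact: ckap.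
Qed.

(** The expansion with [f = 1], of which only the constant coefficient survives. This normalizes
    Cauchy's formula without a winding number. *)
Let int_kap w : cabs w < 1 -> cint 0 (2 * pi) (kap w) = (2 * pi)%:C.
Proof.
move=> w1; apply/eqP; rewrite -subr_eq0 -cabs_eq0 eq_le cabs_ge0 andbT.
apply/ler_addgt0Pr => e e0; rewrite add0r.
pose A := 1 / (1 - cabs w) * (2 * pi) + 1.
have A0 : 0 < A by rewrite ltr_wpDl// mulr_ge0// divr_ge0// subr_ge0 ltW.
have [|N hN] := expr_small (_ : 0 <= cabs w < 1) (divr_gt0 e0 A0); first by rewrite cabs_ge0.
have {}hN := hN N.+1 (leqnSn _).
have cc : cont_circle (fun=> 1) by move=> x; exact: ccon_cst.
have hM x : 0 <= x <= 2 * pi -> cabs (1 : C) <= 1 by rewrite cabs1.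
have := @kernel_expansion (fun=> 1) w N.+1 1 w1 cc hM.
have -> : psum (circle_coef (fun=> 1)) N.+1 w = 1.
  rewrite /psum big_ord_recl big1 ?addr0.
    rewrite expr0 mulr1 /circle_coef (@eq_cint _ _ (fun x => (cis x)^-1 ^+ 0)).
      by rewrite cint_cis_period/= mulVf.
    by move=> x _; rewrite mul1r.
  move=> i _; rewrite /circle_coef (@eq_cint _ _ (fun x => (cis x)^-1 ^+ lift ord0 i)).
    by rewrite cint_cis_period/= mulr0 mul0r.
  by move=> x _; rewrite mul1r.
rewrite mulr1 (@eq_cint _ _ (kap w)); last by move=> x _; rewrite mul1r.
move=> /le_trans; apply.
apply: (@le_trans _ _ (A * (e / A))); last by rewrite mulrC divfK// gt_eqF.
have q0 : 0 <= 1 - cabs w by rewrite subr_ge0 ltW.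
apply: ler_pM; [by rewrite mulr_ge0// divr_ge0|by rewrite exprn_ge0// cabs_ge0|by rewrite /A lerDl|exact: hN].
Qed.

Lemma disc_taylor1 f r : 1 < r -> holo_disc f r -> has_ps f (circle_coef f) 1.
Proof.
move=> r1 hf w w1 e e0.
have cf : cont_circle f.
  by move=> x; apply: ccon_comp; [exact: ccon_cis|apply: (holo_cont hf); rewrite cabs_cis].
have [M M0 hM] := ccon_bounded p0 (fun x (_ : 0 <= x <= 2 * pi) => cf x).
have E : cint 0 (2 * pi) (fun x => f (cis x) * kap w x) = (2 * pi)%:C * f w.
  have i0 : (0 +i* 1 : C) != 0 by rewrite eq_complex /= oner_eq0 andbF.
  apply: (mulfI i0); rewrite -cintZ; last by move=> x _; apply: cconM => //; exact: ckap.
  rewrite (@eq_cint _ _ (fun x => f (cis x) * ((0 +i* 1) * cis x / (cis x - w)))); last first.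
    by move=> x _; rewrite /kap; ring.
  rewrite (cauchy_kernel r1 hf w1).
  rewrite (@eq_cint _ _ (fun x => (0 +i* 1) * kap w x)); last by move=> x _; rewrite /kap mulrA.
  rewrite cintZ; last by move=> x _; exact: ckap.
  by rewrite int_kap// mulrC mulrA.
pose A := M / (1 - cabs w) + 1.
have A0 : 0 < A by rewrite ltr_wpDl// divr_ge0// subr_ge0 ltW.
have [|N hN] := expr_small (_ : 0 <= cabs w < 1) (divr_gt0 e0 A0); first by rewrite cabs_ge0.
exists N => n /hN {}hN.
have := kernel_expansion n w1 cf hM; rewrite E -mulrBr cabsM cabs_real ger0_norm//.
rewrite [X in _ <= X]mulrAC [X in _ <= X]mulrC ler_pM2l ?mulr_gt0 ?pi_gt0// => /le_trans; apply.
apply: (@le_trans _ _ (A * (e / A))); last by rewrite mulrC divfK// gt_eqF.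
have q0 : 0 <= 1 - cabs w by rewrite subr_ge0 ltW.
apply: ler_pM; [by rewrite divr_ge0|by rewrite exprn_ge0// cabs_ge0|by rewrite /A lerDl|exact: hN].
Qed.

Lemma holo_disc_scale f r (s : R) : 0 < s -> holo_disc f r -> holo_disc (fun z => f (s%:C * z)) (r / s).
Proof.
move=> s0 hf z zr; have [|d hd] := hf (s%:C * z).
  by rewrite cabsM cabs_real gtr0_norm// mulrC -ltr_pdivlMr.
exists (d * (s%:C * 1)); apply: (@cderiv_comp _ (fun z => s%:C * z)) hd.
exact/cderivZ/cderiv_id.
Qed.

(** Rescaling gives an expansion at every radius below [r], with coefficients that might depend on
    the radius; uniqueness on the disc of radius [r / 2] identifies them all. *)
Lemma disc_taylor f r : 0 < r -> holo_disc f r -> exists a, has_ps f a r.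
Proof.
move=> r0 hf.
have loc s : 0 < s < r -> exists a, has_ps f a s.
  move=> /andP[s0 sr]; pose g z := f (s%:C * z).
  have sC : s%:C != 0 :> C by rewrite -cabs_gt0 cabs_real normr_gt0 gt_eqF.
  have := @disc_taylor1 g (r / s); rewrite ltr_pdivlMr// mul1r => /(_ sr (holo_disc_scale s0 hf)) hg.
  exists (fun n => circle_coef g n / s%:C ^+ n) => z zs e e0.
  have [|N hN] := hg (z / s%:C) _ e e0.
    by rewrite cabsM cabsV cabs_real gtr0_norm// ltr_pdivrMr// mul1r.
  exists N => n /hN; rewrite /g mulrC divfK//.
  suff -> : psum (circle_coef g) n (z / s%:C) = psum (fun n => circle_coef g n / s%:C ^+ n) n z by [].
  by apply: eq_bigr => i _; rewrite exprMn exprVn mulrA mulrAC.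
have [|a ha] := loc (r / 2); first by lra.
exists a => z zr; pose s := (Num.max (cabs z) (r / 2) + r) / 2.
have [m1 m2] : cabs z <= Num.max (cabs z) (r / 2) /\ r / 2 <= Num.max (cabs z) (r / 2).
  by rewrite !le_max !lexx orbT.
have m3 : Num.max (cabs z) (r / 2) < r by rewrite gt_max zr; lra.
have [|b hb] := loc s; first by rewrite /s; lra.
have hb2 : has_ps f b (r / 2).
  by move=> y yr; apply: hb; apply: lt_trans yr _; rewrite /s; lra.
have -> : a = b by apply/funext; apply: has_ps_unique ha hb2; lra.
by apply: hb; rewrite /s; lra.
Qed.

(** The value at the centre is the coefficient of index 0, that is, the mean over the circle. *)
Lemma max_principle f r s (M : R) : 0 < s < r -> holo_disc f r ->
  (forall x, 0 <= x <= 2 * pi -> cabs (f (s%:C * cis x)) <= M) -> cabs (f 0) <= M.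
Proof.
move=> /andP[s0 sr] hf hM; pose g z := f (s%:C * z).
have hg := holo_disc_scale s0 hf.
have r1 : 1 < r / s by rewrite ltr_pdivlMr// mul1r.
have -> : f 0 = circle_coef g 0%N.
  by rewrite -(has_ps0 ltr01 (disc_taylor1 r1 hg)) mulr0.
apply: cabs_circle_coef.
  by move=> x; apply: ccon_comp; [exact: ccon_cis|apply: (holo_cont hg); rewrite cabs_cis].
by move=> x; exact: hM.
Qed.

End taylor.

(** * Injective holomorphic functions *)

Section zeros.
Context {R : realType}.
Local Notation C := R[i].
Implicit Types (f g h : C -> C) (a b : nat -> C) (z w k d : C) (r s : R).

Lemma ccont_eq f g z : (exists2 r : R, 0 < r & forall k, cabs k < r -> f (z + k) = g (z + k)) ->
  ccont f z -> ccont g z.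
Proof.
move=> [r r0 fg] hf e e0; have [s s0 hs] := hf e e0.
exists (Num.min r s); first by rewrite lt_min r0.
move=> k; rewrite lt_min => /andP[kr ks].
by have := fg 0; rewrite cabs0 addr0 => /(_ r0) <-; rewrite -fg//; exact: hs.
Qed.

Lemma cderiv_shift f z0 z d : cderiv f (z0 + z) d -> cderiv (fun k => f (z0 + k)) z d.
Proof. by move=> h e e0; have [r r0 hr] := h e e0; exists r => // k; rewrite addrA; exact: hr. Qed.

Lemma cderiv_unshift f z0 z d : cderiv (fun k => f (z0 + k)) z d -> cderiv f (z0 + z) d.
Proof. by move=> h e e0; have [r r0 hr] := h e e0; exists r => // k; have := hr k; rewrite addrA. Qed.

Lemma has_ps_cont f a r z : has_ps f a r -> cabs z < r -> ccont f z.
Proof. by move=> /has_ps_deriv[g _ hg] /hg /cderiv_cont. Qed.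

Lemma has_ps_holo f a r : has_ps f a r -> holo_disc f r.
Proof. by move=> /has_ps_deriv[g _ hg] z /hg; exists (g z). Qed.

Lemma ccont_eq0 f g r : 0 < r -> ccont f 0 -> ccont g 0 ->
  (forall k, k != 0 -> cabs k < r -> f k = g k) -> f 0 = g 0.
Proof.
move=> r0 cf cg fg; apply/eqP; rewrite -subr_eq0 -cabs_eq0 eq_le cabs_ge0 andbT.
apply/ler_addgt0Pr => e e0; rewrite add0r.
have e2 : 0 < e / 2 by rewrite divr_gt0.
have [s1 s10 h1] := cf _ e2; have [s2 s20 h2] := cg _ e2.
pose s := Num.min r (Num.min s1 s2).
have s0 : 0 < s by rewrite !lt_min r0 s10.
have [l1 l2 l3] : [/\ s <= r, s <= s1 & s <= s2] by rewrite !ge_min !lexx !orbT.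
pose k : C := (s / 2)%:C.
have ks : cabs k < s by rewrite cabs_real gtr0_norm ?divr_gt0//; lra.
have k0 : k != 0 by rewrite -cabs_gt0 cabs_real normr_gt0 gt_eqF// divr_gt0.
have := h1 k (lt_le_trans ks l2); have := h2 k (lt_le_trans ks l3); rewrite !add0r => H2 H1.
apply: le_trans (cabs_triangle _ _ (f k)) _; rewrite (_ : e = e / 2 + e / 2); last by lra.
by apply: lerD; [rewrite cabs_distrC ltW|rewrite fg ?ltW//; exact: lt_le_trans l1].
Qed.

Lemma has_ps_div f a r : 0 < r -> has_ps f a r -> a 0%N = 0 ->
  exists2 g, has_ps g (fun n => a n.+1) r & forall k, cabs k < r -> f k = k * g k.
Proof.
move=> r0 fa a0; have [g hg] : exists g, has_ps g (fun n => a n.+1) r.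
  apply: has_ps_exists => s /andP[s0 sr].
  have [|M M0 hM] := @has_ps_bounded _ f a r s fa; first by rewrite s0.
  exists (M / s); first by rewrite divr_ge0// ltW.
  by move=> n; rewrite ler_pdivlMr// -mulrA -exprSr.
exists g => // k kr; apply/eqP; rewrite -subr_eq0 -cabs_eq0 eq_le cabs_ge0 andbT.
apply/ler_addgt0Pr => e e0; rewrite add0r.
have e2 : 0 < e / 2 by rewrite divr_gt0.
have k1 : 0 < cabs k + 1 by rewrite ltr_wpDl ?cabs_ge0.
have [N1 h1] := fa k kr _ e2; have [N2 h2] := hg k kr _ (divr_gt0 e2 k1).
pose N := maxn N1 N2.
have {}h1 := h1 N.+1 (leqW (leq_maxl _ _)); have {}h2 := h2 N (leq_maxr _ _).
have E : psum a N.+1 k = k * psum (fun n => a n.+1) N k.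
  rewrite /psum big_ord_recl a0 mul0r add0r mulr_sumr; apply: eq_bigr => i _.
  by rewrite /= /bump /= add1n exprS mulrCA.
apply: le_trans (cabs_triangle _ _ (psum a N.+1 k)) _; rewrite (_ : e = e / 2 + e / 2); last by lra.
apply: lerD => //; rewrite E -mulrBr cabsM cabs_distrC.
apply: (@le_trans _ _ ((cabs k + 1) * (e / 2 / (cabs k + 1)))).
  by rewrite ler_pM ?cabs_ge0// lerDl.
by rewrite mulrC divfK// gt_eqF.
Qed.

Lemma ccont_neq0 f : ccont f 0 -> f 0 != 0 ->
  exists2 s : R, 0 < s & forall k, cabs k < s -> f k != 0.
Proof.
move=> cf f0; have := cf (cabs (f 0)); rewrite cabs_gt0 => /(_ f0)[s s0 hs].
exists s => // k /hs; rewrite add0r; apply: contraTneq => ->.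
by rewrite sub0r cabsN ltxx.
Qed.

(** While the constant coefficient vanishes, a factor [k] is split off; this happens at most [n]
    times, and a nonzero constant coefficient keeps the quotient away from 0 by continuity. *)
Lemma isolated_zeros f a r n : 0 < r -> has_ps f a r -> a n != 0 ->
  exists2 s : R, 0 < s & forall k, k != 0 -> cabs k < s -> f k != 0.
Proof.
move=> r0; elim: n f a => [|n IH] f a fa an;
  have cf : ccont f 0 by [apply: (has_ps_cont fa); rewrite cabs0].
  have [|s s0 hs] := ccont_neq0 cf; first by rewrite (has_ps0 r0 fa).
  by exists s => // k _; exact: hs.
have [a0|a0] := eqVneq (a 0%N) 0; last first.
  have [|s s0 hs] := ccont_neq0 cf; first by rewrite (has_ps0 r0 fa).
  by exists s => // k _; exact: hs.
have [g ga fg] := has_ps_div r0 fa a0; have [s s0 hs] := IH g _ ga an.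
exists (Num.min r s); first by rewrite lt_min r0.
by move=> k k0; rewrite lt_min => /andP[kr ks]; rewrite fg// mulf_neq0// hs.
Qed.

End zeros.

(** * Open mapping, holomorphic inverse and nonvanishing derivative *)

Section injective_holomorphic.
Context {R : realType}.
Local Notation C := R[i].
Variables (U : set C) (phi dphi : C -> C).
Hypothesis openU : open U.
Hypothesis hphi : forall z, U z -> cderiv phi z (dphi z).
Hypothesis inj : {in U &, injective phi}.

Let disc_in z : U z -> exists2 r : R, 0 < r & forall k, cabs k < r -> U (z + k).
Proof.
move=> Uz; have /openC_cabs/(_ z Uz)[r r0 hr] := openU.
by exists r => // k kr; apply: hr; rewrite addrC addKr.
Qed.

Let inj' z w : U z -> U w -> phi z = phi w -> z = w.
Proof. by move=> Uz Uw; apply: inj; rewrite inE. Qed.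

(** Injectivity keeps [phi] at distance at least [m] from [phi z0] on a small circle. If a value [w]
    closer than [m / 2] were omitted, [1 / (phi - w)] would be at most [2 / m] on the circle and
    larger at the centre, against the maximum principle. The derivative of [phi] is not involved. *)
Lemma open_mapping_disc z0 (r : R) : U z0 -> 0 < r ->
  exists2 s : R, 0 < s & forall w, cabs (w - phi z0) < s ->
    exists z, [/\ U z, cabs (z - z0) < r & phi z = w].
Proof.
move=> Uz0 r0; have [r1 r10 hr1] := disc_in Uz0.
pose q := Num.min r r1; have q0 : 0 < q by rewrite lt_min r0.
have [qr qr1] : q <= r /\ q <= r1 by rewrite !ge_min !lexx orbT.
have qU k : cabs k < q -> U (z0 + k) by move=> kq; apply: hr1; exact: lt_le_trans kq qr1.
pose s := q / 2; have s0 : 0 < s by rewrite divr_gt0.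
have sq : s < q by rewrite /s; lra.
have p0 : 0 <= 2 * pi :> R by rewrite mulr_ge0// pi_ge0.
pose c x : C := s%:C * cis x.
have cc x : cabs (c x) = s by rewrite cabsM cabs_cis mulr1 cabs_real gtr0_norm.
have cont x : ccon (fun x => phi (z0 + c x) - phi z0) x.
  apply: cconB; last exact: ccon_cst.
  apply: ccon_comp; last by apply/cderiv_cont/hphi/qU; rewrite cc.
  apply: cconD; first exact: ccon_cst.
  by apply: cconM; [exact: ccon_cst|exact: ccon_cis].
have hc : {within `[0, 2 * pi], continuous (fun x => cabs (phi (z0 + c x) - phi z0))}.
  by apply: continuous_subspaceT => x; exact/ccon_cabs/cont.
have [xm _ hm] := EVT_min p0 hc.
pose m := cabs (phi (z0 + c xm) - phi z0).
have m0 : 0 < m.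
  rewrite cabs_gt0 subr_eq0; apply/eqP => /inj' E.
  have : z0 + c xm = z0 by apply: E => //; apply: qU; rewrite cc.
  move=> /(congr1 (fun x => x - z0)); rewrite addrC addKr subrr => /(congr1 cabs).
  by rewrite cc cabs0; lra.
exists (m / 2); first by rewrite divr_gt0.
move=> w hw; apply/not_existsP => hn.
have nw k : cabs k < q -> phi (z0 + k) - w != 0.
  move=> kq; rewrite subr_eq0; apply/eqP => E; apply: (hn (z0 + k)); split => //.
    exact: qU.
  by rewrite addrC addKr; exact: lt_le_trans kq qr.
pose f k := (phi (z0 + k) - w)^-1.
have hf : holo_disc f q.
  move=> k kq; exists (- dphi (z0 + k) / (phi (z0 + k) - w) ^+ 2).
  apply: (@cderivV _ (fun k => phi (z0 + k) - w)); first exact: nw.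
  rewrite -[dphi _]subr0; apply: cderivB; last exact: cderiv_cst.
  by apply: cderiv_shift; apply/hphi/qU.
have := @max_principle _ f q s (2 / m); rewrite s0 sq => /(_ isT hf).
have H x : 0 <= x <= 2 * pi -> cabs (f (s%:C * cis x)) <= 2 / m.
  move=> x2; rewrite /f cabsV -[2 / m]invrK invf_div.
  rewrite lef_pV2 ?posrE ?divr_gt0//; last by rewrite cabs_gt0 nw// cc.
  have := hm x; rewrite in_itv/= => /(_ x2); rewrite -/m => mx.
  have := cabs_triangle (phi (z0 + c x)) (phi z0) w; rewrite -/(c x).
  by move: hw mx; lra.
move=> /(_ H); rewrite /f addr0 cabsV -[2 / m]invrK invf_div.
rewrite lef_pV2 ?posrE ?divr_gt0//; last by rewrite cabs_gt0 -[z0]addr0 nw// cabs0.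
by rewrite cabs_distrC leNgt hw.
Qed.

Variable psi : C -> C.
Hypothesis psiK : forall z, U z -> psi (phi z) = z.

Lemma open_image : open (phi @` U).
Proof.
apply/openC_cabs => _ [z Uz <-]; have [s s0 hs] := open_mapping_disc Uz ltr01.
by exists s => // w /hs[y [Uy _ <-]]; exists y.
Qed.

Lemma inverse_cont z : U z -> ccont psi (phi z).
Proof.
move=> Uz e e0; have [s s0 hs] := open_mapping_disc Uz e0.
exists s => // k ks; have [|y [Uy yz E]] := hs (phi z + k); first by rewrite addrC addKr.
by rewrite -E !psiK.
Qed.

Lemma inverse_cderiv z : U z -> dphi z != 0 -> cderiv psi (phi z) (dphi z)^-1.
Proof.
move=> Uz d0; have /cderivP[q [q0 cq hq]] := hphi Uz.
have cpsi := inverse_cont Uz.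
pose kap k := psi (phi z + k) - z.
have ckap : ccont kap 0.
  apply: ccontB; last exact: ccont_cst.
  by apply: ccont_shift; rewrite addr0.
have kap0 : kap 0 = 0 by rewrite /kap addr0 psiK// subrr.
have [s s0 hs] := open_mapping_disc Uz ltr01.
have E k : cabs k < s -> k = q (kap k) * kap k.
  move=> ks; have [|y [Uy _ Ey]] := hs (phi z + k); first by rewrite addrC addKr.
  have : psi (phi z + k) = y by rewrite -Ey psiK.
  by rewrite /kap => ->; rewrite -hq subrKC Ey addrC addKr.
have cqk : ccont (fun k => q (kap k)) 0 by apply: ccont_comp => //; rewrite kap0.
have [|t t0 ht] := ccont_neq0 cqk; first by rewrite kap0 q0.
apply/cderivP; exists (fun k => if k == 0 then (dphi z)^-1 else kap k / k); split.
- by rewrite eqxx.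
- have h : ccont (fun k => (q (kap k))^-1) 0.
    by apply: ccontV => //; rewrite kap0 q0.
  apply: ccont_eq h; exists (Num.min s t); first by rewrite lt_min s0.
  move=> k; rewrite add0r lt_min => /andP[ks kt].
  case: eqVneq => [->|k0]; first by rewrite kap0 q0.
  have qk := ht k kt; apply: (mulIf k0); rewrite divfK//.
  by rewrite {2}(E k ks) mulrA mulVf// mul1r.
- move=> k; rewrite psiK//; case: eqVneq => [->|k0]; first by rewrite addr0 psiK// subrr mulr0.
  by rewrite divfK.
Qed.

(** If the derivative vanished at [z0], this zero would be isolated, so [psi] would be continuous
    near [phi z0] and holomorphic except at that point. The singularity is removable, and the chain
    rule for [psi (phi x)] then reads [1 = 0]. *)
Lemma injective_deriv_neq0 z0 : U z0 -> dphi z0 != 0.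
Proof.
move=> Uz0; apply/eqP => d0.
have [r r0 hr] := disc_in Uz0.
pose f k := phi (z0 + k).
have df k : cabs k < r -> cderiv f k (dphi (z0 + k)).
  by move=> kr; apply: cderiv_shift; apply/hphi/hr.
have [a fa] : exists a, has_ps f a r.
  by apply: disc_taylor => // k /df; exists (dphi (z0 + k)).
have [g ga hg] := has_ps_deriv fa.
have gd k : cabs k < r -> g k = dphi (z0 + k).
  by move=> kr; exact: cderiv_unique (hg k kr) (df k kr).
(* Otherwise [phi] would be constant near [z0], against injectivity. *)
have [n an] : exists n, a n.+1 != 0.
  apply/not_existsP => h.
  have [F Fa fF] : exists2 F, has_ps F (fun n => a n.+1) r &
      forall k, cabs k < r -> f k - a 0%N = k * F k.
    have h1 : has_ps (fun k => f k - a 0%N) (fun n => if n is 0%N then 0 else a n) r.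
      move=> z zr e e0; have [N hN] := fa z zr e e0; exists N.+1 => m Nm.
      have := hN m (ltnW Nm); rewrite /psum; case: m Nm => // m _.
      rewrite !big_ord_recl /= expr0 mulr1 mul0r add0r opprD addrA.
      by [].
    by have [F] := has_ps_div r0 h1 erefl; exists F.
  have F0 k : cabs k < r -> F k = 0.
    move=> kr; apply/eqP; rewrite -cabs_eq0 eq_le cabs_ge0 andbT.
    apply/ler_addgt0Pr => e e0; rewrite add0r; have [N hN] := Fa k kr e e0.
    have := hN N (leqnn N); rewrite /psum big1 ?subr0// => i _.
    by have := h i; move=> /negP/negPn/eqP ->; rewrite mul0r.
  pose k : C := (r / 2)%:C.
  have kr : cabs k < r by rewrite cabs_real gtr0_norm ?divr_gt0//; lra.
  have k0 : k != 0 by rewrite -cabs_gt0 cabs_real normr_gt0 gt_eqF// divr_gt0.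
  have E : phi (z0 + k) = phi z0.
    have := fF k kr; rewrite F0// mulr0 => /eqP; rewrite subr_eq0 => /eqP.
    by rewrite -(has_ps0 r0 fa) /f addr0.
  have := inj' (hr k kr) Uz0 E => /(congr1 (fun x => x - z0)).
  by rewrite addrC addKr subrr => /eqP; rewrite (negbTE k0).
have [|s s0 hs] := isolated_zeros r0 ga (_ : pshift a n != 0).
  by rewrite mulf_neq0// pnatr_eq0.
pose rho := Num.min r s; have rho0 : 0 < rho by rewrite lt_min r0.
have [rhor rhos] : rho <= r /\ rho <= s by rewrite !ge_min !lexx orbT.
have [t t0 ht] := open_mapping_disc Uz0 rho0.
have cpsi k : cabs k < t -> k != 0 -> exists d, cderiv psi (phi z0 + k) d.
  move=> kt k0; have [|z [Uz zz E]] := ht (phi z0 + k); first by rewrite addrC addKr.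
  have z0z : z - z0 != 0.
    apply: contraNneq k0 => /eqP; rewrite subr_eq0 => /eqP zE.
    by move: E; rewrite zE => /(congr1 (fun x => x - phi z0)); rewrite subrr addrC addKr => <-.
  exists (dphi z)^-1; rewrite -E; apply: inverse_cderiv => //.
  by have := hs _ z0z (lt_le_trans zz rhos); rewrite gd ?subrKC//; exact: lt_le_trans zz rhor.
pose v k := psi (phi z0 + k) - z0.
have cv : ccont v 0.
  apply: ccontB; last exact: ccont_cst.
  by apply: ccont_shift; rewrite addr0; exact: inverse_cont.
have v0 : v 0 = 0 by rewrite /v addr0 psiK// subrr.
(* A priori [psi] is only continuous at [phi z0]; multiplying by [k] makes it
   differentiable there, and the power series can then be divided by [k]. *)
pose chi k := k * v k.
have hchi : holo_disc chi t.
  move=> k kt; have [->|k0] := eqVneq k 0.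
    exists (v 0); apply/cderivP; exists v; split=> // k'.
    by rewrite /chi add0r mul0r subr0 mulrC.
  have [d hd] := cpsi k kt k0.
  exists (1 * v k + k * d); apply: cderivM; first exact: cderiv_id.
  rewrite -[d]subr0; apply: cderivB; last exact: cderiv_cst.
  exact: cderiv_shift.
have [c hc] := disc_taylor t0 hchi.
have c0 : c 0%N = 0 by rewrite -(has_ps0 t0 hc) /chi mul0r.
have [chi1 h1 E1] := has_ps_div t0 hc c0.
have E2 k : k != 0 -> cabs k < t -> chi1 k = v k.
  by move=> k0 kt; have := E1 k kt; rewrite /chi => /(mulfI k0).
have t00 : cabs (0 : C) < t by rewrite cabs0.
have E3 : chi1 0 = v 0 by apply: (ccont_eq0 t0) E2 => //; exact: has_ps_cont h1 t00.
have [d1 hd1] := has_ps_holo h1 t00.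
have hv : cderiv v 0 d1.
  apply: cderiv_eq hd1; exists t => // k kt; rewrite add0r.
  by have [->|k0] := eqVneq k 0; [exact: E3|exact: E2].
have hpsi : cderiv psi (phi z0) d1.
  rewrite -[phi z0]addr0; apply: cderiv_unshift.
  have -> : (fun k => psi (phi z0 + k)) = (fun k => v k + z0).
    by apply/funext => k; rewrite /v subrK.
  by rewrite -[d1]addr0; apply: cderivD => //; exact: cderiv_cst.
have := cderiv_comp (hphi Uz0) hpsi; rewrite d0 mulr0 => H.
have : cderiv (fun x => psi (phi x)) z0 1.
  apply: cderiv_eq (cderiv_id z0); exists r => // k kr.
  by rewrite psiK//; exact: hr.
by move=> /(cderiv_unique H) /eqP; rewrite eq_sym oner_eq0.
Qed.

End injective_holomorphic.

(** * Powers of the modulus of a zero-free holomorphic function *)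

Section complex_exponential.
Context {R : realType}.
Local Notation C := R[i].
Implicit Types (z w k : C) (x y : R).

Lemma is_derive_littleo (f : R -> R) x (d e : R) : is_derive x 1 f d -> 0 < e ->
  exists2 r : R, 0 < r & forall h, `|h| < r -> `|f (x + h) - f x - d * h| <= e * `|h|.
Proof.
move=> [df <-] e0.
have : (fun h : R => h^-1 *: (f (h + x) - f x)) @ 0^' --> 'D_1 f x.
  have -> : (fun h : R => h^-1 *: (f (h + x) - f x)) =
    (fun h : R => h^-1 *: ((f \o shift x) (h *: 1) - f x)).
    by apply/funext => h /=; rewrite /GRing.scale/= mulr1.
  exact: df.
move/cvgrPdist_le => /(_ e e0).
rewrite near_withinE => /nbhs_ballP[r /= r0 h]; exists r => // k kr.
have [->|k0] := eqVneq k 0; first by rewrite addr0 mulr0 !subr0 subrr normr0 mulr0.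
have := h k; rewrite /ball/= sub0r normrN => /(_ kr k0) hk.
have -> : f (x + k) - f x - 'D_1 f x * k
    = - ('D_1 f x - k^-1 *: (f (k + x) - f x)) * k.
  by rewrite /GRing.scale/= mulNr mulrBl mulrAC mulVf// mul1r opprB addrC [k + x]addrC addrC.
by rewrite normrM normrN ler_wpM2r.
Qed.

Definition cexp z : C := (expR (complex.Re z))%:C * cis (complex.Im z).

Lemma cexpD z w : cexp (z + w) = cexp z * cexp w.
Proof. by case: z w => a b [c d]; rewrite /cexp/= expRD cisD rmorphM; ring. Qed.

Lemma cexp0 : cexp 0 = 1.
Proof. by rewrite /cexp /= expR0 cis0 mulr1. Qed.

Lemma cabs_cexp z : cabs (cexp z) = expR (complex.Re z).
Proof. by rewrite /cexp cabsM cabs_cis mulr1 cabs_real gtr0_norm// expR_gt0. Qed.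

Lemma cexp_neq0 z : cexp z != 0.
Proof. by rewrite -cabs_gt0 cabs_cexp expR_gt0. Qed.

(** The addition formula reduces the claim to the point 0, where the real exponential, sine and
    cosine are expanded to first order. *)
Lemma cderiv_cexp z : cderiv cexp z (cexp z).
Proof.
suff h0 : cderiv cexp 0 1.
  have := cderivZ (cexp z) h0; rewrite mulr1 => h.
  rewrite -[z in cderiv _ z _]addr0; apply: cderiv_unshift.
  apply: cderiv_eq h; exists 1 => // k _; by rewrite add0r cexpD.
move=> e e0; pose e1 := e / 6; have e10 : 0 < e1 by rewrite divr_gt0.
have [r1 r10 h1] := is_derive_littleo (is_derive_expR 0) e10.
have [r2 r20 h2] := is_derive_littleo (is_derive_cos 0) e10.
have [r3 r30 h3] := is_derive_littleo (is_derive_sin 0) e10.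
pose r := Num.min (Num.min r1 e1) (Num.min r2 r3).
have r0 : 0 < r by rewrite !lt_min r10 e10 r20.
have [l1 l2 [l3 l4]] : [/\ r <= r1, r <= e1 & r <= r2 /\ r <= r3] by rewrite !ge_min !lexx !orbT.
exists r => // k kr; rewrite add0r cexp0 mul1r.
have xK := norm_Re_cabs k; have yK := norm_Im_cabs k; 
set K := cabs k in kr xK yK *; set x := complex.Re k in xK *; set y := complex.Im k in yK *.
have -> : cexp k - 1 - k = (expR x - 1 - x)%:C * cis y + x%:C * (cis y - 1) +
   ((cos y - 1) +i* (sin y - y)).
  by rewrite /x /y; case: (k) => u v; rewrite /cexp /cis; apply: complexP => /=; ring.
have y1 : `|y| < r2 by apply: le_lt_trans yK _; exact: lt_le_trans l3.
have y2 : `|y| < r3 by apply: le_lt_trans yK _; exact: lt_le_trans l4.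
have x1 : `|x| < r1 by apply: le_lt_trans xK _; exact: lt_le_trans l1.
have {}h1 := h1 x x1; have {}h2 := h2 y y1; have {}h3 := h3 y y2.
move: h1 h2 h3; rewrite !add0r expR0 cos0 sin0 oppr0 mul0r !mul1r !subr0 ?addr0 => h1 h2 h3.
have K0 : 0 <= K by exact: cabs_ge0.
have a1 : cabs ((expR x - 1 - x)%:C * cis y) <= e1 * K.
  by rewrite cabsM cabs_cis mulr1 cabs_real; apply: le_trans h1 _; rewrite ler_wpM2l// ltW.
have a2 : cabs (x%:C * (cis y - 1)) <= K * e1.
  rewrite cabsM cabs_real; apply: ler_pM; rewrite ?cabs_ge0//.
  rewrite -cis0; apply: le_trans (cis_lipschitz _ _) _.
  by rewrite subr0 (le_trans yK)// ltW// (lt_le_trans kr).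
have a3 : cabs ((cos y - 1) +i* (sin y - y)) <= e1 * K + e1 * K.
  apply: le_trans (cabs_ReIm _) _ => /=; apply: lerD.
    by apply: le_trans h2 _; rewrite ler_wpM2l// ltW.
  by apply: le_trans h3 _; rewrite ler_wpM2l// ltW.
apply: le_trans (ler_cabsD _ _) _; apply: le_trans (lerD (ler_cabsD _ _) (lexx _)) _.
apply: le_trans (lerD (lerD a1 a2) a3) _.
by rewrite /e1; nra.
Qed.

End complex_exponential.

(** * Logarithmic primitives *)

Section powers.
Context {R : realType}.
Local Notation C := R[i].
Implicit Types (f g p : C -> C) (z : C).

Lemma deriv0_cst f r : 0 < r -> (forall z, cabs z < r -> cderiv f z 0) ->
  forall z, cabs z < r -> f z = f 0.
Proof.
move=> r0 hf; have [|a fa] := @disc_taylor _ f r r0; first by move=> z /hf; exists 0.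
have [g ga hg] := has_ps_deriv fa.
have g0 z : cabs z < r -> g z = 0 by move=> zr; exact: cderiv_unique (hg z zr) (hf z zr).
have z0 : has_ps g (fun=> 0) r.
  move=> z zr e e0; exists 0%N => N _; rewrite g0// /psum big1 ?subrr ?cabs0 ?ltW// => i _.
  by rewrite mul0r.
have an n : a n.+1 = 0.
  have := has_ps_unique r0 ga z0 n => /eqP; rewrite /pshift mulf_eq0 pnatr_eq0 /=.
  by move/eqP.
move=> z zr; rewrite (has_ps0 r0 fa); apply/eqP; rewrite -subr_eq0 -cabs_eq0 eq_le cabs_ge0 andbT.
apply/ler_addgt0Pr => e e0; rewrite add0r; have [N hN] := fa z zr e e0.
have := hN N.+1 (leqnSn _); rewrite /psum big_ord_recl big1 ?addr0 ?expr0 ?mulr1// => i _.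
by rewrite /= /bump/= an mul0r.
Qed.

Lemma holo_primitive f r : 0 < r -> holo_disc f r ->
  exists g, forall z, cabs z < r -> cderiv g z (f z).
Proof.
move=> r0 hf; have [a fa] := disc_taylor r0 hf.
pose b n : C := if n is m.+1 then a m / m.+1%:R else 0.
have sb : pshift b = a.
  by apply/funext => n; rewrite /pshift /b mulrC divfK// pnatr_eq0.
have [g gb] : exists g, has_ps g b r.
  apply: has_ps_exists => s /andP[s0 sr].
  have [|M M0 hM] := @has_ps_bounded _ f a r s fa; first by rewrite s0.
  exists (M * s); first by rewrite mulr_ge0// ltW.
  case=> [|n]; first by rewrite /b cabs0 mul0r mulr_ge0// ltW.
  rewrite /b cabsM cabsV exprSr mulrA ler_wpM2r ?(ltW s0)//.
  have -> : cabs (n.+1%:R : C) = n.+1%:R.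
    by have := cabs_real (n.+1%:R : R); rewrite rmorph_nat ger0_norm.
  rewrite mulrAC ler_pdivrMr ?ltr0n//; apply: le_trans (hM n) _.
  by rewrite ler_peMr// ler1n.
exists g => z; apply: has_ps_cderiv gb _; by rewrite sb.
Qed.

Lemma holo_disc_div f g r : holo_disc f r -> holo_disc g r ->
  (forall z, cabs z < r -> g z != 0) -> holo_disc (fun z => f z / g z) r.
Proof.
move=> hf hg g0 z zr; have [d hd] := hf z zr; have [c hc] := hg z zr.
by eexists; apply: cderivM hd _; apply: cderivV hc; exact: g0.
Qed.

(** Let [l] be a primitive of p' / p. The function [p * cexp (- l)] has derivative 0, so [p] is the
    constant [q 0] times [cexp l], and [cexp (b%:C * l)] has the required modulus up to a positive
    constant. *)
Lemma holo_abs_powR p (b : R) : holo_disc p 1 -> (forall z, cabs z < 1 -> p z != 0) ->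
  exists2 L, holo_disc L 1 & forall z, cabs z < 1 -> cabs (L z) = cabs (p z) `^ b.
Proof.
move=> hp p0; have [a pa] := disc_taylor ltr01 hp.
have [dp da hdp] := has_ps_deriv pa.
have [l hl] := holo_primitive ltr01 (holo_disc_div (has_ps_holo da) hp p0).
pose q z := p z * cexp (- l z).
have q_cst z : cabs z < 1 -> q z = q 0.
  apply: deriv0_cst => // {}z z1.
  have := cderivM (hdp z z1) (cderiv_comp (cderivN (hl z z1)) (cderiv_cexp (- l z))).
  suff -> : dp z * cexp (- l z) + p z * (cexp (- l z) * - (dp z / p z)) = 0 by [].
  by field; exact: p0.
have q0 : q 0 != 0 by rewrite mulf_neq0 ?cexp_neq0// p0// cabs0.
have absp z : cabs z < 1 -> cabs (p z) = cabs (q 0) * expR (complex.Re (l z)).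
  move=> z1; rewrite -(q_cst z z1) /q cabsM cabs_cexp -mulrA -expRD.
  by case: (l z) => u v /=; rewrite addNr expR0 mulr1.
exists (fun z => (cabs (q 0) `^ b)%:C * cexp (b%:C * l z)).
  move=> z z1; eexists; apply: cderivZ; apply: cderiv_comp (cderiv_cexp _).
  by apply: cderivZ; exact: hl z1.
move=> z z1; rewrite cabsM cabs_real cabs_cexp absp// ger0_norm ?powR_ge0//.
rewrite powRM ?cabs_ge0 ?expR_ge0// -expRM; congr (_ * expR _).
by case: (l z) => u v /=; rewrite mul0r subr0 mulrC.
Qed.

End powers.

(** * Planar Lebesgue measure *)

Section plane_measure.
Context {R : realType}.
Local Notation C := R[i].
Local Notation RM := (measurableTypeR R).
Local Notation T2 := (RM * RM)%type.
Local Notation lam := (@lebesgue_measure R).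
Local Notation mu2 := (@lebesgue_measure R \x @lebesgue_measure R)%E.
Implicit Types (A B E : set T2) (a b c d x y r : R).

(** Half-open sides make subdivisions disjoint, and intersections are again of this form, so that
    the rectangles are a pi-system generating the Borel sets. *)
Definition rect a b c d : set T2 := `]a, b]%classic `*` `]c, d]%classic.

Lemma measurable_rect a b c d : measurable (rect a b c d).
Proof. by apply: measurableX; exact: measurable_itv. Qed.

Definition rects : set (set T2) := [set A `*` B | A in @ocitv R & B in @ocitv R].

Lemma rects_rect a b c d : rects (rect a b c d).
Proof. by exists `]a, b]%classic; [exists (a, b)|exists `]c, d]%classic => //; exists (c, d)]. Qed.

Lemma rectsP E : rects E -> exists a b c d, E = rect a b c d.
Proof. by move=> [A [[a b] _ <-] [B [[c d] _ <-] <-]]; exists a, b, c, d. Qed.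

Let cover_nat (x : R) : exists n : nat, - n%:R < x <= n%:R.
Proof.
exists (Num.truncn `|x|).+1; have := truncnS_gt `|x|.
by rewrite ltr_norml => /andP[-> /ltW ->].
Qed.

Lemma measurable_planeE : @measurable _ T2 = <<s rects >>.
Proof.
rewrite eqEsubset; split; last first.
  apply: smallest_sub; first exact: sigma_algebra_measurable.
  by move=> _ /rectsP[a [b [c [d ->]]]]; exact: measurable_rect.
pose T' := g_sigma_algebraType rects.
have mf : measurable_fun setT (fst : T' -> RM).
  apply: (measurability (@ocitv R)) => // _ [_ [[a b] _ <-] <-]; rewrite setTI.
  have -> : fst @^-1` `]a, b]%classic = \bigcup_n rect a b (- n%:R) n%:R.
    apply/seteqP; split => [[x y] /= xab|[x y] [n _ []]//].
    by have [n hn] := cover_nat y; exists n => //; split => //=; rewrite in_itv.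
  by apply: bigcupT_measurable => n; apply: sub_sigma_algebra; exact: rects_rect.
have ms : measurable_fun setT (snd : T' -> RM).
  apply: (measurability (@ocitv R)) => // _ [_ [[a b] _ <-] <-]; rewrite setTI.
  have -> : snd @^-1` `]a, b]%classic = \bigcup_n rect (- n%:R) n%:R a b.
    apply/seteqP; split => [[x y] /= xab|[x y] [n _ []]//].
    by have [n hn] := cover_nat x; exists n => //; split => //=; rewrite in_itv.
  by apply: bigcupT_measurable => n; apply: sub_sigma_algebra; exact: rects_rect.
have mi : measurable_fun setT (fun x : T' => (x.1, x.2) : T2) by exact: measurable_fun_pair.
move=> A mA; have := mi measurableT A mA; rewrite setTI.
by rewrite (_ : _ @^-1` A = A)//; apply/seteqP; split => [[x y]|[x y]].
Qed.

Lemma rectI a b c d a' b' c' d' : rect a b c d `&` rect a' b' c' d' =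
  rect (Num.max a a') (Num.min b b') (Num.max c c') (Num.min d d').
Proof.
apply/seteqP; split => [[x y] [[/= + +] [/= + +]]|[x y] [/= + +]]; rewrite /rect/= !in_itv/= ?gt_max ?le_min.
  by move=> /andP[-> ->] /andP[-> ->] /andP[-> ->] /andP[-> ->].
move=> /andP[/andP[h1 h2] /andP[h3 h4]] /andP[/andP[h5 h6] /andP[h7 h8]].
by rewrite h1 h2 h3 h4 h5 h6 h7 h8.
Qed.

Lemma plane_measure_unique (m1 m2 : {measure set T2 -> \bar R}) :
  (forall a b c d, m1 (rect a b c d) = m2 (rect a b c d)) ->
  (forall a b c d, (m1 (rect a b c d) < +oo)%E) ->
  forall E, measurable E -> m1 E = m2 E.
Proof.
move=> h12 hoo; apply: (measure_unique rects (fun n => rect (- n%:R) n%:R (- n%:R) n%:R)).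
- exact: measurable_planeE.
- move=> _ _ /rectsP[a [b [c [d ->]]]] /rectsP[a' [b' [c' [d' ->]]]].
  by rewrite rectI; exact: rects_rect.
- by move=> n; exact: rects_rect.
- apply/seteqP; split => // -[x y] _.
  have [n hn] := cover_nat x; have [m hm] := cover_nat y.
  exists (maxn n m) => //; split => /=; rewrite in_itv/=.
    move: hn => /andP[h1 h2]; apply/andP; split.
      by apply: le_lt_trans h1; rewrite lerN2 ler_nat leq_maxl.
    by apply: le_trans h2 _; rewrite ler_nat leq_maxl.
  move: hm => /andP[h1 h2]; apply/andP; split.
    by apply: le_lt_trans h1; rewrite lerN2 ler_nat leq_maxr.
  by apply: le_trans h2 _; rewrite ler_nat leq_maxr.
- by move=> _ /rectsP[a [b [c [d ->]]]].
- by move=> n.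
Qed.

Lemma lam_oc a b : a <= b -> lam `]a, b]%classic = (b - a)%:E.
Proof.
move=> ab; rewrite lebesgue_measure_itv/= lte_fin; case: ltP => //.
by move=> ba; have -> : a = b by [apply/eqP; rewrite eq_le ab]; rewrite subrr.
Qed.

Lemma mu2_rect a b c d : a <= b -> c <= d -> mu2 (rect a b c d) = ((b - a) * (d - c))%:E.
Proof.
move=> ab cd; have := @product_measure1E _ _ _ _ R lam lam `]a, b]%classic `]c, d]%classic.
rewrite /rect => ->; [|exact: measurable_itv..].
by transitivity ((b - a)%:E * (d - c)%:E)%E => //; congr (_ * _)%E; exact: lam_oc.
Qed.

Lemma rect_empty a b c d : ~~ ((a < b) && (c < d)) -> rect a b c d = set0.
Proof.
rewrite negb_and -!leNgt => h; apply/seteqP; split => // -[x y] [/=]; rewrite !in_itv/=.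
by case/orP: h => h /andP[h1 h2] /andP[h3 h4]; lra.
Qed.

Lemma mu2_rect_lty a b c d : (mu2 (rect a b c d) < +oo)%E.
Proof.
have [/andP[ab cd]|/rect_empty ->] := boolP ((a < b) && (c < d)); last by rewrite measure0.
by rewrite mu2_rect ?ltry// ltW.
Qed.

(** Preimages are measured, so for an invertible linear map [k] is the inverse of the absolute value
    of the determinant. *)
Definition scales (f : T2 -> T2) (k : R) := measurable_fun setT f /\
  (0 <= k /\ forall E, measurable E -> mu2 (f @^-1` E) = (k%:E * mu2 E)%E).

Lemma scales_comp f g k l : scales f k -> scales g l -> scales (g \o f) (k * l).
Proof.
move=> [mf [k0 hf]] [mg [l0 hg]]; split; first exact: measurableT_comp.
split; first exact: mulr_ge0.
move=> E mE; rewrite comp_preimage hf; last by rewrite -[X in measurable X]setTI; exact: mg.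
by rewrite hg// EFinM muleA.
Qed.

Lemma scales_rect f k : measurable_fun setT f -> 0 <= k ->
  (forall a b c d, a < b -> c < d -> mu2 (f @^-1` rect a b c d) = (k * ((b - a) * (d - c)))%:E) ->
  scales f k.
Proof.
move=> mf k0 h; split => //; split => // E mE.
have hh a b c d : mu2 (f @^-1` rect a b c d) = (k%:E * mu2 (rect a b c d))%E.
  have [/andP[ab cd]|/rect_empty ->] := boolP ((a < b) && (c < d)).
    by rewrite h// mu2_rect ?ltW// EFinM.
  by rewrite preimage_set0 !measure0 mule0.
have := @plane_measure_unique (pushforward mu2 f) (mscale (NngNum k0) mu2).
rewrite /pushforward /mscale/=; apply => //.
by move=> a b c d; rewrite /pushforward hh lte_mul_pinfty// ?lee_fin// mu2_rect_lty.
Qed.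

Lemma lam_co a b : a <= b -> lam `[a, b[%classic = (b - a)%:E.
Proof.
move=> ab; rewrite lebesgue_measure_itv/= lte_fin; case: ltP => //.
by move=> ba; have -> : a = b by [apply/eqP; rewrite eq_le ab]; rewrite subrr.
Qed.

Lemma lam_scale p a b : p != 0 -> a < b ->
  lam ((fun x => p * x) @^-1` `]a, b]%classic) = (`|p|^-1 * (b - a))%:E.
Proof.
move=> p0 ab; have [pp|pn] := ltP 0 p.
  have -> : (fun x => p * x) @^-1` `]a, b]%classic = `]a / p, b / p]%classic.
    by apply/seteqP; split => x /=; rewrite !in_itv/= ltr_pdivrMr// ler_pdivlMr// mulrC.
  rewrite lam_oc; last by rewrite ler_pM2r ?invr_gt0// ltW.
  by rewrite gtr0_norm// -mulrBl mulrC.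
have {}pn : p < 0 by rewrite lt_neqAle p0.
have -> : (fun x => p * x) @^-1` `]a, b]%classic = `[b / p, a / p[%classic.
  by apply/seteqP; split => x /=; rewrite !in_itv/= ltr_ndivlMr// ler_ndivrMr// mulrC andbC.
rewrite lam_co; last by rewrite ler_nM2r ?invr_lt0// ltW.
by rewrite ltr0_norm// invrN mulNr -mulrN opprB mulrBr ![p^-1 * _]mulrC.
Qed.

Lemma scales_swap : scales (fun p => (p.2, p.1)) 1.
Proof.
apply: scales_rect => //; first exact: measurable_swap.
move=> a b c d ab cd; have -> : (fun p : T2 => (p.2, p.1)) @^-1` rect a b c d = rect c d a b.
  by apply/seteqP; split => [[x y] [/= ? ?]|[x y] [/= ? ?]].
by rewrite mu2_rect ?ltW// mul1r mulrC.
Qed.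

Lemma scales_diag p q : p != 0 -> q != 0 -> scales (fun z => (p * z.1, q * z.2)) (`|p|^-1 * `|q|^-1).
Proof.
move=> p0 q0; have m1 : measurable_fun setT (fun z : T2 => p * z.1).
  by apply: measurable_funM => //; exact: measurable_fst.
have m2 : measurable_fun setT (fun z : T2 => q * z.2).
  by apply: measurable_funM => //; exact: measurable_snd.
apply: scales_rect; first exact: measurable_fun_pair.
  by rewrite mulr_ge0// invr_ge0.
move=> a b c d ab cd.
have -> : (fun z : T2 => (p * z.1, q * z.2)) @^-1` rect a b c d =
   ((fun x => p * x) @^-1` `]a, b]%classic) `*` ((fun x => q * x) @^-1` `]c, d]%classic) by [].
have mM r (I : set RM) : measurable I -> measurable ((fun x => r * x) @^-1` I).
  by move=> mI; rewrite -[X in measurable X]setTI; exact: (mulrl_measurable (D := setT)).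
transitivity ((`|p|^-1 * (b - a))%:E * (`|q|^-1 * (d - c))%:E)%E; last first.
  by rewrite -EFinM; congr EFin; ring.
rewrite product_measure1E; [|by apply: mM; exact: measurable_itv..].
by congr (_ * _)%E; exact: lam_scale.
Qed.

(** By Fubini: each vertical section of the preimage of a rectangle is a translate of a section of
    the rectangle. *)
Lemma scales_shear c : scales (fun z => (z.1, z.2 + c * z.1)) 1.
Proof.
have m2 : measurable_fun setT (fun z : T2 => z.2 + c * z.1).
  apply: measurable_funD; first exact: measurable_snd.
  by apply: measurable_funM => //; exact: measurable_fst.
have mf : measurable_fun setT (fun z : T2 => (z.1, z.2 + c * z.1) : T2).
  by apply: measurable_fun_pair => //; exact: measurable_fst.
apply: scales_rect => // a b u v ab uv.
set V := (X in mu2 X); transitivity (\int[lam]_x (lam \o xsection V) x)%E => //; rewrite /V.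
rewrite mul1r (eq_integral (fun x : RM => (\1_(`]a, b]%classic) x * (v - u))%:E)).
  under eq_integral do rewrite EFinM.
  rewrite ge0_integralZr//; last 2 first.
  - by apply: measurableT_comp => //; apply/measurable_indicP; exact: measurable_itv.
  - by rewrite lee_fin subr_ge0 ltW.
  rewrite integral_indic//.
  by rewrite setIT EFinM; congr (_ * _)%E; apply: lam_oc; exact: ltW.
move=> x _ /=; rewrite indicE.
have -> : xsection ((fun z : T2 => (z.1, z.2 + c * z.1)) @^-1` rect a b u v) x =
    if x \in `]a, b]%classic then `]u - c * x, v - c * x]%classic else set0.
  apply/seteqP; split => y; rewrite /xsection/= inE /rect/= /mkset/=.
    move=> [xab]; rewrite mem_set// => h /=; rewrite in_itv/=.
    by move: h; rewrite in_itv/= ltrBlDr lerBrDr.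
  case: ifPn => // /set_mem xab; rewrite /= in_itv/= ltrBlDr lerBrDr => h.
  by split => //=; rewrite in_itv.
case: ifPn => _; last by rewrite measure0 mul0r.
rewrite mul1r lam_oc; first by congr EFin; ring.
by rewrite lerB// ltW.
Qed.

Definition mul_plane (a : C) (p : R * R) : R * R := to_xy (a * of_xy p).

Lemma mul_planeE p q z : mul_plane (p +i* q) z = (p * z.1 - q * z.2, q * z.1 + p * z.2).
Proof. by case: z => x y; rewrite /mul_plane /of_xy /to_xy; simpc; rewrite /= [q * x + _]addrC. Qed.

(** For [p != 0] the matrix of multiplication by [p +i* q] is a horizontal shear followed by the
    diagonal matrix of [p] and [(p ^+ 2 + q ^+ 2) / p], followed by a vertical shear. For [p = 0]
    the number is a product of two factors with nonzero real part. *)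
Lemma scales_mul_plane (a : C) : a != 0 -> scales (mul_plane a) (cabs a ^- 2).
Proof.
have main (p q : R) : p != 0 -> scales (mul_plane (p +i* q)) (cabs (p +i* q) ^- 2).
  move=> p0; pose r := (p ^+ 2 + q ^+ 2) / p.
  have s0 : p ^+ 2 + q ^+ 2 != 0 by rewrite gt_eqF// ltr_wpDr ?sqr_ge0// exprn_even_gt0.
  have r0 : r != 0 by rewrite mulf_neq0// invr_neq0.
  have h1 := scales_comp (scales_comp scales_swap (scales_shear (- q / p))) scales_swap.
  have := scales_comp (scales_comp h1 (scales_diag p0 r0)) (scales_shear (q / p)).
  set k := (X in scales _ X); set f := (X in scales X _).
  have -> : k = cabs (p +i* q) ^- 2.
    rewrite /k !mul1r mulr1 -invfM -normrM sqr_cabs/= /r mulrCA mulfV// mulr1 ger0_norm//.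
    by rewrite addr_ge0 ?sqr_ge0.
  have -> // : f = mul_plane (p +i* q).
  apply/funext => -[x y]; rewrite mul_planeE /f /=; congr (_, _); rewrite /r; field => //.
case: a => p q a0; have [p0|p0] := eqVneq p 0; last exact: main.
rewrite p0 in a0 *; have q0 : q != 0 by apply: contraNneq a0 => ->.
have e : 0 +i* q = (1 +i* 1) * (q / 2 +i* (q / 2)) by simpc; congr (_ +i* _); field.
have q2 : q / 2 != 0 by rewrite mulf_neq0// invr_neq0.
have := scales_comp (main _ (q / 2) q2) (main 1 1 (oner_neq0 _)).
have -> : cabs (q / 2 +i* (q / 2)) ^- 2 * cabs (1 +i* 1) ^- 2 = cabs (0 +i* q) ^- 2.
  have := cabsM (1 +i* 1) (q / 2 +i* (q / 2)); rewrite -e => ->; by rewrite exprMn [RHS]invfM mulrC.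
suff -> : mul_plane (0 +i* q) = mul_plane (1 +i* 1) \o mul_plane (q / 2 +i* (q / 2)) by [].
by apply/funext => z; rewrite /= /mul_plane to_xyK mulrA -e.
Qed.

Lemma scales_translate (w : C) : scales (fun p => (p.1 + complex.Re w, p.2 + complex.Im w)) 1.
Proof.
have m1 : measurable_fun setT (fun z : T2 => z.1 + complex.Re w).
  by apply: measurable_funD => //; exact: measurable_fst.
have m2 : measurable_fun setT (fun z : T2 => z.2 + complex.Im w).
  by apply: measurable_funD => //; exact: measurable_snd.
apply: scales_rect => //; first exact: measurable_fun_pair.
move=> a b c d ab cd; have -> : (fun z : T2 => (z.1 + complex.Re w, z.2 + complex.Im w)) @^-1` rect a b c d =
   rect (a - complex.Re w) (b - complex.Re w) (c - complex.Im w) (d - complex.Im w).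
  apply/seteqP; split => [[x y] [/=]|[x y] [/=]]; rewrite /rect/= !in_itv/= !ltrBlDr !lerBrDr.
    by move=> -> ->.
  by move=> -> ->.
by rewrite mu2_rect ?lerB ?(ltW ab) ?(ltW cd)// mul1r; congr EFin; ring.
Qed.

End plane_measure.

(** * Measurability and auxiliary measures *)

Section plane_topology.
Context {R : realType}.
Local Notation C := R[i].
Local Notation RM := (measurableTypeR R).
Local Notation T2 := (RM * RM)%type.
Local Notation mu2 := (@lebesgue_measure R \x @lebesgue_measure R)%E.
Implicit Types (D U V : set C) (f : C -> C) (z w : C) (a b c d x y r e : R).

Definition closed_rect a b c d : set C :=
  [set z | a <= complex.Re z <= b /\ c <= complex.Im z <= d].

Definition plane D : set T2 := @of_xy R @^-1` D.

(** The rectangles are rational squares. Their closures lie in [D], so that continuous functions on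
    [D] are bounded on each of them. *)
Lemma open_rect_cover D : open D -> exists Q : nat -> (R * R) * (R * R),
  (forall n, closed_rect (Q n).1.1 (Q n).1.2 (Q n).2.1 (Q n).2.2 `<=` D) /\
  plane D = \bigcup_n rect (Q n).1.1 (Q n).1.2 (Q n).2.1 (Q n).2.2.
Proof.
move=> /openC_cabs oD.
pose sq (t : rat * rat * rat) : (R * R) * (R * R) := let p := ratr t.1.1 in let q := ratr t.1.2 in
  let s := ratr t.2 in ((p - s, p + s), (q - s, q + s)).
pose ok (Q : (R * R) * (R * R)) := closed_rect Q.1.1 Q.1.2 Q.2.1 Q.2.2 `<=` D.
(* Reversed bounds give an empty rectangle, the value at the indices that code no square with
   closure in [D]. *)
pose e0 : (R * R) * (R * R) := ((1, 0), (1, 0)).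
pose Q n := if unpickle n is Some t then if `[< ok (sq t) >] then sq t else e0 else e0.
have ok0 : ok e0 by move=> z [/= h1 h2]; exfalso; lra.
have okQ n : ok (Q n).
  by rewrite /Q; case: unpickle => [t|//]; case: asboolP.
exists Q; split => //; apply/seteqP; split; last first.
  move=> [x y] [n _]; rewrite /rect /= => -[/=]; rewrite !in_itv/= => h1 h2.
  apply: (okQ n); split => /=; lra.
move=> [x y] Dxy; have [r r0 hr] := oD _ Dxy.
have [s] := @rat_in_itvoo _ 0 (r / 4) (divr_gt0 r0 (ltr0n R 4)).
rewrite in_itv/= => /andP[s0 sr].
have [p] := @rat_in_itvoo _ (x - ratr s) (x + ratr s) ltac:(lra).
rewrite in_itv/= => /andP[p1 p2].
have [q] := @rat_in_itvoo _ (y - ratr s) (y + ratr s) ltac:(lra).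
rewrite in_itv/= => /andP[q1 q2].
exists (pickle (p, q, s)) => //.
have -> : Q (pickle (p, q, s)) = sq (p, q, s).
  rewrite /Q pickleK; case: asboolP => // -[]; move=> [u v] [/= h1 h2]; apply: hr.
  apply: le_lt_trans (cabs_ReIm _) _; rewrite /of_xy /=.
  apply: (@le_lt_trans _ _ (2 * ratr s + 2 * ratr s)); last by lra.
  by apply: lerD; rewrite ler_norml; lra.
by split; rewrite /= in_itv/=; lra.
Qed.

Lemma measurable_plane D : open D -> measurable (plane D).
Proof.
move=> /open_rect_cover[Q [_ ->]]; apply: bigcupT_measurable => n.
exact: measurable_rect.
Qed.

Definition rcont (g : C -> R) z := forall e, 0 < e ->
  exists2 r : R, 0 < r & forall k, cabs k < r -> `|g (z + k) - g z| < e.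

Lemma rcont_Re f z : ccont f z -> rcont (fun z => complex.Re (f z)) z.
Proof.
move=> h e e0; have [r r0 hr] := h e e0; exists r => // k /hr; apply: le_lt_trans.
by have := norm_Re_cabs (f (z + k) - f z); case: (f (z + k)) (f z) => ? ? [].
Qed.

Lemma rcont_Im f z : ccont f z -> rcont (fun z => complex.Im (f z)) z.
Proof.
move=> h e e0; have [r r0 hr] := h e e0; exists r => // k /hr; apply: le_lt_trans.
by have := norm_Im_cabs (f (z + k) - f z); case: (f (z + k)) (f z) => ? ? [].
Qed.

Lemma rcont_cabs f z : ccont f z -> rcont (fun z => cabs (f z)) z.
Proof.
move=> h e e0; have [r r0 hr] := h e e0; exists r => // k /hr; apply: le_lt_trans.
rewrite ler_norml; apply/andP; split.
  by rewrite lerNl opprB cabs_distrC; exact: ler_cabs_dist.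
exact: ler_cabs_dist.
Qed.

Lemma measurable_rcont D (g : C -> R) : open D -> (forall z, D z -> rcont g z) ->
  measurable_fun (plane D) (fun p : T2 => g (of_xy p)).
Proof.
move=> oD cg; apply: (measurability (@RGenOInfty.G R)).
  exact: RGenOInfty.measurableE.
move=> _ [_ [x ->] <-].
rewrite (_ : _ `&` _ = plane (D `&` [set z | x < g z])); last first.
  by apply/seteqP; split => p /=; rewrite in_itv/= andbT.
apply: measurable_plane; apply/openC_cabs => z [Dz xz].
have /openC_cabs/(_ _ Dz)[r r0 hr] := oD.
have [s s0 hs] := cg z Dz (g z - x) ltac:(by rewrite subr_gt0).
exists (Num.min r s); first by rewrite lt_min r0.
move=> w; rewrite lt_min => /andP[wr ws]; split; first exact: hr.
by have := hs _ ws; rewrite subrKC /= ltr_norml; lra.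
Qed.

(** Compactness by bisection, with the defect 0 on rectangles where [g] is bounded and 1 on the
    others: unboundedness passes to one of the quarters, while continuity bounds [g] near each
    point. *)
Lemma closed_rect_bounded (g : C -> R) a b c d : a <= b -> c <= d ->
  (forall z, closed_rect a b c d z -> rcont g z) ->
  exists2 M : R, 0 <= M & forall z, closed_rect a b c d z -> `|g z| <= M.
Proof.
move=> ab cd cg.
pose bd a b c d := exists2 M : R, 0 <= M & forall z, closed_rect a b c d z -> `|g z| <= M.
pose T (Q : (R * R) * (R * R)) : R := if `[< bd Q.1.1 Q.1.2 Q.2.1 Q.2.2 >] then 0 else 1.
have T0 Q : 0 <= T Q by rewrite /T; case: ifP.
have : T ((a, b), (c, d)) <= 0.
  apply: bisection_le0 => //.
    move=> a' b' c' d' _ _ _ _ _ _; cbv zeta; set m := (a' + b') / 2; set n := (c' + d') / 2.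
    rewrite {1}/T; case: asboolP => hb /=; first by rewrite !addr_ge0.
    have S Q : 0 <= T Q by exact: T0.
    have B Q : ~ bd Q.1.1 Q.1.2 Q.2.1 Q.2.2 -> T Q = 1.
      by rewrite /T; case: asboolP.
    have T1 Q : bd Q.1.1 Q.1.2 Q.2.1 Q.2.2 \/ T Q = 1.
      by have [|/B] := pselect (bd Q.1.1 Q.1.2 Q.2.1 Q.2.2); [left|right].
    have s1 := S (a', m, (c', n)); have s2 := S (m, b', (c', n)).
    have s3 := S (a', m, (n, d')); have s4 := S (m, b', (n, d')).
    case: (T1 (a', m, (c', n))) => [[M1 M10 h1]|]; last by lra.
    case: (T1 (m, b', (c', n))) => [[M2 M20 h2]|]; last by lra.
    case: (T1 (a', m, (n, d'))) => [[M3 M30 h3]|]; last by lra.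
    case: (T1 (m, b', (n, d'))) => [[M4 M40 h4]|]; last by lra.
    exfalso; apply: hb; exists (M1 + M2 + M3 + M4); first by rewrite !addr_ge0.
    move=> z [/= /andP[z1 z2] /andP[z3 z4]].
    case: (leP (complex.Re z) m) => x1; case: (leP (complex.Im z) n) => y1.
    - by apply: le_trans (h1 z _) _; [split => /=; rewrite ?z1 ?x1 ?z3 ?y1|move: M20 M30 M40; clear; lra].
    - by apply: le_trans (h3 z _) _; [split => /=; rewrite ?z1 ?x1 ?z4 ?(ltW y1)|move: M10 M20 M40; clear; lra].
    - by apply: le_trans (h2 z _) _; [split => /=; rewrite ?z2 ?(ltW x1) ?z3 ?y1|move: M10 M30 M40; clear; lra].
    - by apply: le_trans (h4 z _) _; [split => /=; rewrite ?z2 ?(ltW x1) ?z4 ?(ltW y1)|move: M10 M20 M30; clear; lra].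
  move=> x y xab ycd e e0; have zin : closed_rect a b c d (x +i* y) by [].
  have [r r0 hr] := cg _ zin 1 ltr01.
  exists (r / 2); first by rewrite divr_gt0.
  move=> a' b' c' d' h1 h2 h3 h4 s1 s2.
  rewrite /T; case: asboolP => [_|[]]; first by rewrite mulr_ge0 ?sqr_ge0 ?ltW.
  exists (`|g (x +i* y)| + 1); first by rewrite addr_ge0.
  move=> z [/= z1 z2]; have := hr (z - (x +i* y)); rewrite subrKC => h.
  have : `|g z - g (x +i* y)| < 1.
    apply: h; apply: le_lt_trans (cabs_ReIm _) _; case: z z1 z2 => u v /= z1 z2.
    have h5 : `|u - x| <= b' - a' by rewrite ler_norml; lra.
    have h6 : `|v - y| <= d' - c' by rewrite ler_norml; lra.
    lra.
  have := ler_normD (g z - g (x +i* y)) (g (x +i* y)); rewrite subrK; lra.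
by rewrite /T; case: asboolP => //=; rewrite ler10.
Qed.

End plane_topology.

(** * Images of restricted measures and measures with a density *)

Section measures.
Context d d' (T : measurableType d) (T' : measurableType d') (R : realType).
Variables (mu : {measure set T -> \bar R}) (D : set T) (mD : measurable D).

Section partial_pushforward.
Variables (f : T -> T') (mf : measurable_fun D f).

(** The proofs of measurability are arguments so that the structure of measure, which depends on
    them, can be attached to the term; [dens] is built in the same way. *)
Definition ppush (mD : measurable D) (mf : measurable_fun D f) (E : set T') : \bar R := mu (D `&` f @^-1` E).

Let ppush0 : ppush mD mf set0 = 0%E.
Proof. by rewrite /ppush preimage_set0 setI0 measure0. Qed.

Let ppush_ge0 E : (0 <= ppush mD mf E)%E.
Proof. exact: measure_ge0. Qed.

Let ppush_sigma_additive : semi_sigma_additive (ppush mD mf).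
Proof.
move=> F mF tF mUF; rewrite /ppush preimage_bigcup setI_bigcupr.
apply: measure_semi_sigma_additive.
- by move=> n; exact: mf.
- apply/trivIsetP => i j _ _ ij; rewrite setIACA -(preimage_setI f).
  by move/trivIsetP : tF => /(_ i j Logic.I Logic.I ij) ->; rewrite preimage_set0 setI0.
- by rewrite -setI_bigcupr -preimage_bigcup; exact: mf.
Qed.

HB.instance Definition _ := isMeasure.Build _ _ _ (ppush mD mf) ppush0 ppush_ge0 ppush_sigma_additive.
End partial_pushforward.

Section density.
Variables (g : T -> R) (mg : measurable_fun D g) (g0 : forall x, D x -> 0 <= g x).

Definition dens (mD : measurable D) (mg : measurable_fun D g)
  (g0 : forall x, D x -> 0 <= g x) (E : set T) : \bar R := (\int[mu]_(x in D `&` E) (g x)%:E)%E.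

Let dens0 : dens mD mg g0 set0 = 0%E.
Proof. by rewrite /dens setI0 integral_set0. Qed.

Let dens_ge0 E : (0 <= dens mD mg g0 E)%E.
Proof. by apply: integral_ge0 => x [Dx _]; rewrite lee_fin g0. Qed.

Let dens_sigma_additive : semi_sigma_additive (dens mD mg g0).
Proof.
move=> F mF tF mUF; rewrite /dens setI_bigcupr ge0_integral_bigcup.
- apply: is_cvg_ereal_nneg_natsum_cond => n _ _.
  by apply: integral_ge0 => x [Dx _]; rewrite lee_fin g0.
- by move=> n; exact: measurableI.
- rewrite -setI_bigcupr; apply/measurable_EFinP; apply: measurable_funS mg => //.
- by move=> x [n _ [Dx _]]; rewrite lee_fin g0.
- apply/trivIsetP => i j _ _ ij; rewrite setIACA.
  by move/trivIsetP : tF => /(_ i j Logic.I Logic.I ij) ->; rewrite setI0.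
Qed.

HB.instance Definition _ := isMeasure.Build _ _ _ (dens mD mg g0) dens0 dens_ge0 dens_sigma_additive.
End density.

End measures.

(** * Conformal change of variables *)

Section deriv_holo.
Context {R : realType}.
Local Notation C := R[i].

Lemma holo_deriv (U : set C) (f df : C -> C) : open U -> (forall z, U z -> cderiv f z (df z)) ->
  forall z, U z -> exists d, cderiv df z d.
Proof.
move=> /openC_cabs oU hf z Uz; have [r r0 hr] := oU z Uz.
have Uk k : cabs k < r -> U (z + k) by move=> kr; apply: hr; rewrite addrC addKr.
have hk : holo_disc (fun k => f (z + k)) r.
  by move=> k kr; exists (df (z + k)); apply: cderiv_shift; exact/hf/Uk.
have [a fa] := disc_taylor r0 hk; have [g ga hg] := has_ps_deriv fa.
have z0 : cabs (0 : C) < r by rewrite cabs0.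
have [d hd] := has_ps_holo ga z0.
exists d; rewrite -[z]addr0; apply: cderiv_unshift; apply: cderiv_eq hd.
exists r => // k kr; rewrite add0r.
apply: cderiv_unique (hg k kr) _; apply: cderiv_shift; exact/hf/Uk.
Qed.

End deriv_holo.

Lemma ler_normB4 (R : realDomainType) (x1 x2 x3 x4 y1 y2 y3 y4 : R) :
  `|x1 + x2 + x3 + x4 - (y1 + y2 + y3 + y4)| <= `|x1 - y1| + `|x2 - y2| + `|x3 - y3| + `|x4 - y4|.
Proof.
rewrite (_ : _ - _ = x1 - y1 + (x2 - y2) + (x3 - y3) + (x4 - y4)); last by ring.
apply: le_trans (ler_normD _ _) _; rewrite lerD2r.
apply: le_trans (ler_normD _ _) _; rewrite lerD2r; exact: ler_normD.
Qed.

Section squeeze.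
Context {R : realFieldType}.
Implicit Types (a b x y s t q : R).

Lemma itv_grow a b x y q : a < x <= b -> `|y - x| <= q -> a - q < y <= b + q.
Proof. by rewrite ler_norml; lra. Qed.

Lemma itv_shrink a b x y q : a + q < x <= b - q -> `|y - x| <= q -> a < y <= b.
Proof. by rewrite ler_norml; lra. Qed.

Lemma itv_shrink_closed a b x q : 0 <= q -> a + q < x <= b - q -> a <= x <= b.
Proof. by lra. Qed.

Lemma itv_grow_le a b q : 0 <= q -> a <= b -> a - q <= b + q.
Proof. by lra. Qed.

Lemma itv_shrink_le a b q : 2 * q < b - a -> a + q <= b - q.
Proof. by lra. Qed.

(** Moving the sides of an [s] by [t] rectangle by [q] changes its area by at most
    [2 * q * (s + t) + 4 * q ^+ 2]. As [q <= s + t], this is at most [6 * q * (s + t)], which is the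
    origin of the 6. *)
Lemma area_squeeze s t q eta D e F : 0 <= s + t -> q = eta * (s + t) -> 0 <= q ->
  eta <= 1 / 4 -> 0 <= D -> 6 * eta * D <= e ->
  F <= D * ((s + 2 * q) * (t + 2 * q)) -> D * (s * t - 2 * q * (s + t)) <= F ->
  `|F - D * (s * t)| <= e * (s + t) ^+ 2.
Proof.
move=> S0 qE q0 eta1 D0 hD Fp Fm.
have q1 : q <= s + t by rewrite qE -[leRHS]mul1r ler_wpM2r//; lra.
have key : D * (6 * q * (s + t)) <= e * (s + t) ^+ 2.
  rewrite [leLHS](_ : _ = 6 * eta * D * (s + t) ^+ 2); last by rewrite qE; ring.
  by rewrite ler_wpM2r ?sqr_ge0.
have h6 : (s + 2 * q) * (t + 2 * q) - s * t <= 6 * q * (s + t).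
  by have := ler_wpM2l q0 q1; lra.
have := ler_wpM2l D0 h6; have := mulr_ge0 D0 (mulr_ge0 q0 S0).
by rewrite ler_norml; lra.
Qed.

End squeeze.

Section change_of_variables.
Context {R : realType}.
Local Notation C := R[i].
Local Notation RM := (measurableTypeR R).
Local Notation T2 := (RM * RM)%type.
Local Notation mu2 := (@lebesgue_measure R \x @lebesgue_measure R)%E.
Implicit Types (a b c d x y r e : R).

Lemma rect_splitx (m : {measure set T2 -> \bar R}) a b c d x : a <= x <= b ->
  m (rect a b c d) = (m (rect a x c d) + m (rect x b c d))%E.
Proof.
move=> axb; rewrite -measureU; [|exact: measurable_rect..|].
- congr (m _); apply/seteqP; split => [[u v] [/=]|[u v] [] [/=]]; rewrite /rect/= !in_itv/=.
  + move=> h1 h2; case: (leP u x) => ux; [left|right]; split => //; lra.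
  + by move=> h1 h2; split => //; lra.
  + by move=> h1 h2; split => //; lra.
- apply/seteqP; split => // -[u v] [] [/=]; rewrite !in_itv/= => h1 _ [/= h2 _].
  by move: h2; rewrite in_itv/=; lra.
Qed.

Lemma rect_splity (m : {measure set T2 -> \bar R}) a b c d y : c <= y <= d ->
  m (rect a b c d) = (m (rect a b c y) + m (rect a b y d))%E.
Proof.
move=> cyd; rewrite -measureU; [|exact: measurable_rect..|].
- congr (m _); apply/seteqP; split => [[u v] [/=]|[u v] [] [/=]]; rewrite /rect/= !in_itv/=.
  + move=> h1 h2; case: (leP v y) => vy; [left|right]; split => //; lra.
  + by move=> h1 h2; split => //; lra.
  + by move=> h1 h2; split => //; lra.
- apply/seteqP; split => // -[u v] [] [/=]; rewrite !in_itv/= => _ h1 [/= _ h2].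
  by move: h2; rewrite in_itv/=; lra.
Qed.

Variables (U : set C) (phi dphi psi : C -> C).
Hypothesis openU : open U.
Hypothesis hphi : forall z, U z -> cderiv phi z (dphi z).
Hypothesis inj : {in U &, injective phi}.
Hypothesis psiK : forall z, U z -> psi (phi z) = z.

Let V := phi @` U.
Let openV : open V := open_image openU hphi inj.
Let mU : measurable (plane U) := measurable_plane openU.
Let mV : measurable (plane V) := measurable_plane openV.

Let d0 z : U z -> dphi z != 0.
Proof. exact: (injective_deriv_neq0 openU hphi inj psiK). Qed.

Let cdphi z : U z -> ccont dphi z.
Proof. by move=> Uz; have [d /cderiv_cont] := holo_deriv openU hphi Uz. Qed.

Let cpsi w : V w -> ccont psi w.
Proof. by move=> [z Uz <-]; exact: (inverse_cont openU hphi inj psiK). Qed.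

Let psiU w : V w -> U (psi w).
Proof. by move=> [z Uz <-]; rewrite psiK. Qed.

Let phipsi w : V w -> phi (psi w) = w.
Proof. by move=> [z Uz <-]; rewrite psiK. Qed.

Let g (p : T2) : R := cabs (dphi (of_xy p)) ^+ 2.

Let mg : measurable_fun (plane U) g.
Proof.
apply: measurable_funX; apply: (measurable_rcont (g := fun z => cabs (dphi z))) => // z Uz.
exact/rcont_cabs/cdphi.
Qed.

Let g0 p : plane U p -> 0 <= g p. Proof. by move=> _; exact: sqr_ge0. Qed.

Let theta (p : T2) : T2 := to_xy (psi (of_xy p)).

Let mtheta : measurable_fun (plane V) theta.
Proof.
apply: (measurability (@rects R)); first exact: measurable_planeE.
move=> _ [_ /rectsP[a [b [c [d ->]]]] <-].
have m1 : measurable_fun (plane V) (fun p : T2 => complex.Re (psi (of_xy p))).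
  by apply: (measurable_rcont (g := fun z => complex.Re (psi z))) => // w Vw; exact/rcont_Re/cpsi.
have m2 : measurable_fun (plane V) (fun p : T2 => complex.Im (psi (of_xy p))).
  by apply: (measurable_rcont (g := fun z => complex.Im (psi z))) => // w Vw; exact/rcont_Im/cpsi.
rewrite (_ : _ `&` _ =
   (plane V `&` (fun p : T2 => complex.Re (psi (of_xy p))) @^-1` `]a, b]%classic) `&`
   (plane V `&` (fun p : T2 => complex.Im (psi (of_xy p))) @^-1` `]c, d]%classic)); last first.
  by apply/seteqP; split => [p [Vp [/= h1 h2]]|p [[Vp h1] [_ h2]]].
by apply: measurableI; [apply: m1|apply: m2] => //; exact: measurable_itv.
Qed.

(** [m1 E] is the area of the image under [phi] of the part of [E] in [U], written with the inverse
    map so that it is visibly a measure; [m2 E] is the integral of the Jacobian over the same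
    part. *)
Let m1 : {measure set T2 -> \bar R} := ppush mu2 mV mtheta.
Let m2 : {measure set T2 -> \bar R} := dens mu2 mU mg g0.

Let rect_closed a b c d (p : T2) : rect a b c d p -> closed_rect a b c d (of_xy p).
Proof. by case: p => x y [/=]; rewrite !in_itv/= => h1 h2; split => /=; lra. Qed.

Let m2_bounds a b c d (l u : R) : a <= b -> c <= d -> closed_rect a b c d `<=` U -> 0 <= l ->
  (forall z, closed_rect a b c d z -> l <= cabs (dphi z) ^+ 2 <= u) ->
  ((l * ((b - a) * (d - c)))%:E <= m2 (rect a b c d) /\
   m2 (rect a b c d) <= (u * ((b - a) * (d - c)))%:E)%E.
Proof.
move=> ab cd sU l0 hlu; rewrite /m2/= /dens.
have sP : rect a b c d `<=` plane U by move=> p /rect_closed /sU.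
have -> : plane U `&` rect a b c d = rect a b c d by exact/setIidr.
have mr := measurable_rect a b c d.
have mgr : measurable_fun (rect a b c d) (fun p => (g p)%:E).
  by apply/measurable_EFinP; exact: measurable_funS mg.
have cst (k : R) : (\int[mu2]_(p in rect a b c d) k%:E = (k * ((b - a) * (d - c)))%:E)%E.
  by rewrite integral_cst// [X in (_ * X)%E](_ : _ = ((b - a) * (d - c))%:E)//; exact: mu2_rect.
split; rewrite -cst; apply: ge0_le_integral => //.
- by move=> p /rect_closed /hlu /andP[+ _]; rewrite lee_fin.
- by move=> p /rect_closed /sU Up; rewrite lee_fin g0.
- by move=> p /rect_closed /hlu /andP[_ +]; rewrite lee_fin.
Qed.

Let m2_fin a b c d : a <= b -> c <= d -> closed_rect a b c d `<=` U -> (m2 (rect a b c d) < +oo)%E.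
Proof.
move=> ab cd sU.
have [|M M0 hM] := @closed_rect_bounded _ (fun z => cabs (dphi z)) a b c d ab cd.
  by move=> z /sU Uz; exact/rcont_cabs/cdphi.
have [||_] := @m2_bounds a b c d 0 (M ^+ 2) ab cd sU.
- by [].
- move=> z /hM; rewrite ger0_norm ?cabs_ge0// => h; rewrite sqr_ge0/=.
  by rewrite lerXn2r// nnegrE cabs_ge0.
- by move=> /le_lt_trans; apply; rewrite ltry.
Qed.

Let m1_fin a b c d : a <= b -> c <= d -> closed_rect a b c d `<=` U -> (m1 (rect a b c d) < +oo)%E.
Proof.
move=> ab cd sU.
have [|M M0 hM] := @closed_rect_bounded _ (fun z => cabs (phi z)) a b c d ab cd.
  by move=> z /sU Uz; apply: rcont_cabs; exact: cderiv_cont (hphi Uz).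
apply: le_lt_trans (mu2_rect_lty (- (M + 1)) M (- (M + 1)) M).
rewrite /m1/= /ppush; apply: le_measure; rewrite ?inE.
- by apply: mtheta => //; exact: measurable_rect.
- exact: measurable_rect.
move=> p [Vp /rect_closed]; rewrite to_xyK => /hM; rewrite phipsi// ger0_norm ?cabs_ge0// => h.
have h1 := le_trans (norm_Re_cabs _) h; have h2 := le_trans (norm_Im_cabs _) h.
case: p Vp h1 h2 {h} => x y _ /=; rewrite !ler_norml => h1 h2.
by split => /=; rewrite in_itv/=; lra.
Qed.

(* Comparison of [phi] with its affine approximation at [z0] on small rectangles. *)
Let m1_local z0 e : U z0 -> 0 < e -> exists2 r : R, 0 < r &
  forall a b c d, a <= complex.Re z0 <= b -> c <= complex.Im z0 <= d -> b - a < r -> d - c < r ->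
  closed_rect a b c d `<=` U ->
  `|fine (m1 (rect a b c d)) - cabs (dphi z0) ^+ 2 * ((b - a) * (d - c))|
     <= e * ((b - a) + (d - c)) ^+ 2.
Proof.
move=> Uz0 e0; pose D := dphi z0; have D0 : D != 0 by exact: d0.
have cD : 0 < cabs D by rewrite cabs_gt0.
pose w0 := phi z0.
(* The two bounds are those required by [area_squeeze]. *)
pose eta := Num.min (1 / 4) (e / (6 * cabs D ^+ 2)).
have eta0 : 0 < eta by rewrite lt_min !divr_gt0// mulr_gt0// exprn_gt0.
have eta1 : eta <= 1 / 4 by rewrite ge_min lexx.
have eta2 : 6 * eta * cabs D ^+ 2 <= e.
  rewrite mulrAC -ler_pdivlMl; last by rewrite mulr_gt0// exprn_gt0.
  by rewrite mulrC ge_min lexx orbT.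
(* The tolerances for [phi] and for its inverse carry [cabs D] and its inverse, so that both errors
   become displacements of at most [q = eta * S] in the domain. *)
have [r1 r10 h1] := hphi Uz0 (mulr_gt0 eta0 cD).
have [r2 r20 h2] := inverse_cderiv openU hphi inj psiK Uz0 D0 (divr_gt0 eta0 cD).
have [r3 r30 h3] := (openC_cabs V).1 openV w0 (ex_intro2 _ _ z0 Uz0 erefl).
pose r := Num.min r1 (Num.min (r2 / cabs D) (r3 / cabs D)).
have r0 : 0 < r by rewrite !lt_min r10 !divr_gt0.
have [l1 [l2 l3]] : r <= r1 /\ (r <= r2 / cabs D /\ r <= r3 / cabs D).
  by rewrite !ge_min !lexx !orbT.
exists (r / 2); first by rewrite divr_gt0.
move=> a b c d hx hy sa sc sU; set s := b - a in sa *; set t := d - c in sc *.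
have ab : a <= b by lra.
have cd : c <= d by lra.
have s0 : 0 <= s by rewrite /s; lra.
have t0 : 0 <= t by rewrite /t; lra.
pose S := s + t; have S0 : 0 <= S by rewrite /S /s /t; lra.
have Sr : S < r by rewrite /S; lra.
have distS z : closed_rect a b c d z -> cabs (z - z0) <= S.
  move=> [z1 z2]; apply: le_trans (cabs_ReIm _) _; rewrite /S /s /t.
  have -> : complex.Re (z - z0) = complex.Re z - complex.Re z0 by case: (z) (z0) => ? ? [].
  have -> : complex.Im (z - z0) = complex.Im z - complex.Im z0 by case: (z) (z0) => ? ? [].
  by apply: lerD; rewrite ler_norml; lra.
(* [A] inverts the affine approximation. *)
pose A (p : T2) : T2 := to_xy (z0 + D^-1 * (of_xy p - w0)).
have sA : scales A (cabs D ^+ 2).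
  have := scales_comp (scales_comp (scales_translate (- w0)) (scales_mul_plane (invr_neq0 D0)))
    (scales_translate z0).
  rewrite cabsV mulr1 mul1r exprVn invrK; set f := (X in scales X _).
  suff -> : f = A by [].
  apply/funext => -[x y]; rewrite /f /A /= /mul_plane /of_xy /to_xy /=.
  case: (D^-1) (z0) (w0) => d1 d2 [x0 y0] [u0 v0] /=.
  by congr (_, _) => /=; rewrite addrC.
have [mA [_ hA]] := sA.
pose q := eta * S.
have q0 : 0 <= q by rewrite mulr_ge0// ltW.
pose Qp := rect (a - q) (b + q) (c - q) (d + q).
pose Qm := rect (a + q) (b - q) (c + q) (d - q).
pose W := plane V `&` theta @^-1` rect a b c d.
have mW : measurable W by apply: mtheta => //; exact: measurable_rect.
have mApre Q : measurable Q -> measurable (A @^-1` Q).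
  by move=> mQ; rewrite -[X in measurable X]setTI; exact: mA.
have near_re (z w : C) : cabs (z - w) <= q ->
    `|complex.Re z - complex.Re w| <= q /\ `|complex.Im z - complex.Im w| <= q.
  move=> h; split.
    by have := le_trans (norm_Re_cabs _) h; case: (z) (w) => ? ? [].
  by have := le_trans (norm_Im_cabs _) h; case: (z) (w) => ? ? [].
(* [W] is squeezed between the preimages under [A] of a shrunk and an enlarged rectangle. The outer
   inclusion expands [phi] at [z0]; the inner one expands the inverse at [w0], which stands in for
   an argument that the image covers enough. *)
have up : W `<=` A @^-1` Qp.
  move=> p [Vp hp]; have hc := rect_closed hp; rewrite to_xyK in hc.
  set z := psi (of_xy p) in hc hp; have zS := distS _ hc.
  have zr : cabs (z - z0) < r1 by exact: le_lt_trans zS (lt_le_trans Sr l1).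
  have := h1 _ zr; rewrite subrKC phipsi// -/w0 -/D => hE.
  have hq : cabs (z0 + D^-1 * (of_xy p - w0) - z) <= q.
    have -> : z0 + D^-1 * (of_xy p - w0) - z = D^-1 * (of_xy p - w0 - D * (z - z0)).
      by field.
    rewrite cabsM cabsV ler_pdivrMl//; apply: le_trans hE _.
    by rewrite /q mulrA [cabs D * eta]mulrC ler_wpM2l// mulr_ge0// ltW.
  have [q1 q2] := near_re _ _ hq.
  move: hp => [/=]; rewrite !in_itv/= => p1 p2.
  by split; rewrite /= in_itv/=; [exact: itv_grow p1 q1|exact: itv_grow p2 q2].
have down : A @^-1` Qm `<=` W.
  move=> p [/=]; rewrite !in_itv/=; set z := z0 + D^-1 * (of_xy p - w0) => p1 p2.
  have hc : closed_rect a b c d z by split; apply: itv_shrink_closed q0 _.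
  have zS := distS _ hc.
  have wE : of_xy p - w0 = D * (z - z0) by rewrite /z; field.
  have wc : cabs (of_xy p - w0) = cabs D * cabs (z - z0) by rewrite wE cabsM.
  have wr : cabs (of_xy p - w0) < cabs D * r.
    by rewrite wc ltr_pM2l//; exact: le_lt_trans zS Sr.
  have Vp : V (of_xy p).
    by apply: h3; apply: lt_le_trans wr _; rewrite mulrC -ler_pdivlMr.
  split => //.
  have wr2 : cabs (of_xy p - w0) < r2 by apply: lt_le_trans wr _; rewrite mulrC -ler_pdivlMr.
  have := h2 _ wr2; rewrite -/w0 -/D subrKC psiK// => hE.
  have hq : cabs (psi (of_xy p) - z) <= q.
    have -> : psi (of_xy p) - z = psi (of_xy p) - z0 - D^-1 * (of_xy p - w0) by rewrite /z; ring.
    apply: le_trans hE _; rewrite wc mulrA divfK ?gt_eqF//.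
    by rewrite ler_wpM2l// ltW.
  have [q1 q2] := near_re _ _ hq.
  by split; rewrite /= in_itv/=; [exact: itv_shrink p1 q1|exact: itv_shrink p2 q2].
have fin := m1_fin ab cd sU.
have W1 : m1 (rect a b c d) = (fine (m1 (rect a b c d)))%:E.
  by rewrite fineK// ge0_fin_numE.
set F := fine _ in W1 *.
have Fp : F <= cabs D ^+ 2 * ((s + 2 * q) * (t + 2 * q)).
  rewrite -lee_fin -W1; have := @le_measure _ _ _ mu2 W (A @^-1` Qp).
  rewrite !inE => /(_ mW (mApre _ (measurable_rect _ _ _ _)) up) H.
  apply: (@le_trans _ _ (mu2 (A @^-1` Qp))); first exact: H.
  rewrite hA; last exact: measurable_rect.
  rewrite [X in (_ * X)%E](_ : _ = ((s + 2 * q) * (t + 2 * q))%:E) ?EFinM//.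
  rewrite -EFinM [LHS]mu2_rect; [|exact: itv_grow_le..].
  by congr EFin; congr (_ * _); rewrite /s /t; ring.
have Fm : cabs D ^+ 2 * (s * t - 2 * q * S) <= F.
  have F0 : 0 <= F by rewrite -lee_fin -W1; exact: measure_ge0.
  (* When a side is at most [2 * q] there is nothing to shrink, but the lower bound is then
     nonpositive. *)
  have [sq|sq] := leP s (2 * q).
    apply: le_trans F0; rewrite mulr_ge0_le0 ?sqr_ge0// subr_le0.
    apply: (@le_trans _ _ (2 * q * t)); first by rewrite ler_wpM2r.
    by apply: ler_wpM2l; [rewrite mulr_ge0|rewrite /S lerDr].
  have [tq|tq] := leP t (2 * q).
    apply: le_trans F0; rewrite mulr_ge0_le0 ?sqr_ge0// subr_le0.
    apply: (@le_trans _ _ (s * (2 * q))); first by rewrite ler_wpM2l.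
    by rewrite mulrC; apply: ler_wpM2l; [rewrite mulr_ge0|rewrite /S lerDl].
  have : cabs D ^+ 2 * ((s - 2 * q) * (t - 2 * q)) <= F.
    rewrite -lee_fin -W1; have := @le_measure _ _ _ mu2 (A @^-1` Qm) W.
    rewrite !inE => /(_ (mApre _ (measurable_rect _ _ _ _)) mW down) H.
    apply: (@le_trans _ _ (mu2 (A @^-1` Qm))); last exact: H.
    rewrite hA; last exact: measurable_rect.
    rewrite [X in (_ <= _ * X)%E](_ : _ = ((s - 2 * q) * (t - 2 * q))%:E) ?EFinM//.
    rewrite -EFinM [LHS]mu2_rect; [|exact: itv_shrink_le..].
    by congr EFin; congr (_ * _); rewrite /s /t; ring.
  apply: le_trans; apply: ler_wpM2l; first exact: sqr_ge0.
  by have qq := mulr_ge0 q0 q0; rewrite /S; lra.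
exact: (area_squeeze S0 (erefl _) q0 eta1 (sqr_ge0 _) eta2 Fp Fm).
Qed.

Let m2_local z0 e : U z0 -> 0 < e -> exists2 r : R, 0 < r &
  forall a b c d, a <= complex.Re z0 <= b -> c <= complex.Im z0 <= d -> b - a < r -> d - c < r ->
  closed_rect a b c d `<=` U ->
  `|fine (m2 (rect a b c d)) - cabs (dphi z0) ^+ 2 * ((b - a) * (d - c))|
     <= e * ((b - a) + (d - c)) ^+ 2.
Proof.
move=> Uz0 e0; have c2 : ccont (fun z => dphi z * dphi z) z0 by apply: ccontM; exact: cdphi.
have [r r0 hr] := rcont_cabs c2 e0; exists (r / 2); first by rewrite divr_gt0.
move=> a b c d hx hy s1 s2 sU; have ab : a <= b by lra.
have cd : c <= d by lra.
set D2 := cabs (dphi z0) ^+ 2.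
have near z : closed_rect a b c d z -> Num.max 0 (D2 - e) <= cabs (dphi z) ^+ 2 <= D2 + e.
  move=> [z1 z2]; have := hr (z - z0); rewrite subrKC !cabsM -!expr2 -/D2 => h.
  have /ltW : `|cabs (dphi z) ^+ 2 - D2| < e.
    apply: h; apply: le_lt_trans (cabs_ReIm _) _.
    have -> : complex.Re (z - z0) = complex.Re z - complex.Re z0 by case: (z) (z0) => ? ? [].
    have -> : complex.Im (z - z0) = complex.Im z - complex.Im z0 by case: (z) (z0) => ? ? [].
    have h3 : `|complex.Re z - complex.Re z0| <= b - a by rewrite ler_norml; lra.
    have h4 : `|complex.Im z - complex.Im z0| <= d - c by rewrite ler_norml; lra.
    by lra.
  by rewrite ler_norml ge_max sqr_ge0/=; lra.
have fin := m2_fin ab cd sU.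
have E : m2 (rect a b c d) = (fine (m2 (rect a b c d)))%:E by rewrite fineK// ge0_fin_numE.
have l0 : 0 <= Num.max 0 (D2 - e) by rewrite le_max lexx.
have := m2_bounds ab cd sU l0 near.
set F := fine _ in E *; rewrite E !lee_fin => -[H1 H2].
have A0 : 0 <= (b - a) * (d - c) by rewrite mulr_ge0// subr_ge0.
have H3 : (D2 - e) * ((b - a) * (d - c)) <= F.
  by apply: le_trans H1; rewrite ler_wpM2r// le_max lexx orbT.
have H4 : (b - a) * (d - c) <= ((b - a) + (d - c)) ^+ 2.
  have k1 : 0 <= b - a by lra.
  have k2 : 0 <= d - c by lra.
  by have := sqr_ge0 (b - a); have := sqr_ge0 (d - c); rewrite sqrrD mulr2n; lra.
have := ler_wpM2l (ltW e0) H4; move: H3 H2; rewrite ler_norml.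
by move: ((b - a) * (d - c)) (_ ^+ 2) => A S; rewrite mulrBl mulrDl; lra.
Qed.

(** Bisection with the distance of the two measures as defect. Near each point both are close to the
    same multiple of the area, each up to [e / 2]. *)
Let rect_measure_eq a b c d : a <= b -> c <= d -> closed_rect a b c d `<=` U ->
  m1 (rect a b c d) = m2 (rect a b c d).
Proof.
move=> ab cd sU.
have sub a' b' c' d' : a <= a' -> b' <= b -> c <= c' -> d' <= d -> closed_rect a' b' c' d' `<=` U.
  by move=> h1 h2 h3 h4 z [/= z1 z2]; apply: sU; split; lra.
pose F (m : {measure set T2 -> \bar R}) (Q : (R * R) * (R * R)) := fine (m (rect Q.1.1 Q.1.2 Q.2.1 Q.2.2)).
have : (fun Q => `|F m1 Q - F m2 Q|) ((a, b), (c, d)) <= 0.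
  apply: (@bisection_le0 R (fun Q => `|F m1 Q - F m2 Q|) a b c d) => //; cbn [fst snd].
    move=> a' b' c' d' h1 h2 h3 h4 h5 h6; set m := (a' + b') / 2; set n := (c' + d') / 2.
    have hm : a' <= m <= b' by rewrite /m; lra.
    have hn : c' <= n <= d' by rewrite /n; lra.
    have split4 (M : {measure set T2 -> \bar R}) :
        (forall a b c d, a <= b -> c <= d -> closed_rect a b c d `<=` U -> (M (rect a b c d) < +oo)%E) ->
        F M (a', b', (c', d')) = F M (a', m, (c', n)) + F M (m, b', (c', n)) +
          F M (a', m, (n, d')) + F M (m, b', (n, d')).
      move=> Mfin; rewrite /F; cbn [fst snd].
      have fin a0 b0 c0 v0 : a' <= a0 <= b0 -> b0 <= b' -> c' <= c0 <= v0 -> v0 <= d' ->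
          M (rect a0 b0 c0 v0) \is a fin_num.
        move=> /andP[k1 k2] k3 /andP[k4 k5] k6; rewrite ge0_fin_numE//; apply: Mfin => //; apply: sub.
        - exact: le_trans k1.
        - exact: le_trans h3.
        - exact: le_trans k4.
        - exact: le_trans h6.
      have [m_a m_b] := andP hm; have [n_c n_d] := andP hn.
      rewrite (rect_splity M a' b' hn) !(rect_splitx M _ _ hm).
      have f1 := fin a' m c' n; have f2 := fin m b' c' n.
      have f3 := fin a' m n d'; have f4 := fin m b' n d'.
      rewrite !lexx m_a m_b n_c n_d in f1 f2 f3 f4.
      have {}f1 := f1 isT isT isT isT; have {}f2 := f2 isT isT isT isT.
      have {}f3 := f3 isT isT isT isT; have {}f4 := f4 isT isT isT isT.
      by rewrite fineD ?fin_numD ?f1 ?f2 ?f3 ?f4// !fineD// addrA.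
    rewrite (split4 _ m1_fin) (split4 _ m2_fin); exact: ler_normB4.
  move=> x y hx hy e e0.
  have Uz : U (x +i* y) by apply: sU.
  have e2 : 0 < e / 2 by rewrite divr_gt0.
  have [r1 r10 h1] := m1_local Uz e2; have [r2 r20 h2] := m2_local Uz e2.
  exists (Num.min r1 r2); first by rewrite lt_min r10.
  move=> a' b' c' d' k1 k2 k3 k4; rewrite !lt_min => /andP[s1 s2] /andP[s3 s4].
  have sU' : closed_rect a' b' c' d' `<=` U by apply: sub; lra.
  have j1 : a' <= complex.Re (x +i* y) <= b' by rewrite /=; lra.
  have j2 : c' <= complex.Im (x +i* y) <= d' by rewrite /=; lra.
  have := h1 a' b' c' d' j1 j2 s1 s3 sU'; have := h2 a' b' c' d' j1 j2 s2 s4 sU'.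
  rewrite /F; cbn [fst snd].
  set X := fine (m1 _); set Y := fine (m2 _); set Z := cabs _ ^+ 2 * _; set W := _ ^+ 2.
  rewrite distrC => H2 H1; rewrite -[X - Y](subrKA Z).
  apply: le_trans (ler_normD _ _) _; lra.
rewrite /F /= normr_le0 subr_eq0 => /eqP H.
have f1 := m1_fin ab cd sU; have f2 := m2_fin ab cd sU.
by rewrite -[LHS]fineK ?ge0_fin_numE// -[RHS]fineK ?ge0_fin_numE// H.
Qed.

(** On each rectangle of a countable cover of [U] both measures are finite and agree on
    subrectangles, hence on Borel sets; making the cover disjoint adds up the pieces. *)
Let image_measureE E : measurable E -> m1 E = m2 E.
Proof.
move=> mE; have [Q [QU UE]] := open_rect_cover openU.
pose q n := rect (Q n).1.1 (Q n).1.2 (Q n).2.1 (Q n).2.2.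
have mq n : measurable (q n) by exact: measurable_rect.
have eqr a b c d n : m1 (rect a b c d `&` q n) = m2 (rect a b c d `&` q n) /\
   (m1 (rect a b c d `&` q n) < +oo)%E.
  rewrite /q rectI.
  have [/andP[ab cd]|/rect_empty ->] := boolP ((Num.max a (Q n).1.1 < Num.min b (Q n).1.2) &&
    (Num.max c (Q n).2.1 < Num.min d (Q n).2.2)); last by rewrite !measure0.
  have sU : closed_rect (Num.max a (Q n).1.1) (Num.min b (Q n).1.2)
      (Num.max c (Q n).2.1) (Num.min d (Q n).2.2) `<=` U.
    move=> z []; rewrite !ge_max !le_min => /andP[/andP[_ h1] /andP[_ h2]] /andP[/andP[_ h3] /andP[_ h4]].
    by apply: (QU n); split; apply/andP.
  by split; [apply: rect_measure_eq|apply: m1_fin] => //; exact: ltW.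
have loc n A : measurable A -> m1 (A `&` q n) = m2 (A `&` q n).
  have := @plane_measure_unique _ (mrestr m1 (mq n)) (mrestr m2 (mq n)).
  rewrite /mrestr; apply => a b c d; first by case: (eqr a b c d n).
  by case: (eqr a b c d n).
have inU : m1 E = m1 (E `&` plane U) /\ m2 E = m2 (E `&` plane U).
  split; last by rewrite /m2/= /dens setICA setIid setIC.
  rewrite /m1/= /ppush; congr (mu2 _); apply/seteqP; split => p [Vp]; last by case.
  by move=> Ep; split => //; split => //; rewrite /plane /= /theta to_xyK; exact: psiU.
rewrite inU.1 inU.2 UE seqDU_bigcup_eq setI_bigcupr.
have msq n : measurable (E `&` seqDU q n).
  apply: measurableI => //; apply: measurableD => //.
  by apply: bigsetU_measurable.
have tsq : trivIset setT (fun n => E `&` seqDU q n).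
  apply/trivIsetP => i j _ _ ij; rewrite setIACA.
  by have /trivIsetP := @trivIset_seqDU _ q; move=> /(_ i j Logic.I Logic.I ij) ->; rewrite setI0.
have msU : measurable (\bigcup_n (E `&` seqDU q n)) by exact: bigcupT_measurable.
rewrite !measure_semi_bigcup//; apply: eq_eseriesr => n _.
have -> : E `&` seqDU q n = (E `&` seqDU q n) `&` q n.
  by apply/esym/setIidl; apply: subset_trans (@subset_seqDU _ q n); exact: subIsetr.
exact: loc.
Qed.

Let Phi (p : T2) : T2 := to_xy (phi (of_xy p)).

Lemma measurable_plane_holo : measurable_fun (plane U) Phi.
Proof.
apply: (measurability (@rects R)); first exact: measurable_planeE.
move=> _ [_ /rectsP[a [b [c [d ->]]]] <-].
have c1 z : U z -> ccont phi z by move=> /hphi /cderiv_cont.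
have n1 : measurable_fun (plane U) (fun p : T2 => complex.Re (phi (of_xy p))).
  by apply: (measurable_rcont (g := fun z => complex.Re (phi z))) => // w Vw; exact/rcont_Re/c1.
have n2 : measurable_fun (plane U) (fun p : T2 => complex.Im (phi (of_xy p))).
  by apply: (measurable_rcont (g := fun z => complex.Im (phi z))) => // w Vw; exact/rcont_Im/c1.
rewrite (_ : _ `&` _ =
   (plane U `&` (fun p : T2 => complex.Re (phi (of_xy p))) @^-1` `]a, b]%classic) `&`
   (plane U `&` (fun p : T2 => complex.Im (phi (of_xy p))) @^-1` `]c, d]%classic)); last first.
  by apply/seteqP; split => [p [Vp [/= h1 h2]]|p [[Vp h1] [_ h2]]].
by apply: measurableI; [apply: n1|apply: n2] => //; exact: measurable_itv.
Qed.

Lemma conformal_measure (B : set T2) : measurable B ->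
  mu2 (plane V `&` B) = (\int[mu2]_(p in plane U `&` Phi @^-1` B) (cabs (dphi (of_xy p)) ^+ 2)%:E)%E.
Proof.
move=> mB; have mE : measurable (plane U `&` Phi @^-1` B) by exact: measurable_plane_holo.
transitivity (m2 (plane U `&` Phi @^-1` B)); last by rewrite /m2 /= /dens setIA setIid.
rewrite -image_measureE// /m1 /= /ppush; congr (mu2 _); apply/seteqP; split => p [Vp].
  move=> Bp; split => //; split; first by rewrite /plane /= /theta to_xyK; exact: psiU.
  by rewrite /= /Phi /theta to_xyK phipsi// of_xyK.
by move=> [_]; rewrite /= /Phi /theta to_xyK phipsi// of_xyK.
Qed.

End change_of_variables.

(** * From an identity of measures to an identity of integrals *)

Section transfer.
Local Open Scope ereal_scope.
Context d d' (X : measurableType d) (Y : measurableType d') (R : realType).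
Variables (mu : {measure set X -> \bar R}) (nu : {measure set Y -> \bar R}).
Variables (D : set X) (V : set Y) (mD : measurable D) (mV : measurable V).
Variables (f : X -> Y) (g : X -> R).
Hypothesis mf : measurable_fun D f.
Hypothesis mg : measurable_fun D g.
Hypothesis g0 : forall x, D x -> (0 <= g x)%R.
Hypothesis fDV : forall x, D x -> V (f x).
Hypothesis H : forall B, measurable B -> nu (V `&` B) = \int[mu]_(x in D `&` f @^-1` B) (g x)%:E.

Import HBNNSimple.

Let transfer_nnsfun (h : {nnsfun Y >-> R}) :
  \int[nu]_(y in V) (h y)%:E = \int[mu]_(x in D) ((h (f x))%:E * (g x)%:E).
Proof.
have mh r : measurable (h @^-1` [set r]) by exact: measurable_sfunP.
have mhf r : measurable (D `&` f @^-1` (h @^-1` [set r])) by exact: mf.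
transitivity (\sum_(k \in range h) (k%:E * nu (V `&` h @^-1` [set k]))).
  under eq_integral do rewrite fimfunE -fsumEFin//.
  rewrite ge0_integral_fsum//; last 2 first.
  - by move=> y; apply/measurable_EFinP; exact: measurable_funM.
  - by move=> y x _; rewrite nnfun_muleindic_ge0.
  apply: eq_fsbigr => r _; rewrite integralZl_indic_nnsfun// integral_indic//.
  by rewrite setIC.
transitivity (\sum_(k \in range h) \int[mu]_(x in D) ((k * \1_(h @^-1` [set k]) (f x))%:E * (g x)%:E)); last first.
  rewrite -ge0_integral_fsum//; last 2 first.
  - move=> k; apply: emeasurable_funM; last exact/measurable_EFinP.
    apply/measurable_EFinP; apply: measurable_funM => //.
    by apply: (@measurableT_comp _ _ _ _ _ _ (\1_(h @^-1` [set k]) : Y -> R)) => //; exact: measurable_indic.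
  - by move=> k x Dx; apply: mule_ge0; [exact: nnfun_muleindic_ge0|rewrite lee_fin; exact: g0].
  apply: eq_integral => x xD; rewrite fimfunE -fsumEFin// ge0_mule_fsuml//.
  by move=> k; rewrite nnfun_muleindic_ge0.
apply: eq_fsbigr => k /set_mem [y _ hy].
have k0 : (0 <= k)%R by rewrite -hy; exact: fun_ge0.
rewrite H// [RHS](eq_integral (fun x => k%:E * ((g x)%:E * (\1_(f @^-1` (h @^-1` [set k])) x)%:E))); last first.
  by move=> x _; rewrite EFinM -muleA; congr (_ * _); rewrite muleC.
rewrite ge0_integralZl//; last 2 first.
- apply: emeasurable_funM; first exact/measurable_EFinP.
  apply/measurable_EFinP.
  by apply: (@measurableT_comp _ _ _ _ _ _ (\1_(h @^-1` [set k]) : Y -> R)) => //; exact: measurable_indic.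
- by move=> x Dx; apply: mule_ge0; rewrite lee_fin//; exact: g0.
congr (_ * _).
rewrite integral_mkcondr; apply: eq_integral => x _; rewrite patchE indicE.
by case: ifP => _; rewrite ?mule1 ?mule0.
Qed.

Lemma ge0_transfer (G : Y -> \bar R) : measurable_fun V G -> (forall y, V y -> 0 <= G y) ->
  \int[nu]_(y in V) G y = \int[mu]_(x in D) (G (f x) * (g x)%:E).
Proof.
move=> mG G0; pose G_ := nnsfun_approx mV mG.
have cG y : V y -> (G_ n y)%:E @[n --> \oo] --> G y.
  by move=> Vy; apply: cvg_nnsfun_approx => // *; apply: G0.
transitivity (limn (fun n => \int[nu]_(y in V) (G_ n y)%:E)).
  rewrite -monotone_convergence//.
  - by apply: eq_integral => y /[!inE] yV; apply/esym/cvg_lim => //; exact: cG.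
  - by move=> n; exact/measurable_EFinP/measurable_funTS.
  - by move=> n y _; rewrite lee_fin.
  - by move=> y _ m n mn; rewrite lee_fin; exact/lefP/nd_nnsfun_approx.
under eq_fun do rewrite transfer_nnsfun.
rewrite -monotone_convergence//.
- apply: eq_integral => x /[!inE] xD; apply/cvg_lim => //.
  by apply: cvgeZr => //; exact/cG/fDV.
- move=> n; apply: emeasurable_funM; last exact/measurable_EFinP.
  by apply/measurable_EFinP; exact: measurableT_comp.
- by move=> n x Dx; apply: mule_ge0; rewrite lee_fin; [exact: fun_ge0|exact: g0].
- move=> x Dx m n mn; rewrite lee_wpmul2r ?lee_fin ?g0//.
  exact/lefP/nd_nnsfun_approx.
Qed.

End transfer.

(** * The Gram matrix and the Schur test *)

Section gam.
Context {R : realType}.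
Variable c : R.

(* [gam k = k! / (c)_k], the normalized [k]-th moment of [(1 - t)^(c - 2) dt] on [[0, 1]]. *)
Fixpoint gam k : R := if k is k'.+1 then gam k' * (k%:R / (k'%:R + c)) else 1.

Hypothesis c1 : 1 <= c.

Let c0 : 0 < c := lt_le_trans ltr01 c1.

Let kc k : 0 < k%:R + c.
Proof. by rewrite ltr_wpDl. Qed.

Lemma gamS k : gam k.+1 = gam k * (k.+1%:R / (k%:R + c)). Proof. by []. Qed.

Lemma gam_gt0 k : 0 < gam k.
Proof. by elim: k => [|k IH] //; rewrite gamS mulr_gt0// divr_gt0. Qed.

Lemma gam_ratio_le1 k : k.+1%:R / (k%:R + c) <= 1.
Proof. by rewrite ler_pdivrMr// mul1r -natr1 lerD2l. Qed.

Lemma gam_le1 k : gam k <= 1.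
Proof.
elim: k => [|k IH] //; rewrite gamS mulr_ile1 ?gam_ratio_le1// ltW ?gam_gt0//.
by rewrite divr_gt0.
Qed.

(** By induction on [n]: the ratio [k.+1%:R / (k%:R + c)] of consecutive moments increases with [k],
    because [c >= 1]. *)
Lemma gam_logconvex d m n : gam (d + m) * gam (d + n) <= gam (d + m + n) * gam d.
Proof.
elim: n => [|n IH]; first by rewrite !addn0.
rewrite !addnS !gamS mulrA [leRHS]mulrAC.
have r0 k : 0 <= k.+1%:R / (k%:R + c) by rewrite ltW// divr_gt0.
apply: ler_pM => //; first by rewrite mulr_ge0// ltW// gam_gt0.
rewrite ler_pdivrMr// mulrAC ler_pdivlMr// -!natr1 !natrD.
have := c1; have : 0 <= m%:R :> R by []; have : 0 <= d%:R + n%:R :> R by rewrite addr_ge0.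
move: (m%:R) (d%:R) (n%:R) => x y z /[swap] x0 /[swap] w; nra.
Qed.

(** The inductive step is [(n / c + 1) * ((n + 1) / (n + c)) = (n + 1) / c]. *)
Lemma gam_sum n : \sum_(k < n) gam n / gam k = n%:R / c.
Proof.
elim: n => [|n IH]; first by rewrite big_ord0 mul0r.
have g0 k : gam k != 0 by rewrite gt_eqF// gam_gt0.
rewrite big_ord_recr /=.
under eq_bigr => k _ do rewrite mulrAC.
rewrite -mulr_suml IH [gam n * _ / _]mulrAC divff// -mulrDl -[n.+1%:R]natr1.
have h1 : n%:R + c != 0 by rewrite gt_eqF.
have h2 : c != 0 by rewrite gt_eqF.
by field; rewrite h1 h2.
Qed.

Lemma gam_inv_bounded (s : R) : 0 < s < 1 -> exists2 M : R, 0 <= M & forall n, s ^+ n / gam n <= M.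
Proof.
move=> /andP[s0 s1].
pose f n := s ^+ n / gam n.
have f0 n : 0 <= f n by rewrite divr_ge0 ?exprn_ge0 ?ltW ?gam_gt0.
(* From this index on the ratio [s * (n + c) / (n + 1)] of consecutive values of [f] is at most
   1. *)
pose J := Num.truncn (c / (1 - s)).
have dec n : (J <= n)%N -> f n.+1 <= f n.
  move=> Jn; rewrite /f exprSr gamS invfM invf_div mulrACA; apply: ler_piMr; first exact: (f0 n).
  rewrite mulrA ler_pdivrMr// mul1r.
  have h : c / (1 - s) <= n.+1%:R.
    by apply: (@le_trans _ _ J.+1%:R); [apply/ltW/truncnS_gt|rewrite ler_nat].
  rewrite ler_pdivrMr ?subr_gt0// in h; rewrite -natr1 in h *.
  have hs := ler_wpM2l (ltW s0) h; have n0 : 0 <= n%:R + 1 :> R by rewrite addr_ge0.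
  have := mulr_ge0 n0 (sqr_ge0 (1 - s)); rewrite sqrrB mulr2n; lra.
exists (\sum_(i < J.+1) f i); first exact: sumr_ge0.
move=> n; have [nJ|Jn] := leqP n J.
  by rewrite (bigD1 (Ordinal (nJ : (n < J.+1)%N)))//= lerDl sumr_ge0.
rewrite -(subnKC (ltnW Jn)); elim: (n - J)%N => [|k IH].
  by rewrite addn0 big_ord_recr /= lerDr sumr_ge0.
by rewrite addnS; apply: le_trans IH; apply: dec; rewrite leq_addr.
Qed.

(* The Gram matrix of the projections onto the orthogonal complement of the holomorphic
   functions of the monomials [w^n conj(w)^m], [w^n' conj(w)^m'] with [n + m' = n' + m]. *)
Definition gram m n m' n' : R :=
  gam (n + m') - (if (m <= n)%N then gam n * gam n' / gam (n - m) else 0).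

Let gram_ge0 m n m' n' : (n + m' = n' + m)%N -> 0 <= gram m n m' n'.
Proof.
move=> e; rewrite /gram; case: ifP => mn; last by rewrite subr0 ltW// gam_gt0.
rewrite subr_ge0 ler_pdivrMr ?gam_gt0//.
have := gam_logconvex (n - m) m m'; rewrite subnK//.
by rewrite (_ : (n - m + m' = n')%N)//; lia.
Qed.

Let gramC m n m' n' : (n + m' = n' + m)%N -> gram m n m' n' = gram m' n' m n.
Proof.
move=> e; rewrite /gram e; have -> : (m <= n)%N = (m' <= n')%N by lia.
have -> : (n - m = n' - m')%N by lia.
by rewrite [gam n * _]mulrC.
Qed.

(** Both halves of the entries are summed by [gam_sum], the second after the shift of [n] by [m],
    and give [(n' + m) / c] and [n' / c]. The range [n < n' + m] expresses that the other conjugate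
    exponent, [n' + m - n], is positive. *)
Let gram_row m n' : \sum_(n < n' + m) gram m n (n' + m - n) n' / gam n = m%:R / c.
Proof.
rewrite (eq_bigr (fun n : 'I_(n' + m) => gam (n' + m) / gam n -
  (if (m <= n)%N then gam n * gam n' / gam (n - m) else 0) / gam n)); last first.
  by move=> n _; rewrite /gram subnKC ?mulrBl// ltnW.
rewrite sumrB gam_sum.
have -> : \sum_(n < n' + m) (if (m <= n)%N then gam n * gam n' / gam (n - m) else 0) / gam n
    = \sum_(k < n') gam n' / gam k.
  rewrite addnC big_split_ord /= big1 ?add0r; last by move=> i _; rewrite leqNgt ltn_ord mul0r.
  apply: eq_bigr => k _; rewrite leq_addr addKn [gam _ * gam n']mulrC mulrAC -!mulrA.
  by rewrite mulVKf// gt_eqF// gam_gt0.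
by rewrite gam_sum natrD mulrDl addrAC subrr add0r.
Qed.

(* A Schur test with weights [1 / gam]. *)
Lemma gram_bound N (y : nat -> nat -> R) : (forall m n, 0 <= y m n) ->
  \sum_(p : 'I_N * 'I_N | (0 < p.1)%N) \sum_(q : 'I_N * 'I_N | (0 < q.1)%N && (q.2 + q.1 == p.2 + p.1)%N)
    y p.1 p.2 * y q.1 q.2 * gram p.1 q.2 q.1 p.2
  <= \sum_(p : 'I_N * 'I_N | (0 < p.1)%N) y p.1 p.2 ^+ 2 * gam p.2 * (p.1%:R / c).
Proof.
move=> y0.
(* The exponents are crossed: [p] stands for [(m, n')] and [q] for [(m', n)]. The condition
   [n + m' = n' + m] then says that [p] and [q] have the same total degree. *)
pose U (p q : 'I_N * 'I_N) := gram p.1 q.2 q.1 p.2 * (y p.1 p.2 ^+ 2 * (gam p.2 / gam q.2)).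
pose S := \sum_(p : 'I_N * 'I_N | (0 < p.1)%N)
  \sum_(q : 'I_N * 'I_N | (0 < q.1)%N && (q.2 + q.1 == p.2 + p.1)%N) U p q.
have SE : S = \sum_(p : 'I_N * 'I_N | (0 < p.1)%N)
  \sum_(q : 'I_N * 'I_N | (0 < q.1)%N && (q.2 + q.1 == p.2 + p.1)%N) U q p.
  rewrite /S [RHS](exchange_big_dep (fun q : 'I_N * 'I_N => 0 < q.1)%N)/=; last first.
    by move=> p q _ /andP[].
  by apply: eq_bigr => p p0; apply: eq_bigl => q; rewrite p0/= eq_sym.
(* Termwise, twice the product of the two values of [y] is at most the sum of their squares weighted
   by [gam p.2 / gam q.2] and its inverse; symmetry of the Gram matrix identifies the two resulting
   sums. *)
apply: (@le_trans _ _ ((S + S) / 2)).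
  rewrite {2}SE /S -big_split mulr_suml; apply: ler_sum => p _ /=.
  rewrite -big_split mulr_suml; apply: ler_sum => q /andP[_ /eqP e] /=.
  rewrite /U (gramC (esym e)) -mulrDr mulrC -mulrA; apply: ler_wpM2l.
    exact/gram_ge0/esym.
  rewrite ler_pdivlMr//; have gp := gam_gt0 p.2; have gq := gam_gt0 q.2.
  rewrite -subr_ge0 (_ : _ - _ = (y p.1 p.2 * gam p.2 - y q.1 q.2 * gam q.2) ^+ 2 / (gam p.2 * gam q.2)).
    by rewrite divr_ge0 ?sqr_ge0// mulr_ge0// ltW.
  by field; rewrite !gt_eqF.
rewrite (_ : (S + S) / 2 = S); last by field.
apply: ler_sum => p p0.
have -> : y p.1 p.2 ^+ 2 * gam p.2 * (p.1%:R / c) =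
    y p.1 p.2 ^+ 2 * gam p.2 * \sum_(n < p.2 + p.1) gram p.1 n (p.2 + p.1 - n) p.2 / gam n.
  by rewrite gram_row.
rewrite mulr_sumr.
pose f n := y p.1 p.2 ^+ 2 * gam p.2 * (gram p.1 n (p.2 + p.1 - n) p.2 / gam n).
have f0 n : (n < p.2 + p.1)%N -> 0 <= f n.
  move=> h; apply: mulr_ge0; first by rewrite mulr_ge0 ?sqr_ge0// ltW// gam_gt0.
  by apply: divr_ge0; [apply: gram_ge0; lia|rewrite ltW// gam_gt0].
rewrite -(pair_big_dep (fun m : 'I_N => 0 < m)%N (fun m n : 'I_N => n + m == p.2 + p.1)%N
  (fun m n => U p (m, n)))/= (exchange_big_dep (fun=> true))//=.
(* For a given [p] the value [n] of [q.2] determines [q.1], and [q.1 > 0] forces [n < p.2 + p.1].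
   The sum is thus part of a row of nonnegative terms, possibly cut at [N]. *)
apply: (@le_trans _ _ (\sum_(n < N | (n < p.2 + p.1)%N) f n)).
  rewrite [leRHS]big_mkcond /=; apply: ler_sum => n _.
  have [nl|nl] := ltnP n (p.2 + p.1); last first.
    rewrite big_pred0// => m; apply/negP => /andP[m0 /eqP e].
    by move: nl; rewrite -e -[leqRHS]addn0 leq_add2l leqNgt m0.
  rewrite (eq_bigr (fun=> f n)); last first.
    move=> m /andP[_ /eqP e]; rewrite /U /f /= (_ : (p.2 + p.1 - n = m)%N); last by rewrite -e addKn.
    by ring.
  have [m0 mN|none] := pickP (fun m : 'I_N => (0 < m) && (n + m == p.2 + p.1))%N.
    rewrite (big_pred1 m0)// => m /=; apply/idP/eqP => [/andP[_ /eqP e]|->//].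
    by case/andP: mN => _ /eqP e'; apply/val_inj/(@addnI n); rewrite e; exact/esym.
  by rewrite big_pred0// f0.
rewrite (big_mkcond _ (fun n : 'I_N => f n)) /= -/f.
have [NL|LN] := leqP N (p.2 + p.1).
  rewrite (big_ord_widen _ (fun n => if (n < p.2 + p.1)%N then f n else 0) NL) big_mkcond/=.
  by apply: ler_sum => i _; case: ifP => _; rewrite ?ltn_ord// f0.
by rewrite (big_ord_widen _ f (ltnW LN)) -big_mkcond.
Qed.

End gam.

(** * Finite Fourier analysis *)

Section parseval.
Context {R : realType}.
Local Notation C := R[i].
Local Notation Re := (@complex.Re R).

Lemma prim_root_exists (n : nat) : (0 < n)%N -> exists z : C, n.-primitive_root z.
Proof.
pose p : {poly C} := 'X^n - 1; have [r Dp] := closed_field_poly_normal p.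
move=> n_gt0; rewrite (monicP _) ?monicXnsubC // scale1r in Dp.
have rn1 : all n.-unity_root r by apply/allP => z; rewrite -root_prod_XsubC -Dp.
have sz_r : (n < (size r).+1)%N.
  by rewrite -(size_prod_XsubC r id) -Dp size_XnsubC.
have [|z] := hasP (has_prim_root n_gt0 rn1 _ sz_r); last by exists z.
rewrite -separable_prod_XsubC -Dp separable_Xn_sub_1 // pnatr_eq0; lia.
Qed.

Lemma cabs_prim_root n (z : C) : n.-primitive_root z -> cabs z = 1.
Proof.
move=> pz; have n0 := prim_order_gt0 pz; have := prim_expr_order pz.
move=> /(congr1 cabs); rewrite cabsX cabs1 => /eqP.
by rewrite pexprn_eq1 ?cabs_ge0// gtn_eqF//= => /eqP.
Qed.

Lemma mulJ_prim_root n (z : C) : n.-primitive_root z -> z * z^* = 1.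
Proof. by move=> pz; rewrite -cabs_mulJ (cabs_prim_root pz) expr1n. Qed.

Let root_sum n (z x : C) : n.-primitive_root z -> x ^+ n = 1 -> x != 1 -> \sum_(j < n) x ^+ j = 0.
Proof.
move=> pz xn x1; apply: (mulfI (x := x - 1)); first by rewrite subr_eq0.
by rewrite -subrX1 xn subrr mulr0.
Qed.

Let root_orth n (z : C) (s t : nat) : n.-primitive_root z -> (s < n)%N -> (t < n)%N ->
  \sum_(j < n) z ^+ (j * s) * (z ^+ (j * t))^* = (n%:R *+ (s == t))%:C.
Proof.
move=> pz sn tn; have zJ := mulJ_prim_root pz.
have [<-|st] := eqVneq s t.
  rewrite mulr1n (eq_bigr (fun=> 1)) ?sumr_const ?card_ord ?rmorph_nat//.
  by move=> j _; rewrite rmorphXn -exprMn zJ expr1n.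
rewrite mulr0n (eq_bigr (fun j : 'I_n => (z ^+ s * (z ^+ t)^*) ^+ j)); last first.
  by move=> j _; rewrite exprMn -rmorphXn -!exprM !(mulnC j).
apply: (root_sum pz).
  have zk k : (z ^+ k) ^+ n = 1 by rewrite exprAC (prim_expr_order pz) expr1n.
  by rewrite exprMn -rmorphXn !zk rmorph1 mulr1.
apply/negP => /eqP e.
have zJt : z ^+ t * (z ^+ t)^* = 1 by rewrite rmorphXn -exprMn zJ expr1n.
have : z ^+ s == z ^+ t by rewrite -[z ^+ s]mulr1 -zJt mulrCA e mulr1.
by rewrite (eq_prim_root_expr pz) !modn_small// (negbTE st).
Qed.

(** The frequencies are below [n], so the powers of [z] tell them apart and only pairs of equal
    frequency survive. Several indices may share a frequency, whence the inner sum. *)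
Lemma parseval n (z : C) (P : finType) (f : P -> nat) (w : P -> C) :
  n.-primitive_root z -> (forall p, (f p < n)%N) ->
  \sum_(j < n) cabs (\sum_p z ^+ (j * f p) * w p) ^+ 2 =
  n%:R * \sum_p \sum_(q | f q == f p) Re (w p * (w q)^*).
Proof.
move=> pz fn; apply: (@complexI R); rewrite rmorph_sum /=.
under eq_bigr => j _ do rewrite cabs_mulJ rmorph_sum mulr_suml.
rewrite exchange_big /=.
have -> : \sum_p \sum_(j < n) z ^+ (j * f p) * w p * \sum_q (z ^+ (j * f q) * w q)^* =
    n%:R * \sum_p \sum_(q | f q == f p) w p * (w q)^*.
  rewrite mulr_sumr; apply: eq_bigr => p _.
  under eq_bigr => j _ do rewrite mulr_sumr.
  rewrite exchange_big mulr_sumr [RHS]big_mkcond /=; apply: eq_bigr => q _.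
  under eq_bigr => j _ do rewrite rmorphM mulrACA.
  rewrite -mulr_suml root_orth// eq_sym; case: eqP => _; rewrite ?mul0r//.
  by rewrite mulr1n rmorph_nat.
rewrite rmorphM rmorph_nat; congr (_ * _).
rewrite (_ : \sum_p _ = (Re (\sum_p \sum_(q | f q == f p) w p * (w q)^*))%:C).
  by congr (_%:C); rewrite raddf_sum; apply: eq_bigr => p _; rewrite raddf_sum.
apply: complexP => //=.
set X := (X in complex.Im X).
(* Conjugation exchanges [p] and [q], so the double sum is real. *)
have : X^* = X.
  rewrite /X rmorph_sum /=; under eq_bigr => p _ do rewrite rmorph_sum /=.
  rewrite (exchange_big_dep (fun=> true))//=; apply: eq_bigr => p _.
  apply: eq_big => q; first by rewrite eq_sym.
  by rewrite rmorphM /= conjcK mulrC.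
by case: X => x y [] /eqP; rewrite eq_sym -addr_eq0 -mulr2n mulrn_eq0/= => /eqP.
Qed.

End parseval.

(** * Radial functions *)

Section radial.
Context {R : realType}.
Local Notation C := R[i].
Local Notation RM := (measurableTypeR R).
Local Notation T2 := (RM * RM)%type.
Local Notation lam := (@lebesgue_measure R).
Local Notation mu2 := (@lebesgue_measure R \x @lebesgue_measure R)%E.
Local Notation Rp := (`[0, +oo[%classic : set RM).
Implicit Types (p : T2) (a b t x : R).

Definition sqn p : RM := cabs (of_xy p) ^+ 2.

Lemma sqnE p : sqn p = p.1 ^+ 2 + p.2 ^+ 2.
Proof. by rewrite /sqn sqr_cabs. Qed.

Lemma sqn_ge0 p : 0 <= sqn p. Proof. exact: sqr_ge0. Qed.

Lemma measurable_sqn : measurable_fun setT sqn.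
Proof.
rewrite (_ : sqn = fun p => p.1 ^+ 2 + p.2 ^+ 2); last by apply/funext => p; rewrite sqnE.
apply: measurable_funD; apply: measurable_funX; [exact: measurable_fst|exact: measurable_snd].
Qed.

Let kappa := fine (mu2 [set p | sqn p < 1]).

Let measurable_lt b : measurable [set p | sqn p < b].
Proof.
rewrite -[X in measurable X]setTI; have := measurable_sqn measurableT (measurable_itv `]-oo, b[).
by congr (measurable (_ `&` _)); apply/seteqP; split => p; rewrite /= in_itv.
Qed.

Let kappa_fin : mu2 [set p | sqn p < 1] = kappa%:E.
Proof.
rewrite /kappa fineK// ge0_fin_numE//; apply: le_lt_trans (mu2_rect_lty (-2) 2 (-2) 2).
apply: le_measure; rewrite ?inE//; first exact: measurable_rect.
move=> [x y] /=; rewrite sqnE /= => h; have := sqr_ge0 x; have := sqr_ge0 y => y0 x0.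
by split; rewrite /= in_itv/=; nra.
Qed.

Let kappa_ge0 : 0 <= kappa.
Proof. by rewrite fine_ge0. Qed.

Let mu2_lt b : 0 <= b -> mu2 [set p | sqn p < b] = (kappa * b)%:E.
Proof.
rewrite le0r => /orP[/eqP ->|b0].
  by rewrite mulr0 [X in mu2 X](_ : _ = set0) ?measure0//; apply/seteqP; split => p //=; rewrite ltNge sqn_ge0.
pose r := Num.sqrt b; have r0 : 0 < r by rewrite sqrtr_gt0.
have a0 : (r^-1)%:C != 0 :> C by rewrite -cabs_gt0 cabs_real gtr0_norm invr_gt0.
have [_ [_ /(_ _ (measurable_lt 1))]] := scales_mul_plane a0.
rewrite kappa_fin cabs_real gtr0_norm ?invr_gt0// exprVn invrK sqr_sqrtr ?(ltW b0)//.
have r2 : r ^+ 2 = b := sqr_sqrtr (ltW b0).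
have key p : sqn (mul_plane (r^-1)%:C p) = sqn p / b.
  by rewrite /sqn /mul_plane to_xyK cabsM exprMn cabs_real gtr0_norm ?invr_gt0// exprVn r2 mulrC.
rewrite -EFinM mulrC => <-; congr (mu2 _).
by apply/seteqP; split => p; rewrite /preimage; cbn [mkset]; rewrite key ltr_pdivrMr// mul1r.
Qed.

Let mI : measurable Rp := measurable_itv _.
Let mk : measurable_fun Rp (fun=> kappa) := measurable_cst _.
Let k0 : forall t : RM, Rp t -> 0 <= kappa := fun _ _ => kappa_ge0.
Let m1 : {measure set RM -> \bar R} := ppush mu2 measurableT measurable_sqn.
Let m2 : {measure set RM -> \bar R} := dens lam mI mk k0.

(** Under the squared modulus the planar measure becomes [kappa] times Lebesgue measure on the
    half-line: homotheties give discs of squared radius [b] the area [kappa * b], and half-lines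
    determine the measure. *)
Let radial_measure (B : set RM) : measurable B -> m1 B = m2 B.
Proof.
have m1E b : m1 `]-oo, b[%classic = (if 0 <= b then kappa * b else 0)%:E.
  rewrite /m1 /= /ppush setTI; case: ifPn => [b0|].
    by rewrite -mu2_lt//; congr (mu2 _); apply/seteqP; split => p; rewrite /= in_itv.
  rewrite -ltNge => b0; rewrite (_ : _ @^-1` _ = set0) ?measure0//; apply/seteqP; split => p //=.
  by rewrite in_itv/= ltNge (le_trans (ltW b0))// sqn_ge0.
move=> mB; apply: (@measure_unique _ R RM (@RGenInftyO.G R) (fun n : nat => `]-oo, n%:R[%classic)) mB.
- exact: RGenInftyO.measurableE.
- move=> _ _ [a ->] [b ->]; exists (Num.min a b).
  by apply/seteqP; split => [t|t]/=; rewrite !in_itv/= lt_min; [move=> []-> ->|move=> /andP].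
- by move=> n; exists n%:R.
- apply/seteqP; split => // t _; exists (Num.truncn t).+1 => //=.
  by rewrite in_itv/= truncnS_gt.
- move=> _ [b ->]; rewrite [LHS]m1E /m2 /= /dens; case: ifPn => b0.
    rewrite integral_cst; last by apply: measurableI => //; exact: measurable_itv.
    rewrite EFinM; congr (_ * _)%E; transitivity (lam `[0, b[%classic).
      by rewrite lam_co// subr0.
    by congr (lam _); apply/seteqP; split => t /=; rewrite !in_itv/= andbT; [move=> /andP|move=> [] -> ->].
  rewrite (_ : _ `&` _ = set0) ?integral_set0//; apply/seteqP; split => t //= [].
  by rewrite !in_itv/= andbT => t0 tb; move: b0; rewrite (le_trans t0 (ltW tb)).
- by move=> n; rewrite [X in (X < _)%E]m1E ltry.
Qed.

Let radial0 (G : RM -> \bar R) : measurable_fun setT G -> (forall t, 0 <= G t)%E ->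
  (\int[mu2]_p G (sqn p) = kappa%:E * \int[lam]_(t in Rp) G t)%E.
Proof.
move=> mG G0.
transitivity (\int[mu2]_p (G (sqn p) * 1%:E))%E; first by apply: eq_integral => p _; rewrite mule1.
have := @ge0_transfer _ _ T2 RM R mu2 m2 setT setT measurableT measurableT sqn (fun=> 1)
  measurable_sqn (measurable_cst _) (fun _ _ => ler01) (fun _ _ => Logic.I).
move=> /(_ _ G mG (fun t _ => G0 t)) <-; last first.
  move=> B mB; rewrite setTI -radial_measure// /m1 /= /ppush integral_cst ?mul1e//.
  by apply: measurable_sqn.
have := @ge0_transfer _ _ RM RM R lam m2 Rp setT mI measurableT idfun (fun=> kappa)
  (@measurable_id _ _ _) mk k0 (fun _ _ => Logic.I).
move=> /(_ _ G mG (fun t _ => G0 t)) ->; last by move=> B mB; rewrite setTI.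
rewrite -ge0_integralZl//; last exact: measurable_funTS.
by apply: eq_integral => t _; rewrite muleC.
Qed.

(* [kappa = pi], by computing the integral of a Gaussian density in two ways. *)
Let kappa_pi : kappa = pi.
Proof.
pose g : RM -> RM := normal_pdf 0 1.
have mg : measurable_fun setT g by exact: measurable_normal_pdf.
have g0 x : 0 <= g x by exact: normal_pdf_ge0.
have one : (\int[mu2]_p (g p.1 * g p.2)%:E = 1)%E.
  rewrite (fubini_tonelli1 (fun p : T2 => (g p.1 * g p.2)%:E)).
  - transitivity (\int[lam]_x (g x)%:E)%E; last exact: integral_normal_pdf.
    apply: eq_integral => x _; rewrite /fubini_F /=.
    under eq_integral do rewrite EFinM.
    rewrite ge0_integralZl_EFin//; last 2 first.
    + by move=> y _; rewrite lee_fin.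
    + exact/measurable_EFinP.
    by rewrite integral_normal_pdf mule1.
  - apply/measurable_EFinP; apply: measurable_funM.
      by apply: measurableT_comp => //; exact: measurable_fst.
    by apply: measurableT_comp => //; exact: measurable_snd.
  - by move=> p; rewrite lee_fin mulr_ge0.
(* In the variable [t = x ^+ 2 + y ^+ 2] the product of two standard normal densities is [pi^-1]
   times the exponential density of rate [1 / 2], whose integral is 1. *)
pose h : RM -> RM := exponential_pdf (1 / 2).
pose G (t : RM) : \bar R := (pi^-1 * (2^-1 * expR (- (1 / 2) * t)))%:E.
have mG : measurable_fun setT G.
  apply/measurable_EFinP; apply: measurable_funM => //; apply: measurable_funM => //.
  by apply: measurableT_comp => //; apply: measurable_funM.
have := radial0 mG; rewrite (_ : (\int[mu2]_p _)%E = 1%E); last first.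
  rewrite -one; apply: eq_integral => -[x y] _ /=; rewrite /G sqnE /g /normal_pdf oner_eq0 /=.
  rewrite /normal_fun /normal_peak !expr1n mul1r mulrACA -expRD -invfM -expr2 sqr_sqrtr.
    rewrite !subr0 mul1r mulrA -[pi *+ 2]mulr_natr invfM; congr (_ * expR _)%:E.
    by field.
  by rewrite mul1r mulrn_wge0// pi_ge0.
have -> : (\int[lam]_(t in Rp) G t = (pi^-1)%:E)%E.
  rewrite -[RHS]mule1 -(@integral_exponential_pdf R (1 / 2)); [|lra..].
  rewrite -ge0_integralZl_EFin//; last 3 first.
  - by move=> t _; rewrite lee_fin exponential_pdf_ge0//; lra.
  - by apply/measurable_EFinP; exact: measurable_exponential_pdf.
  - by rewrite invr_ge0 pi_ge0.
  rewrite [LHS]integral_mkcond; congr (integral _ _ _); apply/funext => t; rewrite /exponential_pdf !patchE.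
  by case: ifP => _; rewrite ?mule0// /G EFinM mul1r.
move=> /(_ _)/esym; rewrite -EFinM => H.
have : kappa / pi = 1.
  apply: EFin_inj; apply: H => t; rewrite lee_fin mulr_ge0 ?invr_ge0 ?pi_ge0// mulr_ge0// expR_ge0.
by move/divr1_eq.
Qed.

Lemma ge0_integral_radial (G : RM -> \bar R) : measurable_fun setT G -> (forall t, 0 <= G t)%E ->
  (\int[mu2]_p G (sqn p) = pi%:E * \int[lam]_(t in Rp) G t)%E.
Proof. by rewrite -kappa_pi; exact: radial0. Qed.

End radial.

(** * Moments *)

Section fatou_le.
Local Open Scope ereal_scope.
Context {R : realType}.

Lemma le_limn_einf (u : (\bar R)^nat) (x : R) :
  (forall e : R, (0 < e)%R -> exists N, forall n, (N <= n)%N -> (x - e)%:E <= u n) ->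
  x%:E <= limn_einf u.
Proof.
move=> h; rewrite limn_einf_lim (cvg_lim _ (@cvg_einfs_sup _ u))//.
apply/lee_addgt0Pr => e e0; have [N hN] := h e e0.
rewrite -leeBlDr// -EFinB; apply: (@le_trans _ _ (einfs u N)).
  by apply: le_ereal_inf_tmp => _ [k /= Nk <-]; exact: hN.
by apply: ereal_sup_ubound; exists N.
Qed.

Lemma limn_einf_le (u : (\bar R)^nat) (A : \bar R) : (forall n, u n <= A) -> limn_einf u <= A.
Proof.
move=> h; rewrite limn_einf_lim (cvg_lim _ (@cvg_einfs_sup _ u))//.
apply: ge_ereal_sup => _ [n _ <-]; apply: le_trans (h n).
by apply: ereal_inf_lbound; exists n => /=.
Qed.

Lemma fatou_le d (T : measurableType d) (mu : {measure set T -> \bar R}) (D : set T)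
    (g : T -> R) (gn : nat -> T -> R) (A : \bar R) : measurable D ->
  measurable_fun D g -> (forall n, measurable_fun D (gn n)) ->
  (forall x, D x -> (0 <= g x)%R) -> (forall n x, D x -> (0 <= gn n x)%R) ->
  (forall x (e : R), D x -> (0 < e)%R -> exists N, forall n, (N <= n)%N -> (g x - e <= gn n x)%R) ->
  (forall n, \int[mu]_(x in D) (gn n x)%:E <= A) -> \int[mu]_(x in D) (g x)%:E <= A.
Proof.
move=> mD mg mgn g0 gn0 lim leA.
apply: le_trans (limn_einf_le leA); apply: le_trans (fatou mu mD _ _) => //.
- apply: ge0_le_integral => //.
  + exact/measurable_EFinP.
  + apply: measurableT_comp => //; apply: measurable_fun_limn_esup => n; apply: measurableT_comp => //; exact/measurable_EFinP.
  + move=> x Dx; apply: le_limn_einf => e e0; have [N hN] := lim x e Dx e0.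
    by exists N => n Nn; rewrite lee_fin hN.
- by move=> n; exact/measurable_EFinP.
Qed.

End fatou_le.

(** * Moments of a power weight, and the functional that they define on polynomials *)

Section beta_moments.
Context {R : realType}.
Local Notation RM := (measurableTypeR R).
Local Notation lam := (@lebesgue_measure R).
Local Notation I01 := (`[0, 1[%classic : set RM).
Variable a : R.
Hypothesis a1 : -1 < a.
Local Notation gam := (gam (2 + a)).

Let a0 : 0 < 1 + a. Proof. by move: a1; lra. Qed.

Let is_derive_1subX (s x : R) : x < 1 -> is_derive x 1 (fun x => (1 - x) `^ s) (- (s * (1 - x) `^ (s - 1))).
Proof.
move=> x1; have y0 : 1 - x \in `]0, +oo[ by rewrite in_itv/= andbT subr_gt0.
have h1 : is_derive (1 - x) 1 (fun x : R => x `^ s) (s * (1 - x) `^ (s - 1)).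
  have := @powR_derive1 R s _ y0; rewrite derive1E => <-.
  by apply: DeriveDef => //; exact: (@derivable_powR R 1 s _ y0).
have h2 : is_derive x 1 (fun x : R => 1 - x) (- 1).
  by have := is_deriveB (is_derive_cst (1 : R) x (1 : R)) (is_derive_id x (1 : R)); rewrite sub0r.
have := @is_derive1_comp _ (fun x : R => x `^ s) (fun x : R => 1 - x) x _ _ h1 h2.
by rewrite mulrN1.
Qed.

Let powR1S (y : R) : 0 < y -> y `^ (1 + a) = y * y `^ a.
Proof. by move=> y0; rewrite powRD ?powRr1 ?(ltW y0)// (gt_eqF y0) implybT. Qed.

Let f k (x : R) : R := x ^+ k * (1 - x) `^ a.

(** The antiderivative of [f k] that vanishes at 0; the recursion is an integration by parts. *)
Fixpoint beta_primitive k (x : R) : R := if k is k'.+1 then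
  (k'%:R + (2 + a))^-1 * (k%:R * beta_primitive k' x - x ^+ k * (1 - x) `^ (1 + a))
  else (1 + a)^-1 * (1 - (1 - x) `^ (1 + a)).

Let is_derive_Xn k (x : R) : is_derive x 1 (fun t : R => t ^+ k.+1) (k.+1%:R * x ^+ k).
Proof.
elim: k => [|k IH]; first by rewrite mulr1; exact: is_derive_id.
have := is_deriveM (is_derive_id x (1 : R)) IH.
rewrite (_ : (fun t : R => t ^+ k.+2) = (id : R -> R) * (fun t => t ^+ k.+1)); last first.
  by apply/funext => t; rewrite exprS.
by move=> H; apply: (is_derive_eq H); rewrite /GRing.scale /= -[k.+2%:R]natr1 exprS; ring.
Qed.

Let is_derive_beta k (x : R) : x < 1 -> is_derive x 1 (beta_primitive k) (f k x).
Proof.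
move=> x1; have y0 : 0 < 1 - x by lra.
have w1 := is_derive_1subX (1 + a) x1; rewrite addrAC subrr add0r in w1.
elim: k => [|k IH].
  have := is_deriveZ (1 + a)^-1 (is_deriveB (is_derive_cst (1 : R) x (1 : R)) w1).
  by move=> H; apply: (is_derive_eq H); rewrite /f expr0 mul1r /GRing.scale /= sub0r opprK mulKf// gt_eqF.
have kc : k%:R + (2 + a) != 0 by rewrite gt_eqF// ltr_wpDl//; move: a1; lra.
have := is_deriveZ (k%:R + (2 + a))^-1
  (is_deriveB (is_deriveZ k.+1%:R IH) (is_deriveM (is_derive_Xn k x) w1)).
move=> H; apply: (is_derive_eq H); rewrite /f /GRing.scale /= powR1S// -natr1 exprSr.
by field.
Qed.

Let derivable_f k (x : R) : x < 1 -> derivable (f k) x 1.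
Proof.
move=> x1; have w1 := is_derive_1subX a x1.
case: k => [|k].
  rewrite (_ : f 0 = fun t => (1 - t) `^ a); first by case: w1.
  by apply/funext => t; rewrite /f expr0 mul1r.
by case: (is_deriveM (is_derive_Xn k x) w1).
Qed.

Let beta0 k : beta_primitive k 0 = 0.
Proof.
elim: k => [|k IH] /=; first by rewrite subr0 powR1 subrr mulr0.
by rewrite IH expr0n/= !(mul0r, mulr0) subr0 mulr0.
Qed.

(** For negative [a] the integrand is unbounded near 1, so the fundamental theorem is applied on
    [[0, xn n]] and followed by monotone convergence. *)
Let xn n : R := 1 - n.+2%:R^-1.

Let J n : set RM := `[0, xn n]%classic.

Let xn01 n : 0 < xn n < 1.
Proof. by rewrite /xn subr_gt0 gtrDl oppr_lt0 invr_gt0 invf_lt1// ltr0n/= ltr1n. Qed.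

Let beta_lim k : beta_primitive k (xn n) @[n --> \oo] --> gam k / (1 + a).
Proof.
have xn1 : xn n @[n --> \oo] --> (1 : R).
  rewrite -[X in _ --> X]subr0; apply: cvgB; first exact: cvg_cst.
  by have := cvg_shiftS (@harmonic R); rewrite /= => ->; exact: cvg_harmonic.
have pn : (1 - xn n) `^ (1 + a) @[n --> \oo] --> (0 : R).
  have /cvg_at_rightP := powR_cvg0 a0; apply; split.
    by move=> n; rewrite subr_gt0; case/andP: (xn01 n).
  rewrite -[X in _ --> X](subrr (1 : R)); apply: cvgB => //; exact: cvg_cst.
elim: k => [|k IH] /=.
  rewrite -[X in _ --> X](_ : (1 + a)^-1 * (1 - 0) = _); last by rewrite subr0 mulr1 mul1r.
  by apply: cvgMr; apply: cvgB => //; exact: cvg_cst.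
rewrite (_ : _ / (1 + a) = (k%:R + (2 + a))^-1 * (k.+1%:R * (gam k / (1 + a)) - 1 ^+ k.+1 * 0)); last first.
  by rewrite mulr0 subr0; ring.
apply: cvgMr; apply: cvgB; first exact: cvgMr.
apply: cvgM => //; elim: k.+1 => [|n IHn]; first exact: cvg_cst.
by under eq_fun do rewrite exprS; rewrite exprS; exact: cvgM.
Qed.

Let continuous_beta k (x : R) : x < 1 -> {for x, continuous (beta_primitive k)}.
Proof.
move=> x1; apply: differentiable_continuous; apply/derivable1_diffP.
by have h := is_derive_beta k x1; exact: ex_derive.
Qed.

Let beta_xn k n : (\int[lam]_(t in J n) (f k t)%:E = (beta_primitive k (xn n))%:E)%E.
Proof.
have /andP[x0 x1] := xn01 n.
rewrite (@continuous_FTC2 _ (f k) (beta_primitive k))//.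
- by rewrite beta0 sube0.
- apply: derivable_within_continuous => x; rewrite in_itv/= => /andP[_ xx].
  exact/derivable_f/(le_lt_trans xx).
- split.
  + move=> x; rewrite in_itv/= => /andP[_ xx].
    by have h := is_derive_beta k (lt_trans xx x1); exact: ex_derive.
  + by apply: cvg_at_right_filter; exact: continuous_beta.
  + by apply: cvg_at_left_filter; exact: continuous_beta.
- move=> x; rewrite in_itv/= => /andP[_ xx].
  by have h := is_derive_beta k (lt_trans xx x1); rewrite derive1E derive_val.
Qed.

Let measurable_f (D : set RM) k : measurable_fun D (f k : RM -> RM).
Proof.
apply: measurable_funM; first exact: measurable_funX.
apply: (measurableT_comp (measurable_powR _)).
exact: measurable_funB.
Qed.

Let f0 k (t : RM) : I01 t -> 0 <= f k t.
Proof. by rewrite /= in_itv/= => /andP[t0 t1]; rewrite mulr_ge0 ?exprn_ge0// powR_ge0. Qed.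

Lemma beta_moment k : (\int[lam]_(t in I01) (t ^+ k * (1 - t) `^ a)%:E = (gam k / (1 + a))%:E)%E.
Proof.
have UI : \bigcup_n J n = I01.
  apply/seteqP; split => t /=.
    move=> [n _]; rewrite /J /= !in_itv/= => /andP[-> /le_lt_trans]; apply.
    by case/andP: (xn01 n).
  rewrite in_itv/= => /andP[t0 t1]; exists (Num.truncn (1 - t)^-1) => //=.
  rewrite /J /= in_itv/= t0/= /xn lerBrDr -lerBrDl.
  have d0 : 0 < 1 - t by rewrite subr_gt0.
  rewrite -[leRHS]invrK lef_pV2 ?posrE ?invr_gt0//.
  by apply/ltW/(lt_trans (truncnS_gt _)); rewrite ltr_nat.
have h : (\int[lam]_(t in J n) (f k t)%:E)%E @[n --> \oo] -->
    (\int[lam]_(t in I01) (f k t)%:E)%E.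
  rewrite -UI; apply: ge0_nondecreasing_set_cvg_integral.
  - apply/nondecreasing_seqP => n; rewrite subsetEset => t; rewrite /J /= !in_itv/= => /andP[-> /le_trans]; apply.
    by rewrite /xn lerB// lef_pV2 ?posrE// ler_nat.
  - by move=> n; exact: measurable_itv.
  - by move=> n; apply/measurable_EFinP; exact: measurable_f.
  - move=> n t tn; rewrite lee_fin f0// -UI; by exists n.
apply: (cvg_unique _ h) => //.
rewrite (_ : (fun n => _) = fun n => (beta_primitive k (xn n))%:E); last by apply/funext => n; exact: beta_xn.
exact/cvg_EFin/beta_lim/nearW.
Qed.

(** The normalized moment functional: [1 + a] times the integral of [Q] against the weight over [[0,
    1[]. It turns integrals of radial polynomials into finite sums. *)
Definition Lam (Q : {poly R}) : R := \sum_(i < size Q) Q`_i * gam i.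

Let LamE n (Q : {poly R}) : (size Q <= n)%N -> Lam Q = \sum_(i < n) Q`_i * gam i.
Proof.
move=> sQ; rewrite /Lam (big_ord_widen _ (fun i => Q`_i * gam i) sQ) big_mkcond /=.
by apply: eq_bigr => i _; case: ltnP => // si; rewrite nth_default ?mul0r.
Qed.

Lemma LamD P Q : Lam (P + Q) = Lam P + Lam Q.
Proof.
have h := size_polyD P Q; rewrite (LamE h) (LamE (leq_maxl (size P) (size Q))).
rewrite (LamE (leq_maxr (size P) (size Q))) -big_split; apply: eq_bigr => i _.
by rewrite coefD mulrDl.
Qed.

Lemma LamZ (k : R) P : Lam (k *: P) = k * Lam P.
Proof.
rewrite (LamE (size_scale_leq k P)) /Lam mulr_sumr; apply: eq_bigr => i _.
by rewrite coefZ mulrA.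
Qed.

Lemma LamXn n : Lam 'X^n = gam n.
Proof.
rewrite (@LamE n.+1) ?size_polyXn// big_ord_recr /= coefXn eqxx mul1r big1 ?add0r//.
by move=> i _; rewrite coefXn ltn_eqF ?mul0r.
Qed.

Lemma Lam_sum (I : Type) (r : seq I) (P : pred I) (F : I -> {poly R}) :
  Lam (\sum_(i <- r | P i) F i) = \sum_(i <- r | P i) Lam (F i).
Proof. by apply: (big_morph Lam LamD); rewrite /Lam size_poly0 big_ord0. Qed.

Lemma poly_moment (Q : {poly R}) :
  (\int[lam]_(t in I01) (Q.[t] * (1 - t) `^ a)%:E = (Lam Q / (1 + a))%:E)%E.
Proof.
transitivity (\int[lam]_(t in I01) (\sum_(i < size Q) (Q`_i)%:E * (f i t)%:E))%E.
  apply: eq_integral => t _; rewrite horner_coef mulr_suml -sumEFin.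
  by apply: eq_bigr => i _; rewrite -EFinM mulrA.
have If i : lam.-integrable I01 (fun t => (f i t)%:E).
  apply/integrableP; split; first by apply/measurable_EFinP; exact: measurable_f.
  apply: (@le_lt_trans _ _ (\int[lam]_(t in I01) (f i t)%:E)%E); last by rewrite beta_moment ltry.
  rewrite le_eqVlt; apply/orP; left; apply/eqP; apply: eq_integral => t; rewrite inE => tI.
  by rewrite gee0_abs// lee_fin f0.
rewrite integral_sum//; last by move=> i; exact: integrableZl.
rewrite /Lam mulr_suml -sumEFin; apply: eq_bigr => i _.
by rewrite integralZl// beta_moment -EFinM mulrA.
Qed.

Local Notation T2 := (RM * RM)%type.
Local Notation mu2 := (@lebesgue_measure R \x @lebesgue_measure R)%E.
Local Notation DD := (plane (@unit_disc R)).

Lemma disc_poly (Q : {poly R}) : (forall t, 0 <= t < 1 -> 0 <= Q.[t]) ->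
  (\int[mu2]_(p in DD) (Q.[sqn p] * (1 - sqn p) `^ a)%:E = (pi / (1 + a) * Lam Q)%:E)%E.
Proof.
move=> Q0; pose g (t : RM) : \bar R := (Q.[t] * (1 - t) `^ a)%:E.
have mg : measurable_fun setT (g \_ I01).
  apply/(measurable_restrictT g); first exact: measurable_itv.
  apply/measurable_EFinP; rewrite (_ : (fun _ => _) = fun t => \sum_(i < size Q) Q`_i * f i t).
    by apply: measurable_sum => i; apply: measurable_funM => //; exact: measurable_f.
  by apply/funext => t; rewrite horner_coef mulr_suml; apply: eq_bigr => i _; rewrite mulrA.
have g0 t : (0 <= (g \_ I01) t)%E.
  apply: erestrict_ge0 => {}t /=; rewrite in_itv/= => t01.
  by rewrite lee_fin mulr_ge0 ?Q0// powR_ge0.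
transitivity (\int[mu2]_p (g \_ I01) (sqn p))%E.
  rewrite integral_mkcond; apply: eq_integral => p _; rewrite !patchE.
  suff -> : (p \in DD) = (sqn p \in I01) by [].
  apply/idP/idP; rewrite !inE /plane /= /unit_disc /= in_itv/= sqn_ge0/= /sqn.
    by rewrite expr_lt1// cabs_ge0.
  by rewrite expr_lt1// cabs_ge0.
rewrite ge0_integral_radial// (_ : (\int[lam]_(t in _) _)%E = (Lam Q / (1 + a))%:E).
  by rewrite -EFinM; congr EFin; ring.
rewrite -poly_moment -[RHS]/(\int[lam]_(t in I01) g t)%E.
pose Rp : set RM := `[0, +oo[%classic.
transitivity (\int[lam]_(t in Rp `&` I01) g t)%E.
  by rewrite integral_mkcondr.
by congr (integral _ _ _); apply: setIidr => t; rewrite /Rp /= !in_itv/= andbT => /andP[].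
Qed.

End beta_moments.

(** * Weighted integrals over the unit disc *)

Section conjugation.
Context {R : realType}.
Local Notation C := R[i].
Implicit Types (u z : C).

(* [conjc] carries a ring structure on [R] that is elaborated in several non-syntactically
   equal ways; this constant does not. *)
Definition cj z : C := z^*.
Lemma cj0 : cj 0 = 0. Proof. exact: rmorph0. Qed.
Lemma cjD u z : cj (u + z) = cj u + cj z. Proof. exact: rmorphD. Qed.
Lemma cjM u z : cj (u * z) = cj u * cj z. Proof. exact: rmorphM. Qed.
Lemma cjB u z : cj (u - z) = cj u - cj z. Proof. exact: rmorphB. Qed.
Lemma cjX z k : cj (z ^+ k) = cj z ^+ k. Proof. exact: rmorphXn. Qed.
Lemma cjK z : cj (cj z) = z. Proof. exact: conjcK. Qed.
Lemma cj_real (k : R) : cj k%:C = k%:C. Proof. exact: conjc_real. Qed.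
Lemma cabs_cj z : cabs (cj z) = cabs z. Proof. exact: cabsJ. Qed.
Lemma mul_cj z : z * cj z = (cabs z ^+ 2)%:C. Proof. by rewrite cabs_mulJ. Qed.
Lemma ccont_cj z : ccont cj z.
Proof. by move=> e e0; exists e => // k ke; rewrite -cjB cabs_cj addrAC subrr add0r. Qed.

End conjugation.

Section gram_bound_prod.
Context {R : realType}.

(** This is [gram_bound] with the exponents uncrossed: an involution exchanges the second components
    of the two pairs. Terms with a zero conjugate exponent vanish since [x 0 = 0]. *)
Lemma gram_bound_prod (c : R) N (x y : nat -> R) : 1 <= c ->
  (forall m, 0 <= x m) -> (forall n, 0 <= y n) -> x 0%N = 0 ->
  \sum_(p : 'I_N * 'I_N) \sum_(q : 'I_N * 'I_N | (p.2 + q.1 == q.2 + p.1)%N)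
    x p.1 * y p.2 * (x q.1 * y q.2) * gram c p.1 p.2 q.1 q.2
  <= \sum_(p : 'I_N * 'I_N) (x p.1 * y p.2) ^+ 2 * gam c p.2 * (p.1%:R / c).
Proof.
move=> c1 x0 y0 x00; have xy0 m n : 0 <= x m * y n by exact: mulr_ge0.
have := gram_bound c1 N xy0.
rewrite [X in _ <= X]big_mkcond /= => /le_trans H.
apply: (@le_trans _ _ _ _ _ _ (H _ _)); last first.
  apply: ler_sum => p _; case: ifPn => // _; apply: mulr_ge0.
    by rewrite mulr_ge0 ?sqr_ge0// ltW// gam_gt0.
  by rewrite divr_ge0// (le_trans ler01).
rewrite pair_big_dep /= [leRHS]pair_big_dep /=.
pose h (r : ('I_N * 'I_N) * ('I_N * 'I_N)) := ((r.1.1, r.2.2), (r.2.1, r.1.2)).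
have hK : involutive h by move=> [[? ?] [? ?]].
rewrite (reindex_inj (inv_inj hK)) /= big_mkcond [leRHS]big_mkcond /=.
apply: ler_sum => -[[m n'] [m' n]] _ /=.
rewrite (eq_sym (n + m')%N) (eq_sym (n' + m)%N).
case: (posnP m) => [->|m0] /=; first by rewrite x00 !mul0r if_same.
case: (posnP m') => [->|m'0] /=; first by rewrite x00 !(mul0r, mulr0) if_same.
rewrite eq_sym; case: ifP => // _; rewrite le_eqVlt; apply/orP; left; apply/eqP; ring.
Qed.

End gram_bound_prod.

(** * Orthogonality on the disc by averaging over rotations *)

Section disc_integrals.
Context {R : realType}.
Local Notation C := R[i].
Local Notation RM := (measurableTypeR R).
Local Notation T2 := (RM * RM)%type.
Local Notation mu2 := (@lebesgue_measure R \x @lebesgue_measure R)%E.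
Local Notation DD := (plane (@unit_disc R)).
Implicit Types (f v : C -> C) (g : C -> R) (z : C) (p : T2).

Lemma open_unit_disc : open (@unit_disc R).
Proof.
apply/openC_cabs => z zD; exists (1 - cabs z); first by rewrite subr_gt0.
move=> w wz; rewrite /unit_disc /= -(subrK z w); apply: le_lt_trans (ler_cabsD _ _) _; lra.
Qed.

Let mDD : measurable DD := measurable_plane open_unit_disc.

Lemma measurable_disc_weight (a : R) : measurable_fun DD (fun p => (1 - sqn p) `^ a).
Proof.
apply: (measurableT_comp (measurable_powR _)).
by apply: measurable_funB => //; apply: measurable_funTS; exact: measurable_sqn.
Qed.

Lemma measurable_disc_cabs f : (forall z, cabs z < 1 -> ccont f z) ->
  measurable_fun DD (fun p => cabs (f (of_xy p))).
Proof.
move=> cf; apply: (measurable_rcont (g := fun z => cabs (f z)) open_unit_disc).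
by move=> z zD; apply: rcont_cabs; exact: cf.
Qed.

Let DDE p : DD p = (cabs (of_xy p) < 1) :> Prop := erefl.

Let rotDD (x : C) p : cabs x = 1 -> DD p -> DD (mul_plane x p).
Proof. by move=> x1; rewrite !DDE /mul_plane to_xyK cabsM x1 mul1r. Qed.

Let sqn_rot (x : C) p : cabs x = 1 -> sqn (mul_plane x p) = sqn p.
Proof. by move=> x1; rewrite /sqn /mul_plane to_xyK cabsM x1 mul1r. Qed.

Lemma disc_rotate (x : C) (g : T2 -> R) : cabs x = 1 -> measurable_fun DD g ->
  (forall p, DD p -> 0 <= g p) ->
  (\int[mu2]_(p in DD) (g (mul_plane x p))%:E = \int[mu2]_(p in DD) (g p)%:E)%E.
Proof.
move=> x1 mg g0; have xn0 : x != 0 by rewrite -cabs_gt0 x1.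
have [mx [_ hx]] := scales_mul_plane xn0.
have := @ge0_transfer _ _ T2 T2 R mu2 mu2 DD DD mDD mDD (mul_plane x) (fun=> 1)
  (measurable_funTS mx) (measurable_cst _) (fun _ _ => ler01) (fun p => @rotDD x p x1).
move=> /(_ _ (fun p => (g p)%:E)) ->.
- by apply: eq_integral => p _; rewrite mule1.
- move=> B mB; rewrite integral_cst ?mul1e; last first.
    by apply: (measurable_funTS mx).
  have h := hx (DD `&` B) (measurableI _ _ mDD mB); rewrite x1 expr1n invr1 mul1e in h.
  transitivity (mu2 (mul_plane x @^-1` (DD `&` B))); first exact/esym.
  congr (mu2 _); apply/seteqP; split => p []; last first.
    by move=> Dp Bp; split => //; exact: rotDD.
  by rewrite !DDE /mul_plane to_xyK cabsM x1 mul1r.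
- exact/measurable_EFinP.
- by move=> p Dp; rewrite lee_fin g0.
Qed.

Variable a : R.
Hypothesis a1 : -1 < a.
Local Notation w p := ((1 - sqn p) `^ a).
Local Notation gam := (gam (2 + a)).

Lemma disc_average n (x : C) g : n.-primitive_root x ->
  measurable_fun DD (fun p => g (of_xy p)) -> (forall z, 0 <= g z) ->
  (\int[mu2]_(p in DD) (g (of_xy p) * w p)%:E =
   \int[mu2]_(p in DD) (n%:R^-1 * (\sum_(j < n) g (x ^+ j * of_xy p)) * w p)%:E)%E.
Proof.
move=> px mg g0; have n0 := prim_order_gt0 px; have x1 := cabs_prim_root px.
have xj j : cabs (x ^+ j) = 1 by rewrite cabsX x1 expr1n.
have gw0 p : 0 <= g (of_xy p) * w p by rewrite mulr_ge0// powR_ge0.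
have mgw : measurable_fun DD (fun p => g (of_xy p) * w p).
  by apply: measurable_funM => //; exact: measurable_disc_weight.
have mrot j : measurable_fun DD (fun p => g (x ^+ j * of_xy p) * w p).
  have xn0 : x ^+ j != 0 by rewrite -cabs_gt0 xj.
  have [mx _] := scales_mul_plane xn0.
  rewrite (_ : (fun p => _) = (fun p => g (of_xy p) * w p) \o mul_plane (x ^+ j)).
    apply: (measurable_comp (F := DD)) => //; last exact: measurable_funTS.
    by move=> _ [p Dp <-]; exact: rotDD.
  by apply/funext => p /=; rewrite sqn_rot// /mul_plane to_xyK.
transitivity (\sum_(j < n) (n%:R^-1)%:E * \int[mu2]_(p in DD) (g (of_xy p) * w p)%:E)%E.
  rewrite -ge0_sume_distrl; last by move=> i _; rewrite lee_fin.
  have -> : (\sum_(j < n) (n%:R^-1)%:E)%E = 1%E :> \bar R; last by rewrite mul1e.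
  by rewrite sumEFin sumr_const card_ord -[X in X%:E]mulr_natr mulVf// pnatr_eq0 -lt0n.
rewrite [RHS](eq_integral (fun p => \sum_(j < n) (n%:R^-1 * (g (x ^+ j * of_xy p) * w p))%:E)%E); last first.
  move=> p _; rewrite sumEFin -mulr_sumr -mulrA; congr (_ * _)%:E.
  by rewrite mulr_suml.
rewrite ge0_integral_sum//; last 2 first.
- by move=> j; apply/measurable_EFinP; apply: measurable_funM.
- by move=> j p _; rewrite lee_fin mulr_ge0// mulr_ge0// powR_ge0.
apply: eq_bigr => j _; under eq_integral do rewrite EFinM.
rewrite ge0_integralZl_EFin//; last 2 first.
- by move=> p _; rewrite lee_fin mulr_ge0// powR_ge0.
- exact/measurable_EFinP.
congr (_ * _)%E; apply: (etrans (esym (disc_rotate (xj j) mgw (fun p _ => gw0 p)))).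
by apply: eq_integral => p _; rewrite sqn_rot// /mul_plane to_xyK.
Qed.

(** Averaging over the roots of unity leaves a polynomial in the squared modulus, integrated by
    [disc_poly]. The condition on [v] concerns moduli only, which leaves room for a unimodular
    factor making all frequencies natural numbers. *)
Lemma disc_quad n (x : C) (P : finType) (fr : P -> nat) (e : P -> C -> C)
    (E : P -> P -> {poly R}) v :
  n.-primitive_root x -> (forall s, fr s < n)%N ->
  measurable_fun DD (fun p => cabs (v (of_xy p))) ->
  (forall j z, cabs (v (x ^+ j * z)) = cabs (\sum_s x ^+ (j * fr s) * e s z)) ->
  (forall s t z, fr t = fr s -> complex.Re (e s z * cj (e t z)) = (E s t).[cabs z ^+ 2]) ->
  (\int[mu2]_(p in DD) (cabs (v (of_xy p)) ^+ 2 * w p)%:E =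
   (pi / (1 + a) * \sum_s \sum_(t | fr t == fr s) Lam a (E s t))%:E)%E.
Proof.
move=> px frn mv hv hE; have n0 := prim_order_gt0 px.
rewrite (@disc_average n x (fun z => cabs (v z) ^+ 2) px); last 2 first.
- exact: measurable_funX.
- by move=> z; exact: sqr_ge0.
pose Q := \sum_s \sum_(t | fr t == fr s) E s t.
have key z : n%:R^-1 * (\sum_(j < n) cabs (v (x ^+ j * z)) ^+ 2) = Q.[cabs z ^+ 2].
  under eq_bigr => j _ do rewrite hv.
  rewrite (parseval (fun s => e s z) px)// mulKf; last by rewrite pnatr_eq0 -lt0n.
  rewrite horner_sum; apply: eq_bigr => s _; rewrite horner_sum; apply: eq_bigr => t /eqP fst.
  exact: hE.
have -> : \sum_s \sum_(t | fr t == fr s) Lam a (E s t) = Lam a Q.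
  by rewrite Lam_sum; apply: eq_bigr => s _; rewrite Lam_sum.
rewrite -disc_poly//.
  by apply: eq_integral => p _; rewrite key.
(* The polynomial is nonnegative at [t] because its value is an average of squared moduli at the
   point [Num.sqrt t]. *)
move=> t /andP[t0 _]; rewrite -(sqr_sqrtr t0) -[Num.sqrt t]ger0_norm ?sqrtr_ge0// -cabs_real -key.
by rewrite mulr_ge0// sumr_ge0// => j _; exact: sqr_ge0.
Qed.

Let psum_quad b N : (0 < N)%N ->
  exists2 x : C, N.-primitive_root x &
  forall z, N%:R^-1 * (\sum_(j < N) cabs (psum b N (x ^+ j * z)) ^+ 2) =
    \sum_(k < N) cabs (b k) ^+ 2 * (cabs z ^+ 2) ^+ k.
Proof.
move=> N0; have [x px] := @prim_root_exists R _ N0; exists x => // z.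
rewrite (eq_bigr (fun j : 'I_N => cabs (\sum_(k < N) x ^+ (j * k) * (b k * z ^+ k)) ^+ 2)); last first.
  move=> j _; congr (cabs _ ^+ 2); apply: eq_bigr => k _.
  by rewrite exprMn -exprM; ring.
rewrite (parseval (fun k : 'I_N => b k * z ^+ k) px) ?mulKf//; last by rewrite pnatr_eq0 -lt0n.
apply: eq_bigr => k _; rewrite (big_pred1 k) => [|l]; last by rewrite /= eqE.
by rewrite -cabs_mulJ /= cabsM cabsX exprMn exprAC.
Qed.

(** The averages of the squared modulus of [f] over [n.+1] roots of unity all have the integral on
    the right. Pointwise they approach the averages for the partial sum of order [n.+1], which are
    explicit and dominate the [N] given terms, so Fatou's lemma applies. *)
Lemma bessel f (b : nat -> C) N : has_ps f b 1 ->
  ((pi / (1 + a) * \sum_(k < N) cabs (b k) ^+ 2 * gam k)%:E <=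
    \int[mu2]_(p in DD) (cabs (f (of_xy p)) ^+ 2 * w p)%:E)%E.
Proof.
move=> fb; have cf z : cabs z < 1 -> ccont f z by move=> z1; exact: (has_ps_cont fb).
have mf : measurable_fun DD (fun p => cabs (f (of_xy p)) ^+ 2).
  by apply: measurable_funX; exact: measurable_disc_cabs.
pose Q : {poly R} := \sum_(k < N) cabs (b k) ^+ 2 *: 'X^k.
have QE t : Q.[t] = \sum_(k < N) cabs (b k) ^+ 2 * t ^+ k.
  by rewrite horner_sum; apply: eq_bigr => k _; rewrite hornerZ hornerXn.
have Q0 t : 0 <= t -> 0 <= Q.[t].
  by move=> t0; rewrite QE sumr_ge0// => k _; rewrite mulr_ge0 ?sqr_ge0 ?exprn_ge0.
have -> : \sum_(k < N) cabs (b k) ^+ 2 * gam k = Lam a Q.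
  by rewrite Lam_sum; apply: eq_bigr => k _; rewrite LamZ LamXn.
rewrite -disc_poly//; last by move=> t /andP[t0 _]; exact: Q0.
have /choice[xi hxi] : forall n, exists x : C, n.+1.-primitive_root x /\
    forall z, n.+1%:R^-1 * (\sum_(j < n.+1) cabs (psum b n.+1 (x ^+ j * z)) ^+ 2) =
    \sum_(k < n.+1) cabs (b k) ^+ 2 * (cabs z ^+ 2) ^+ k.
  by move=> n; have [x px hx] := @psum_quad b n.+1 isT; exists x.
pose S n z := n.+1%:R^-1 * (\sum_(j < n.+1) cabs (f (xi n ^+ j * z)) ^+ 2).
have xi1 n j : cabs (xi n ^+ j) = 1.
  by rewrite cabsX (cabs_prim_root (hxi n).1) expr1n.
apply: (@fatou_le _ _ _ mu2 DD (fun p => Q.[sqn p] * w p) (fun n p => S n (of_xy p) * w p)) => //.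
- apply: measurable_funM; last exact: measurable_disc_weight.
  rewrite (_ : (fun p => _) = fun p => \sum_(k < N) cabs (b k) ^+ 2 * sqn p ^+ k).
    apply: measurable_sum => k; apply: measurable_funM => //; apply: measurable_funX.
    by apply: measurable_funTS; exact: measurable_sqn.
  by apply/funext => p; exact: QE.
- move=> n; apply: measurable_funM; last exact: measurable_disc_weight.
  apply: measurable_funM => //; apply: measurable_sum => j; apply: measurable_funX.
  apply: (measurable_disc_cabs (f := fun z => f (xi n ^+ j * z))) => z z1.
  apply: (ccont_comp (f := fun z => xi n ^+ j * z) (g := f)); last first.
    by apply: cf; rewrite cabsM xi1 mul1r.
  by apply: ccontM; [exact: ccont_cst|exact: ccont_id].
- by move=> p _; rewrite mulr_ge0 ?powR_ge0// Q0// sqn_ge0.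
- move=> n p _; rewrite mulr_ge0 ?powR_ge0// mulr_ge0// sumr_ge0// => j _; exact: sqr_ge0.
- move=> p e Dp e0; set z := of_xy p; have z1 : cabs z < 1 by [].
  set W := w p; have W0 : 0 <= W by exact: powR_ge0.
  have [K1 hK1] := has_ps_uniform fb (s := cabs z) (introT andP (conj (cabs_ge0 z) z1)) ltr01.
  pose B := \sum_(k < K1) cabs (b k) + 1.
  have B0 : 0 < B by rewrite ltr_wpDl// sumr_ge0// => k _; exact: cabs_ge0.
  have fB u : cabs u = cabs z -> cabs (f u) <= B.
    move=> uz; have h := hK1 K1 u (leqnn _); rewrite uz lexx in h; have {}h := h isT.
    rewrite -(subrK (psum b K1 u) (f u)); apply: le_trans (ler_cabsD _ _) _.
    rewrite addrC; apply: lerD => //; apply: le_trans (ler_cabs_sum _ _ _) _.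
    apply: ler_sum => k _; rewrite cabsM cabsX ler_piMr ?cabs_ge0//.
    by rewrite exprn_ile1 ?cabs_ge0// uz ltW.
  (* With [d <= 1] and [cabs (f u) <= B], an error [d] on the value changes its square by at most
     [d * (2 * B + 1)]; the factor [W + 1] pays for the weight. *)
  pose d := Num.min 1 (e / (W + 1) / (2 * B + 1)).
  have d0 : 0 < d by rewrite lt_min ltr01 divr_gt0 ?divr_gt0//; lra.
  have [K2 hK2] := has_ps_uniform fb (s := cabs z) (introT andP (conj (cabs_ge0 z) z1)) d0.
  exists (maxn N K2) => n; rewrite geq_max => /andP[Nn K2n].
  have W1 : 0 < W + 1 by lra.
  have dB : d * (2 * B + 1) * W <= e.
    have : d * (2 * B + 1) <= e / (W + 1).
      by rewrite -ler_pdivlMr ?ge_min ?lexx ?orbT//; lra.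
    move=> /(ler_wpM2r W0) /le_trans; apply.
    by rewrite mulrAC ler_pdivrMr// ler_pM2l//; lra.
  have QS : Q.[sqn p] <= S n z + d * (2 * B + 1).
    apply: (@le_trans _ _ (\sum_(k < n.+1) cabs (b k) ^+ 2 * (cabs z ^+ 2) ^+ k)).
      rewrite QE (big_ord_widen _ (fun k => cabs (b k) ^+ 2 * sqn p ^+ k) (leqW Nn)) big_mkcond /=.
      apply: ler_sum => k _; case: ifP => // _.
      by rewrite mulr_ge0 ?sqr_ge0// exprn_ge0// sqr_ge0.
    have E : d * (2 * B + 1) = n.+1%:R^-1 * \sum_(j < n.+1) d * (2 * B + 1).
      by rewrite sumr_const card_ord -[X in _ = _ * X]mulr_natl mulKf// pnatr_eq0.
    rewrite -(hxi n).2 /S [X in _ <= _ + X]E -mulrDr ler_pM2l ?invr_gt0//.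
    rewrite -big_split; apply: ler_sum => j _ /=; set u := xi n ^+ j * z.
    have uz : cabs u = cabs z by rewrite cabsM xi1 mul1r.
    have := hK2 n.+1 u (leqW K2n); rewrite uz lexx => /(_ isT) h.
    have h2 : cabs (psum b n.+1 u) <= cabs (f u) + d.
      rewrite -(subrK (f u) (psum b n.+1 u)) addrC; apply: le_trans (ler_cabsD _ _) _.
      by rewrite lerD2l cabs_distrC.
    have h3 := fB u uz; have h4 := cabs_ge0 (f u); have h5 := cabs_ge0 (psum b n.+1 u).
    have d1 : d <= 1 by rewrite ge_min lexx.
    apply: (@le_trans _ _ ((cabs (f u) + d) ^+ 2)).
      by rewrite lerXn2r// nnegrE ?addr_ge0// ltW.
    rewrite sqrrD -addrA lerD2l mulr2n; nra.
  apply: (@le_trans _ _ (Q.[sqn p] * W - d * (2 * B + 1) * W)); first by rewrite lerD2l lerN2.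
  by rewrite -mulrBl; apply: ler_wpM2r => //; rewrite lerBlDr.
- move=> n; rewrite le_eqVlt; apply/orP; left; apply/eqP/esym.
  by apply: (@disc_average n.+1 (xi n) (fun z => cabs (f z) ^+ 2) (hxi n).1 mf) => z; exact: sqr_ge0.
Qed.

(* The component of [w^n conj(w)^m] orthogonal to the holomorphic functions. *)
Definition mono m n z : C :=
  z ^+ n * cj z ^+ m - (if (m <= n)%N then (gam n / gam (n - m))%:C * z ^+ (n - m) else 0).

Definition trunc (A b : nat -> C) N z : C :=
  \sum_(s : 'I_N * 'I_N) cj (A s.1) * b s.2 * mono s.1 s.2 z.

(** For [n + m' = n' + m], the product of [mono m n] and the conjugate of [mono m' n'] as a
    polynomial in the squared modulus. *)
Let gramp m n m' n' : {poly R} := if (m <= n)%N then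
    'X^(n + m') - (gam n' / gam (n - m)) *: 'X^n - (gam n / gam (n - m)) *: 'X^n'
      + (gam n / gam (n - m) * (gam n' / gam (n - m))) *: 'X^(n - m)
  else 'X^(n + m').

Let Lam_gramp m n m' n' : Lam a (gramp m n m' n') = gram (2 + a) m n m' n'.
Proof.
rewrite /gramp /gram; case: ifP => _; last by rewrite LamXn subr0.
have LamN P : Lam a (- P) = - Lam a P by rewrite -scaleN1r LamZ mulN1r.
rewrite !LamD !LamN !LamZ !LamXn.
have h : gam (n - m) != 0 by rewrite gt_eqF// gam_gt0//; move: a1; lra.
by field.
Qed.

Let monoM m n m' n' z : (n + m' = n' + m)%N ->
  mono m n z * cj (mono m' n' z) = ((gramp m n m' n').[cabs z ^+ 2])%:C.
Proof.
move=> e; rewrite /mono /gramp (_ : (m' <= n')%N = (m <= n)%N); last by lia.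
case: ifP => mn; last first.
  rewrite !subr0 cjM !cjX cjK hornerXn rmorphXn /= -mul_cj exprMn.
  by rewrite [cj z ^+ n' * _]mulrC mulrACA -!exprD [(m + n')%N]addnC -e.
have -> : (n' - m' = n - m)%N by lia.
set d := (n - m)%N; have -> : n = (d + m)%N by rewrite /d; lia.
have -> : n' = (d + m')%N by rewrite /d; lia.
rewrite !(hornerD, hornerN, hornerZ, hornerXn) cjB !cjM cj_real !cjX cjK.
rewrite !(rmorphD, rmorphN, rmorphM, rmorphXn) /=.
have -> : (cabs z)%:C * (cabs z)%:C = z * cj z by rewrite mul_cj expr2 rmorphM.
rewrite !(exprD, exprMn).
move: (z ^+ d) (z ^+ m) (z ^+ m') (cj z ^+ d) (cj z ^+ m) (cj z ^+ m') => u1 u2 u3 u4 u5 u6.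
by ring.
Qed.

(** A rotation acts on [mono m n] with frequency [n - m]; the extra factor [x ^+ (j * N)] shifts it
    to a natural number. *)
Let mono_rot m n N j (x z : C) : x * cj x = 1 -> (m < N)%N ->
  mono m n (x ^+ j * z) * x ^+ (j * N) = x ^+ (j * (n + N - m)) * mono m n z.
Proof.
move=> xx mN; rewrite !exprM; have yy : x ^+ j * cj (x ^+ j) = 1.
  by rewrite cjX -exprMn xx expr1n.
move: (x ^+ j) yy => y yy; rewrite /mono cjM !exprMn.
have e1 : y ^+ n * cj y ^+ m * y ^+ N = y ^+ (n + N - m).
  rewrite -{1}(subnKC (ltnW mN)) (_ : (n + N - m = n + (N - m))%N); last by lia.
  rewrite !exprD (_ : _ * _ = y ^+ n * y ^+ (N - m) * (y * cj y) ^+ m); last by rewrite exprMn; ring.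
  by rewrite yy expr1n mulr1.
rewrite mulrBl mulrBr; congr (_ - _); first by rewrite -e1; ring.
case: ifP => mn; last by rewrite mul0r mulr0.
have -> : (n + N - m = (n - m) + N)%N by lia.
by rewrite exprD; ring.
Qed.

Let mono_cont m n z : ccont (mono m n) z.
Proof.
have cX k u : ccont (fun z : C => z ^+ k) u by exact: cderiv_cont (cderivX k (cderiv_id u)).
have cJX k u : ccont (fun z : C => cj z ^+ k) u.
  by apply: (ccont_comp (f := cj) (g := fun z => z ^+ k)) => //; exact: ccont_cj.
apply: ccontB; first by apply: ccontM.
case: (m <= n)%N; last exact: ccont_cst.
by apply: ccontM => //; exact: ccont_cst.
Qed.

Lemma trunc_cont A b N z : ccont (trunc A b N) z.
Proof.
pose F (s : 'I_N * 'I_N) u := cj (A s.1) * b s.2 * mono s.1 s.2 u.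
have cF s : ccont (F s) z by apply: ccontM; [exact: ccont_cst|exact: mono_cont].
rewrite -[trunc A b N]/(fun u => \sum_s F s u); elim: (index_enum _) => [|s r IH].
  rewrite (_ : (fun _ => _) = fun=> 0); first exact: ccont_cst.
  by apply/funext => u; rewrite big_nil.
rewrite (_ : (fun _ => _) = fun u => F s u + \sum_(t <- r) F t u); first exact: ccontD.
by apply/funext => u; rewrite big_cons.
Qed.

Lemma trunc_bound A b N : A 0%N = 0 ->
  (\int[mu2]_(p in DD) (cabs (trunc A b N (of_xy p)) ^+ 2 * w p)%:E <=
   (pi / (1 + a) * ((2 + a)^-1 * ((\sum_(m < N) m%:R * cabs (A m) ^+ 2) *
     (\sum_(n < N) cabs (b n) ^+ 2 * gam n))))%:E)%E.
Proof.
move=> A0; have c1 : 1 <= 2 + a by move: a1; lra.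
(* All shifted frequencies [n + N - m] are below [N + N]; the successor keeps the order positive
   when [N] is 0. *)
have [x px] := @prim_root_exists R (N + N).+1 isT.
have xx : x * cj x = 1 := mulJ_prim_root px; have x1 := cabs_prim_root px.
pose coef (s : 'I_N * 'I_N) := cj (A s.1) * b s.2.
pose E (s t : 'I_N * 'I_N) : {poly R} := complex.Re (coef s * cj (coef t)) *: gramp s.1 s.2 t.1 t.2.
have frE (s t : 'I_N * 'I_N) : (t.2 + N - t.1 == s.2 + N - s.1)%N = (s.2 + t.1 == t.2 + s.1)%N.
  by case: s t => [[s1 ?] [s2 ?]] [[t1 ?] [t2 ?]] /=; lia.
rewrite (@disc_quad _ x ('I_N * 'I_N)%type (fun s => (s.2 + N - s.1)%N)
  (fun s z => coef s * mono s.1 s.2 z) E (trunc A b N) px); last 4 first.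
- by case=> [[s1 ?] [s2 ?]] /=; lia.
- by apply: measurable_disc_cabs => z _; exact: trunc_cont.
- move=> j z; have <- : trunc A b N (x ^+ j * z) * x ^+ (j * N) =
      \sum_(s : 'I_N * 'I_N) x ^+ (j * (s.2 + N - s.1)) * (coef s * mono s.1 s.2 z).
    rewrite mulr_suml; apply: eq_bigr => s _.
    by rewrite -[LHS]mulrA mono_rot ?ltn_ord// mulrCA.
  by rewrite cabsM cabsX x1 expr1n mulr1.
- move=> s t z /eqP; rewrite frE => /eqP e; rewrite cjM mulrACA monoM// hornerZ.
  by case: (coef s * _) => u v /=; rewrite mulr0 subr0.
rewrite lee_fin; apply: ler_wpM2l.
  by rewrite divr_ge0 ?pi_ge0//; move: a1; lra.
have := @gram_bound_prod R (2 + a) N (fun m => cabs (A m)) (fun n => cabs (b n)) c1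
  (fun m => cabs_ge0 _) (fun n => cabs_ge0 _).
rewrite A0 cabs0 => /(_ erefl) H; apply: le_trans (le_trans H _).
  apply: ler_sum => s _; rewrite (eq_bigl _ _ (frE s)); apply: ler_sum => t /eqP e.
  rewrite LamZ Lam_gramp; apply: ler_wpM2r.
    rewrite /gram; case: ifP => mn; last by rewrite subr0 ltW// gam_gt0.
    rewrite subr_ge0 ler_pdivrMr ?gam_gt0//.
    have := gam_logconvex c1 (s.2 - s.1) s.1 t.1; rewrite subnK//.
    have -> // : (s.2 - s.1 + t.1 = t.2)%N.
    by rewrite -(addnK s.1 t.2) -e addnBAC.
  apply: le_trans (ler_norm _) _; apply: le_trans (norm_Re_cabs _) _.
  by rewrite /coef !(cabsM, cabs_cj).
rewrite le_eqVlt; apply/orP; left; apply/eqP.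
rewrite -(pair_bigA _ (fun m n : 'I_N => (cabs (A m) * cabs (b n)) ^+ 2 * gam n * (m%:R / (2 + a)))) /=.
rewrite mulr_suml mulr_sumr; apply: eq_bigr => m _.
rewrite mulr_sumr mulr_sumr; apply: eq_bigr => n _.
by rewrite exprMn; ring.
Qed.

End disc_integrals.

(** * The solution on the disc *)

Section series_limit.
Context {R : realType}.
Local Notation C := R[i].

Lemma cseries_cvg (t : nat -> C) (M : R) : (forall K, \sum_(m < K) cabs (t m) <= M) ->
  exists2 c : C, cabs c <= M & forall e : R, 0 < e -> exists K0, forall K, (K0 <= K)%N ->
    cabs (\sum_(m < K) t m - c) <= e.
Proof.
move=> hM.
have cvg (u : nat -> R) : (forall m, `|u m| <= cabs (t m)) -> cvgn (series u).
  move=> ut; apply: normed_cvg; apply: (@nondecreasing_is_cvgn _ _ _).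
    by apply: nondecreasing_series => *; exact: normr_ge0.
  exists M => _ [n _ <-]; change (\sum_(0 <= k < n) `|u k| <= M); rewrite big_mkord; apply: le_trans (hM n).
  by apply: ler_sum => m _; exact: ut.
have /cvg_ex[x hx] := cvg _ (fun m => norm_Re_cabs (t m)).
have /cvg_ex[y hy] := cvg _ (fun m => norm_Im_cabs (t m)).
have lim (e : R) : 0 < e -> exists K0, forall K, (K0 <= K)%N -> cabs (\sum_(m < K) t m - (x +i* y)) <= e.
  move=> e0; have e2 : 0 < e / 2 by rewrite divr_gt0.
  have [N1 _ h1] := (@cvgrPdist_le _ _ _ _ _ _ _).1 hx _ e2.
  have [N2 _ h2] := (@cvgrPdist_le _ _ _ _ _ _ _).1 hy _ e2.
  exists (maxn N1 N2) => K; rewrite geq_max => /andP[K1 K2].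
  apply: le_trans (cabs_ReIm _) _.
  have := h1 K K1; have := h2 K K2; rewrite /series /= !big_mkord !(distrC _ (\sum_(_ < _) _)).
  rewrite !raddfB /= !raddf_sum /=; lra.
exists (x +i* y) => //; apply/ler_addgt0Pr => e e0; have [K0 /(_ K0 (leqnn _)) h] := lim e e0.
set S := \sum_(_ < _) _ in h; rewrite -(subrK S (x +i* y)) addrC.
apply: le_trans (ler_cabsD _ _) _; apply: lerD; last by rewrite cabs_distrC.
by apply: le_trans (ler_cabs_sum _ _ _) _.
Qed.

End series_limit.

Section disc_solution.
Context {R : realType}.
Local Notation C := R[i].
Local Notation RM := (measurableTypeR R).
Local Notation T2 := (RM * RM)%type.
Local Notation mu2 := (@lebesgue_measure R \x @lebesgue_measure R)%E.
Local Notation DD := (plane (@unit_disc R)).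
Variable a : R.
Hypothesis a1 : -1 < a.
Local Notation gam := (gam (2 + a)).
Variables (A b : nat -> C) (psi F : C -> C) (Sa Sb : R).
Hypothesis A0 : A 0%N = 0.
Hypothesis psiA : has_ps psi A 1.
Hypothesis Fb : has_ps F b 1.
Hypothesis hSa : forall N, \sum_(m < N) m%:R * cabs (A m) ^+ 2 <= Sa.
Hypothesis hSb : forall N, \sum_(n < N) cabs (b n) ^+ 2 * gam n <= Sb.

Let c1 : 1 <= 2 + a. Proof. by move: a1; lra. Qed.
Let g0 n : 0 < gam n := gam_gt0 c1 n.

(** The contribution of the monomial with exponents [m + j] and [m] to the coefficient of [z ^+ j]
    in the holomorphic projection. *)
Let t j m : C := cj (A m) * b (m + j)%N * (gam (m + j) / gam j)%:C.

Let M0 := (Sa + Sb) / 2.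

(** Termwise, [2 * x * y * g <= x ^+ 2 + y ^+ 2 * g ^+ 2], where [g <= 1] is a moment. For [m >= 1]
    the first square is at most [m * x ^+ 2], and the term [m = 0] vanishes with [A 0]. *)
Let t_bound j K : \sum_(m < K) cabs (t j m) <= M0 / gam j.
Proof.
apply: (@le_trans _ _ ((\sum_(m < K) m%:R * cabs (A m) ^+ 2 +
    \sum_(m < K) cabs (b (j + m)%N) ^+ 2 * gam (j + m)) / 2 / gam j)).
  rewrite -big_split !mulr_suml; apply: ler_sum => m _ /=.
  rewrite /t addnC !cabsM cabs_cj cabs_real normrM [`|_^-1|]ger0_norm ?invr_ge0 ?(ltW (g0 _))//.
  rewrite (ger0_norm (ltW (g0 _))) mulrA ler_pM2r ?invr_gt0//.
  have [->|m0] := posnP m.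
    rewrite A0 cabs0 !mul0r add0r divr_ge0// mulr_ge0 ?sqr_ge0 ?(ltW (g0 _))//.
  have m1 : 1 <= m%:R :> R by rewrite ler1n.
  have gl := gam_le1 c1 (j + m); have gp := g0 (j + m).
  move: (cabs (A m)) (cabs (b _)) (cabs_ge0 (A m)) (cabs_ge0 (b (j + m)%N)) => x y x0 y0.
  have h1 := sqr_ge0 (x - y * gam (j + m)).
  have h2 : x ^+ 2 <= m%:R * x ^+ 2 by rewrite ler_peMl ?sqr_ge0.
  have h3 : y ^+ 2 * gam (j + m) ^+ 2 <= y ^+ 2 * gam (j + m).
    by apply: ler_wpM2l; [exact: sqr_ge0|rewrite expr2 ler_piMr// ltW].
  by move: h1; rewrite sqrrB exprMn mulr2n; lra.
rewrite ler_pM2r ?invr_gt0// ler_pM2r ?invr_gt0//; apply: lerD => //.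
apply: le_trans (hSb (j + K)); rewrite big_split_ord /= lerDr sumr_ge0// => i _.
by rewrite mulr_ge0 ?sqr_ge0 ?(ltW (g0 _)).
Qed.

Let M0_ge0 : 0 <= M0.
Proof. by have := t_bound 0 0; rewrite big_ord0 invr1 mulr1. Qed.

(** Collection by the exponent [j = n - m]; the square truncation [m, n < N] leaves the range
    [m < N - j] for the inner sum. *)
Let holo_part N z : \sum_(s : 'I_N * 'I_N) cj (A s.1) * b s.2 *
    (if (s.1 <= s.2)%N then (gam s.2 / gam (s.2 - s.1))%:C * z ^+ (s.2 - s.1) else 0) =
  \sum_(j < N) (\sum_(m < N - j) t j m) * z ^+ j.
Proof.
rewrite -(pair_bigA _ (fun m n : 'I_N => cj (A m) * b n *
    (if (m <= n)%N then (gam n / gam (n - m))%:C * z ^+ (n - m) else 0))) /=.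
transitivity (\sum_(m < N) \sum_(j < N | (m + j < N)%N) t j m * z ^+ j).
  apply: eq_bigr => m _.
  pose g n := cj (A m) * b n * (if (m <= n)%N then (gam n / gam (n - m))%:C * z ^+ (n - m) else 0).
  rewrite -[LHS]/(\sum_(n < N) g n).
  have -> : \sum_(n < N) g n = \sum_(j < N - m) g (m + j)%N.
    have E k : \sum_(n < m + k) g n = \sum_(j < k) g (m + j)%N.
      by rewrite big_split_ord /= big1 ?add0r// => i _; rewrite /g leqNgt ltn_ord mulr0.
    by have := E (N - m)%N; rewrite subnKC// ltnW.
  rewrite (big_ord_widen _ (fun j => g (m + j)%N) (leq_subr m N)).
  apply: eq_big => [j|j _]; first by rewrite ltn_subRL.
  by rewrite /g leq_addr addKn /t addnC mulrA.
rewrite (exchange_big_dep (fun=> true)) //=; apply: eq_bigr => j _.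
rewrite (big_ord_widen _ (fun m => t j m) (leq_subr j N)) mulr_suml.
by apply: eq_bigl => m; rewrite ltn_subRL addnC.
Qed.

Let truncE N z : trunc a A b N z = cj (psum A N z) * psum b N z -
  \sum_(j < N) (\sum_(m < N - j) t j m) * z ^+ j.
Proof.
rewrite -holo_part /trunc /mono; under eq_bigr => s _ do rewrite mulrBr.
rewrite sumrB; congr (_ - _).
have -> : cj (psum A N z) = \sum_(m < N) cj (A m) * cj z ^+ m.
  rewrite /psum; elim/big_ind2 : _ => [|x1 x2 y1 y2 <- <-|m _].
  - exact: cj0.
  - exact: cjD.
  - by rewrite cjM cjX.
rewrite mulr_suml -(pair_bigA _ (fun m n : 'I_N => cj (A m) * b n * (z ^+ n * cj z ^+ m))) /=.
apply: eq_bigr => m _; rewrite mulr_sumr; apply: eq_bigr => n _; ring.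
Qed.

Lemma disc_solution : exists2 G : C -> C, holo_disc G 1 &
  (\int[mu2]_(p in DD) (cabs (cj (psi (of_xy p)) * F (of_xy p) - G (of_xy p)) ^+ 2 *
     (1 - sqn p) `^ a)%:E <= (pi / (1 + a) * ((2 + a)^-1 * (Sa * Sb)))%:E)%E.
Proof.
have /choice[c hc] : forall j, exists c : C, cabs c <= M0 / gam j /\ forall e : R, 0 < e ->
    exists K0, forall K, (K0 <= K)%N -> cabs (\sum_(m < K) t j m - c) <= e.
  by move=> j; have [c h1 h2] := cseries_cvg (t_bound j); exists c.
have [G Gc] : exists G, has_ps G c 1.
  apply: has_ps_exists => s s01; have [M M_ge0 hM] := gam_inv_bounded c1 s01.
  exists (M0 * M) => [|n]; first exact: mulr_ge0.
  have s0 : 0 <= s ^+ n by rewrite exprn_ge0// ltW//; case/andP: s01.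
  apply: le_trans (ler_wpM2r s0 (hc n).1) _; rewrite -mulrA; apply: ler_wpM2l => //.
  by rewrite mulrC.
exists G; first exact: has_ps_holo Gc.
(* The length [N - j] of the inner sums depends on [j]. The terms with [j < J] converge one by one,
   and the others are dominated, uniformly in [N], by a geometric tail, since [s ^+ j / gam j] is
   bounded for [s < 1]. *)
have Glim z : cabs z < 1 -> forall e : R, 0 < e -> exists N0, forall N, (N0 <= N)%N ->
    cabs (\sum_(j < N) (\sum_(m < N - j) t j m) * z ^+ j - G z) <= e.
  move=> z1 e e0; have e3 : 0 < e / 3 by rewrite divr_gt0.
  have z0 := cabs_ge0 z.
  pose s := (cabs z + 1) / 2.
  have s0 : 0 < s by rewrite /s; lra.
  have s1 : s < 1 by rewrite /s; lra.
  have zs : cabs z < s by rewrite /s; lra.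
  have [M M_ge0 hM] := gam_inv_bounded c1 (introT andP (conj s0 s1)).
  pose q := cabs z / s.
  have q01 : 0 <= q < 1 by rewrite /q divr_ge0 ?(ltW s0)//= ltr_pdivrMr// mul1r.
  have [q0 q1] := andP q01.
  have h2 : 0 <= M0 * M / (1 - q) by apply: divr_ge0; [exact: mulr_ge0|rewrite subr_ge0 ltW].
  have p0 : 0 < M0 * M / (1 - q) + 1 by apply: ltr_wpDl.
  have [J1 hJ1] := expr_small q01 (divr_gt0 e3 p0).
  have [J2 hJ2] := Gc z z1 _ e3.
  pose J := maxn J1 J2.
  have eJ : 0 < e / 3 / J.+1%:R by rewrite divr_gt0.
  have /choice[K hK] := fun j => (hc j).2 _ eJ.
  (* Then [N - j >= K j] for every [j < J]. *)
  exists (J + \max_(j < J) K j)%N => N JN.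
  have JleN : (J <= N)%N by apply: leq_trans JN; exact: leq_addr.
  set T := fun N j => \sum_(m < N - j) t j m.
  have -> : \sum_(j < N) (\sum_(m < N - j) t j m) * z ^+ j - G z =
    \sum_(j < J) (T N j - c j) * z ^+ j + \sum_(k < N - J) T N (J + k)%N * z ^+ (J + k) + (psum c J z - G z).
    have -> : \sum_(j < N) (\sum_(m < N - j) t j m) * z ^+ j =
        \sum_(j < J) T N j * z ^+ j + \sum_(k < N - J) T N (J + k)%N * z ^+ (J + k).
      have E k : \sum_(j < J + k) T N j * z ^+ j =
        \sum_(j < J) T N j * z ^+ j + \sum_(k < k) T N (J + k)%N * z ^+ (J + k) by rewrite big_split_ord.
      by have := E (N - J)%N; rewrite subnKC.
    under [X in _ = X + _ + _]eq_bigr => j _ do rewrite mulrBl.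
    rewrite sumrB /psum -/(T N); move: (\sum_(i < N - J) _) (\sum_(i < J) T N i * _) (\sum_(i < J) c i * _) => x y v.
    by ring.
  have zj1 j : cabs (z ^+ j) <= 1 by rewrite cabsX exprn_ile1// ltW.
  have b1 : cabs (\sum_(j < J) (T N j - c j) * z ^+ j) <= e / 3.
    apply: le_trans (ler_cabs_sum _ _ _) _.
    apply: (@le_trans _ _ (\sum_(j < J) e / 3 / J.+1%:R)).
      apply: ler_sum => j _; rewrite cabsM -[leRHS]mulr1 ler_pM ?cabs_ge0//.
      apply: hK; rewrite leq_subRL ?(leq_trans (ltnW (ltn_ord j)))//.
      apply: leq_trans JN; apply: leq_add; first exact/ltnW.
      exact: (@leq_bigmax _ (fun i : 'I_J => K i) j).
    rewrite sumr_const card_ord -[leLHS]mulr_natr -mulrA ler_piMr ?(ltW e3)//.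
    by rewrite mulrC ler_pdivrMr// mul1r ler_nat.
  have b2 : cabs (\sum_(k < N - J) T N (J + k)%N * z ^+ (J + k)) <= e / 3.
    apply: le_trans (ler_cabs_sum _ _ _) _.
    apply: (@le_trans _ _ (\sum_(k < N - J) M0 * M * q ^+ J * q ^+ k)).
      apply: ler_sum => k _; rewrite -mulrA -exprD cabsM cabsX.
      apply: (@le_trans _ _ (M0 / gam (J + k) * cabs z ^+ (J + k))).
        apply: ler_wpM2r; first by rewrite exprn_ge0.
        by apply: le_trans (ler_cabs_sum _ _ _) _; exact: t_bound.
      rewrite -[M0 / _ * _]mulrA -[M0 * M * _]mulrA; apply: ler_wpM2l => //.
      have -> : cabs z ^+ (J + k) = s ^+ (J + k) * q ^+ (J + k).
        by rewrite -exprMn /q mulrCA divff ?mulr1// gt_eqF.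
      rewrite mulrA; apply: ler_wpM2r; first by rewrite exprn_ge0.
      by rewrite mulrC.
    rewrite -mulr_sumr; apply: (@le_trans _ _ (M0 * M * q ^+ J * (1 - q)^-1)).
      apply: ler_wpM2l; last exact: sum_geo_le.
      by rewrite mulr_ge0 ?exprn_ge0// mulr_ge0.
    rewrite mulrAC; have h := hJ1 J (leq_maxl _ _).
    apply: le_trans (ler_wpM2l h2 h) _.
    by rewrite mulrA ler_pdivrMr// mulrC ler_pM2l// lerDl.
  have b3 : cabs (psum c J z - G z) <= e / 3 by rewrite cabs_distrC; apply: hJ2; exact: leq_maxr.
  apply: le_trans (ler_cabsD _ _) _; have := ler_cabsD (\sum_(j < J) (T N j - c j) * z ^+ j)
    (\sum_(k < N - J) T N (J + k)%N * z ^+ (J + k)); lra.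
pose v z := cj (psi z) * F z - G z.
have vlim z : cabs z < 1 -> forall e : R, 0 < e -> exists N0, forall N, (N0 <= N)%N ->
    cabs (trunc a A b N z - v z) <= e.
  move=> z1 e e0; have e4 : 0 < e / 4 by rewrite divr_gt0.
  have B0 : 0 < cabs (psi z) + cabs (F z) + 1.
    by have := cabs_ge0 (psi z); have := cabs_ge0 (F z); lra.
  pose d := Num.min 1 (e / 4 / (cabs (psi z) + cabs (F z) + 1)).
  have d0 : 0 < d by rewrite lt_min ltr01 divr_gt0.
  have [N1 h1] := psiA z1 d0; have [N2 h2] := Fb z1 d0; have [N3 h3] := Glim z z1 _ e4.
  exists (maxn N1 (maxn N2 N3)) => N; rewrite !geq_max => /andP[k1 /andP[k2 k3]].
  rewrite truncE; have {}h1 := h1 N k1; have {}h2 := h2 N k2; have {}h3 := h3 N k3.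
  move: h1 h2 h3; set P := psum A N z; set Q := psum b N z; set H := \sum_(j < N) _ => h1 h2 h3.
  rewrite (_ : _ - _ = - (cj (psi z - P) * F z) - cj (P - psi z) * (F z - Q)
     - (cj (psi z) * (F z - Q)) - (H - G z)); last first.
    by rewrite /v !cjB; ring.
  have q1 := cabs_ge0 (psi z); have q2 := cabs_ge0 (F z).
  have d1 : d <= 1 by rewrite ge_min lexx.
  have dB : d * (cabs (psi z) + cabs (F z) + 1) <= e / 4.
    by rewrite -ler_pdivlMr// ge_min lexx orbT.
  apply: le_trans (ler_cabsB _ _) _.
  have := ler_cabsB (- (cj (psi z - P) * F z) - cj (P - psi z) * (F z - Q)) (cj (psi z) * (F z - Q)).
  have := ler_cabsB (- (cj (psi z - P) * F z)) (cj (P - psi z) * (F z - Q)).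
  rewrite cabsN !cabsM !cabs_cj [cabs (P - _)]cabs_distrC.
  have j1 := ler_wpM2r q2 h1; have j2 := ler_wpM2l q1 h2.
  have j3 : cabs (psi z - P) * cabs (F z - Q) <= d * 1.
    by apply: ler_pM; rewrite ?cabs_ge0//; exact: le_trans d1.
  have [x1 x2] : 0 <= d * cabs (psi z) /\ 0 <= d * cabs (F z) by split; apply: mulr_ge0 => //; exact: ltW.
  by rewrite !mulrDr in dB; lra.
have Sb0 : 0 <= Sb by apply: le_trans (hSb 0); rewrite big_ord0.
apply: (@fatou_le _ _ _ mu2 DD (fun p => cabs (v (of_xy p)) ^+ 2 * (1 - sqn p) `^ a)
  (fun N p => cabs (trunc a A b N (of_xy p)) ^+ 2 * (1 - sqn p) `^ a)).
- exact: measurable_plane open_unit_disc.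
- apply: measurable_funM; last exact: measurable_disc_weight.
  apply: measurable_funX; apply: measurable_disc_cabs => z z1.
  apply: ccontB; last exact: has_ps_cont Gc z1.
  apply: ccontM; last exact: has_ps_cont Fb z1.
  by apply: (ccont_comp (f := psi) (g := cj)); [exact: has_ps_cont psiA z1|exact: ccont_cj].
- move=> N; apply: measurable_funM; last exact: measurable_disc_weight.
  by apply: measurable_funX; apply: measurable_disc_cabs => z _; exact: trunc_cont.
- by move=> p _; rewrite mulr_ge0 ?sqr_ge0// powR_ge0.
- by move=> N p _; rewrite mulr_ge0 ?sqr_ge0// powR_ge0.
- move=> p e Dp e0; set z := of_xy p; set W := _ `^ a; have W0 : 0 <= W by exact: powR_ge0.
  have V0 := cabs_ge0 (v z).
  (* If a modulus is at least [cabs (v z) - d], its square loses at most [2 * cabs (v z) * d], and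
     the weight multiplies this by [W]. *)
  have d0 : 0 < e / ((2 * cabs (v z) + 1) * (W + 1)) by rewrite divr_gt0// mulr_gt0//; lra.
  have [N0 hN] := vlim z Dp _ d0; exists N0 => N /hN.
  set d := e / _ in d0 *; set x := cabs (trunc _ _ _ _ _) => h.
  have x0 : 0 <= x by exact: cabs_ge0.
  have h1 : cabs (v z) - d <= x.
    rewrite lerBlDr -(subrK (trunc a A b N z) (v z)) addrC; apply: le_trans (ler_cabsD _ _) _.
    by rewrite lerD2l cabs_distrC.
  have h2 : cabs (v z) ^+ 2 - 2 * cabs (v z) * d <= x ^+ 2.
    have [vd|vd] := leP d (cabs (v z)).
      by apply: (@le_trans _ _ ((cabs (v z) - d) ^+ 2)); [rewrite sqrrB mulr2n; have := sqr_ge0 d; lra|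
        rewrite lerXn2r// nnegrE// subr_ge0].
    apply: le_trans (sqr_ge0 x); rewrite subr_le0; have := ler_wpM2l V0 (ltW vd); nra.
  have h3 : 2 * cabs (v z) * d * W <= e.
    apply: (@le_trans _ _ (d * ((2 * cabs (v z) + 1) * (W + 1)))).
      by have := ltW d0; have := mulr_ge0 V0 W0; have := mulr_ge0 (ltW d0) V0; nra.
    by rewrite /d divfK// gt_eqF// mulr_gt0//; lra.
  apply: le_trans (ler_wpM2r W0 h2); rewrite mulrBl; lra.
- move=> N; apply: le_trans (trunc_bound a1 b N A0) _; rewrite lee_fin.
  apply: ler_wpM2l; first by rewrite divr_ge0 ?pi_ge0//; move: a1; lra.
  apply: ler_wpM2l; first by rewrite invr_ge0; move: a1; lra.
  apply: ler_pM => //; apply: sumr_ge0 => i _; first by rewrite mulr_ge0 ?sqr_ge0.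
  by rewrite mulr_ge0 ?sqr_ge0 ?(ltW (g0 _)).
Qed.

End disc_solution.

(** * Real differentiability *)

Section real_differentiability.
Context {R : realType}.
Local Notation C := R[i].

Definition lin2 (A B : R) (k : R * R) : R := A * k.1 + B * k.2.

Lemma lin2_is_linear A B : linear (lin2 A B : R * R -> R^o).
Proof. by move=> a x y; rewrite /lin2 /= /GRing.scale /=; ring. Qed.

HB.instance Definition _ A B := GRing.isLinear.Build R (R * R)%type R^o *:%R (lin2 A B) (lin2_is_linear A B).

Lemma continuous_lin2 A B : continuous (lin2 A B : R * R -> R^o).
Proof.
move=> k; apply: cvgD; apply: cvgMr; [exact: cvg_fst|exact: cvg_snd].
Qed.

Lemma differentiable_lin2 (v : R * R -> R^o) (x : R * R) (A B : R) :
  (forall e : R, 0 < e -> exists2 r : R, 0 < r & forall k : R * R, cabs (of_xy k) < r ->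
    `|v (k + x) - v x - lin2 A B k| <= e * cabs (of_xy k)) ->
  [/\ differentiable v x, 'D_(1, 0) v x = A & 'D_(0, 1) v x = B].
Proof.
move=> hv.
have E : v \o shift x = cst (v x) + (lin2 A B : R * R -> R^o) +o_ (0 : R * R) id.
  apply/eqaddoP => e e0; have e2 : 0 < e / 2 by rewrite divr_gt0.
  have [r r0 hr] := hv _ e2; apply/nbhs_ballP; exists (r / 2) => /=; first by rewrite divr_gt0.
  move=> k [/=]; rewrite -ball_normE /= !sub0r !normrN => k1 k2.
  have kr : cabs (of_xy k) <= `|k.1| + `|k.2| by exact: cabs_ReIm.
  have -> : (v \o shift x - (cst (v x) + (lin2 A B : R * R -> R^o))) k = v (k + x) - v x - lin2 A B k.
    by rewrite [LHS]/(v (k + x) - (v x + lin2 A B k)) opprD; exact: addrA.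
  apply: le_trans (hr k _) _; first by lra.
  rewrite -mulrA; apply: ler_wpM2l; first exact: ltW.
  rewrite ler_pdivrMl//; apply: le_trans kr _.
  have [m1 m2] : `|k.1| <= `|k| /\ `|k.2| <= `|k|.
    by rewrite [`|k|]/(Num.max `|k.1| `|k.2|) !le_max !lexx orbT.
  by lra.
have D := diff_unique (@continuous_lin2 A B) E.
have df : differentiable v x.
  by apply/diff_locallyP; rewrite D; split => //; exact: continuous_lin2.
have Dk k : 'd v x k = A * k.1 + B * k.2 by rewrite D.
by split => //; rewrite deriveE// Dk /= !(mulr1, mulr0, addr0, add0r).
Qed.

(** [P] and [Q] are the Wirtinger derivatives; the partial derivatives are [P + Q] and i(P - Q), and
    [dbar] isolates [Q]. *)
Lemma dbar_expansion (u : C -> C) z (P Q : C) :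
  (forall e : R, 0 < e -> exists2 r : R, 0 < r & forall k, cabs k < r ->
    cabs (u (z + k) - u z - P * k - Q * cj k) <= e * cabs k) ->
  real_differentiable u z /\ dbar u z = Q.
Proof.
move=> hu.
have oxy (k : R * R) : of_xy (k + to_xy z) = z + of_xy k.
  by case: z k {hu} => z1 z2 [x y]; rewrite /of_xy /to_xy /=; simpc; rewrite [x + _]addrC [y + _]addrC.
have [d1 D1 D2] : [/\ differentiable ((fun p => complex.Re (u (of_xy p))) : R * R -> R^o) (to_xy z),
    'D_(1, 0) ((fun p => complex.Re (u (of_xy p))) : R * R -> R^o) (to_xy z) = complex.Re P + complex.Re Q &
    'D_(0, 1) ((fun p => complex.Re (u (of_xy p))) : R * R -> R^o) (to_xy z) = complex.Im Q - complex.Im P].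
  apply: differentiable_lin2 => e e0; have [r r0 hr] := hu e e0; exists r => // k /hr.
  apply: le_trans; apply: le_trans (norm_Re_cabs _); rewrite oxy to_xyK.
  rewrite le_eqVlt; apply/orP; left; apply/eqP; congr `|_|; rewrite /lin2.
  move: (u (z + of_xy k)) (u z) => U V; clear -P Q k U V; case: U => a1 a2; case: V => b1 b2.
  by case: P => p1 p2; case: Q => q1 q2; case: k => x y /=; ring.
have [d2 D3 D4] : [/\ differentiable ((fun p => complex.Im (u (of_xy p))) : R * R -> R^o) (to_xy z),
    'D_(1, 0) ((fun p => complex.Im (u (of_xy p))) : R * R -> R^o) (to_xy z) = complex.Im P + complex.Im Q &
    'D_(0, 1) ((fun p => complex.Im (u (of_xy p))) : R * R -> R^o) (to_xy z) = complex.Re P - complex.Re Q].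
  apply: differentiable_lin2 => e e0; have [r r0 hr] := hu e e0; exists r => // k /hr.
  apply: le_trans; apply: le_trans (norm_Im_cabs _); rewrite oxy to_xyK.
  rewrite le_eqVlt; apply/orP; left; apply/eqP; congr `|_|; rewrite /lin2.
  move: (u (z + of_xy k)) (u z) => U V; clear -P Q k U V; case: U => a1 a2; case: V => b1 b2.
  by case: P => p1 p2; case: Q => q1 q2; case: k => x y /=; ring.
split; first by split.
rewrite /dbar /partial D1 D2 D3 D4.
apply: (mulIf (x := 2)); first by rewrite pnatr_eq0.
rewrite divfK; last by rewrite pnatr_eq0.
rewrite mulr_natr mulr2n; case: P Q {hu D1 D2 D3 D4} => p1 p2 [q1 q2]; simpc => /=.
by congr (_ +i* _); ring.
Qed.

(** At first order [h] and [g] contribute multiples of [k] only; the multiple of [cj k] comes from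
    [cj (w - p)] and is [h z]. *)
Lemma dbar_combination (h g : C -> C) z c d p : cderiv h z c -> cderiv g z d ->
  real_differentiable (fun w => cj (w - p) * h w - g w) z /\
  dbar (fun w => cj (w - p) * h w - g w) z = h z.
Proof.
move=> hc gd; apply: (@dbar_expansion _ z (cj (z - p) * c - d)) => e e0.
have B0 : 0 < cabs (z - p) + 2 by rewrite ltr_wpDl ?cabs_ge0.
(* Three errors are to be covered, with the factors [cabs (z - p)], 1 and 1. *)
have e1 : 0 < e / (cabs (z - p) + 2) by rewrite divr_gt0.
set e' := e / _ in e1; have [r1 r10 h1] := hc _ e1; have [r2 r20 h2] := gd _ e1.
have [r3 r30 h3] := cderiv_cont hc e1.
exists (Num.min r1 (Num.min r2 r3)); first by rewrite !lt_min r10 r20.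
move=> k; rewrite !lt_min => /andP[/h1 k1 /andP[/h2 k2 /h3 k3]].
rewrite (_ : _ - _ - _ - _ = cj (z - p) * (h (z + k) - h z - c * k)
  + cj k * (h (z + k) - h z) - (g (z + k) - g z - d * k)); last first.
  by rewrite [z + k - p]addrAC cjD; ring.
apply: le_trans (ler_cabsB _ _) _.
have := ler_cabsD (cj (z - p) * (h (z + k) - h z - c * k)) (cj k * (h (z + k) - h z)).
rewrite !cabsM !cabs_cj.
have j1 := ler_wpM2l (cabs_ge0 (z - p)) k1; have j2 := ler_wpM2l (cabs_ge0 k) (ltW k3).
have -> : e * cabs k = cabs (z - p) * (e' * cabs k) + cabs k * e' + e' * cabs k.
  rewrite /e'; move: B0; set B := cabs (z - p) => B0.
  by field; rewrite gt_eqF.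
by lra.
Qed.

End real_differentiability.

(** * Transport to the disc *)

Section transport.
Context {R : realType}.
Local Notation C := R[i].
Local Notation RM := (measurableTypeR R).
Local Notation T2 := (RM * RM)%type.
Local Notation mu2 := (@lebesgue_measure R \x @lebesgue_measure R)%E.
Local Notation DD := (plane (@unit_disc R)).
Variables (Omega : set C) (phi psi dpsi : C -> C).
Hypothesis openO : open Omega.
Hypothesis hphi : forall z, Omega z -> cderiv phi z (derive1 phi z).
Hypothesis phiD : forall z, Omega z -> cabs (phi z) < 1.
Hypothesis psiO : forall w, cabs w < 1 -> Omega (psi w).
Hypothesis phipsi : forall w, cabs w < 1 -> phi (psi w) = w.
Hypothesis psiphi : forall z, Omega z -> psi (phi z) = z.
Hypothesis hpsi : forall w, cabs w < 1 -> cderiv psi w (dpsi w).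

Let dphipsi w : cabs w < 1 -> derive1 phi (psi w) * dpsi w = 1.
Proof.
move=> w1; have := cderiv_comp (hpsi w1) (hphi (psiO w1)).
set d := _ * _ => h; have [r r0 hr] := (openC_cabs _).1 open_unit_disc w w1.
apply: (cderiv_unique h); apply: (cderiv_eq (f := id)); last exact: cderiv_id.
by exists r => // k kr; rewrite phipsi//; apply: hr; rewrite addrC addKr.
Qed.

Let dpsi0 w : cabs w < 1 -> dpsi w != 0.
Proof.
move=> w1; apply/eqP => e; have := dphipsi w1; rewrite e mulr0 => /eqP.
by rewrite eq_sym oner_eq0.
Qed.

Let image_disc : psi @` (@unit_disc R) = Omega.
Proof.
apply/seteqP; split => [_ [w w1 <-]|z Oz]; first exact: psiO.
by exists (phi z); [exact: phiD|exact: psiphi].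
Qed.

Let inj_psi : {in (@unit_disc R) &, injective psi}.
Proof. by move=> x y /set_mem x1 /set_mem y1 e; rewrite -(phipsi x1) -(phipsi y1) e. Qed.

Let Psi (p : T2) : T2 := to_xy (psi (of_xy p)).

Let mPsi : measurable_fun DD Psi.
Proof. exact: (measurable_plane_holo open_unit_disc hpsi). Qed.

Let mdpsi : measurable_fun DD (fun p => cabs (dpsi (of_xy p)) ^+ 2).
Proof.
apply: measurable_funX; apply: measurable_disc_cabs => z z1.
by have [d /cderiv_cont] := holo_deriv open_unit_disc hpsi z1.
Qed.

Let mO : measurable (plane Omega) := measurable_plane openO.
Let mD : measurable DD := measurable_plane open_unit_disc.

Lemma area_transport :
  area Omega = (\int[mu2]_(p in DD) (cabs (dpsi (of_xy p)) ^+ 2)%:E)%E.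
Proof.
have := conformal_measure open_unit_disc hpsi inj_psi phipsi measurableT.
by rewrite image_disc setIT preimage_setT setIT.
Qed.

Lemma measurable_domain (g : C -> R) : (forall z, Omega z -> rcont g z) ->
  measurable_fun (plane Omega) (fun p => g (of_xy p)).
Proof. by move=> cg; exact: measurable_rcont. Qed.

Variables (alpha : R) (L : C -> C).
Hypothesis alpha1 : -1 < alpha.
Hypothesis hL : forall w, cabs w < 1 -> cabs (L w) = cabs (dpsi w) `^ (1 + alpha / 2).

Lemma L_neq0 w : cabs w < 1 -> L w != 0.
Proof. by move=> w1; rewrite -cabs_gt0 hL// powR_gt0// cabs_gt0 dpsi0. Qed.

Let weight_ge0 z : 0 <= weight alpha phi z.
Proof.
rewrite /weight mulr_ge0 ?divr_ge0 ?powR_ge0//; move: alpha1; lra.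
Qed.

(** The exponent [1 + alpha / 2] of [L] is made for this: in the square of its modulus, the exponent
    2 is the Jacobian of [psi] and [alpha] is the factor of the weight in the derivative of
    [phi]. *)
Let weight_psi w : cabs w < 1 ->
  weight alpha phi (psi w) * cabs (dpsi w) ^+ 2 = (1 + alpha) * (1 - cabs w ^+ 2) `^ alpha * cabs (L w) ^+ 2.
Proof.
move=> w1; rewrite /weight phipsi//; set W := (1 - _) `^ _.
have x0 : 0 < cabs (dpsi w) by rewrite cabs_gt0 dpsi0.
have -> : cabs (derive1 phi (psi w)) = (cabs (dpsi w))^-1.
  apply: (mulIf (x := cabs (dpsi w))); first by rewrite gt_eqF.
  by rewrite -cabsM dphipsi// cabs1 mulVf// gt_eqF.
rewrite hL//; move: (cabs (dpsi w)) x0 => x x0.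
have -> : x^-1 `^ alpha = (x `^ alpha)^-1.
  by rewrite -(powR_inv1 (ltW x0)) -powRrM mulN1r powRN.
have xp r s : x `^ (r + s) = x `^ r * x `^ s by rewrite powRD// (gt_eqF x0) implybT.
have -> : x `^ (1 + alpha / 2) ^+ 2 = x ^+ 2 * x `^ alpha.
  rewrite [in RHS](_ : alpha = alpha / 2 + alpha / 2); last by field.
  by rewrite !xp powRr1 ?(ltW x0)//; ring.
by rewrite invrK; ring.
Qed.

Let mweight : measurable_fun (plane Omega) (fun p => weight alpha phi (of_xy p)).
Proof.
have cp z : Omega z -> ccont phi z by move=> /hphi /cderiv_cont.
have cd z : Omega z -> ccont (derive1 phi) z.
  by move=> Oz; have [d /cderiv_cont] := holo_deriv openO hphi Oz.
rewrite (_ : (fun p => _) = fun p => (1 + alpha) * ((1 - cabs (phi (of_xy p)) ^+ 2) `^ alpha *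
    cabs (derive1 phi (of_xy p)) `^ (- alpha))); last first.
  by apply/funext => p; rewrite /weight powRN.
apply: measurable_funM => //; apply: measurable_funM.
  apply: (measurableT_comp (measurable_powR _)); apply: measurable_funB => //.
  apply: measurable_funX; apply: (measurable_domain (g := fun z => cabs (phi z))) => z Oz.
  exact/rcont_cabs/cp.
apply: (measurableT_comp (measurable_powR _)).
apply: (measurable_domain (g := fun z => cabs (derive1 phi z))) => z Oz.
exact/rcont_cabs/cd.
Qed.

Lemma sqnormL2_transport (f : C -> C) : (forall z, Omega z -> ccont f z) ->
  (sqnormL2 alpha phi Omega f = ((1 + alpha) / pi)%:E *
    \int[mu2]_(p in DD) (cabs (f (psi (of_xy p)) * L (of_xy p)) ^+ 2 * (1 - sqn p) `^ alpha)%:E)%E.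
Proof.
move=> cf.
have cpsi w : cabs w < 1 -> ccont psi w by move=> /hpsi /cderiv_cont.
have pi1 : 0 <= (pi : R)^-1 by rewrite invr_ge0 pi_ge0.
have al0 : 0 <= 1 + alpha by move: alpha1; lra.
have mG : measurable_fun (plane Omega)
    (fun p : T2 => (cabs (f (of_xy p)) ^+ 2 * (weight alpha phi (of_xy p) / pi))%:E).
  apply/measurable_EFinP; apply: measurable_funM; last exact: measurable_funM.
  apply: measurable_funX; apply: (measurable_domain (g := fun z => cabs (f z))) => z Oz.
  exact/rcont_cabs/cf.
have G0 p : plane Omega p -> (0 <= (cabs (f (of_xy p)) ^+ 2 * (weight alpha phi (of_xy p) / pi))%:E)%E.
  by move=> _; rewrite lee_fin mulr_ge0 ?sqr_ge0// mulr_ge0// weight_ge0.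
have H (B : set T2) : measurable B -> mu2 (plane Omega `&` B) =
    (\int[mu2]_(p in DD `&` Psi @^-1` B) (cabs (dpsi (of_xy p)) ^+ 2)%:E)%E.
  by move=> mB; rewrite -image_disc; exact: (conformal_measure open_unit_disc hpsi inj_psi phipsi mB).
have PsiO p : DD p -> plane Omega (Psi p).
  by move=> Dp; rewrite /plane /preimage; cbn [mkset]; rewrite /Psi to_xyK; exact: psiO.
have := ge0_transfer mD mO mPsi mdpsi (fun p _ => sqr_ge0 _) PsiO H mG G0.
move=> E; apply: (etrans E).
rewrite -ge0_integralZl_EFin//; last 3 first.
- by move=> p _; rewrite lee_fin mulr_ge0 ?sqr_ge0 ?powR_ge0.
- apply/measurable_EFinP; apply: measurable_funM; last exact: measurable_disc_weight.
  apply: (eq_measurable_fun (fun p => cabs (f (psi (of_xy p))) ^+ 2 * (cabs (dpsi (of_xy p)) `^ (1 + alpha / 2)) ^+ 2)).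
    by move=> p /set_mem Dp; rewrite cabsM exprMn hL.
  apply: measurable_funM; apply: measurable_funX.
    apply: (measurable_disc_cabs (f := fun z => f (psi z))) => z z1.
    by apply: (ccont_comp (f := psi) (g := f)); [exact: cpsi|exact/cf/psiO].
  apply: (measurableT_comp (measurable_powR _)); apply: measurable_disc_cabs => z z1.
  by have [d /cderiv_cont] := holo_deriv open_unit_disc hpsi z1.
- by rewrite mulr_ge0.
apply: eq_integral => p /set_mem Dp; rewrite /Psi to_xyK -!EFinM; congr EFin.
have := weight_psi Dp; rewrite -/(sqn p) => h.
rewrite cabsM exprMn.
transitivity (cabs (f (psi (of_xy p))) ^+ 2 * (weight alpha phi (psi (of_xy p)) * cabs (dpsi (of_xy p)) ^+ 2) / pi).
  by ring.
by rewrite h; ring.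
Qed.

End transport.

(** The unweighted moments, with which Bessel's inequality for the derivative of [psi] becomes the
    area bound. *)
Lemma gam2 (R : realType) k : gam (2 + 0 : R) k = k.+1%:R^-1.
Proof.
elim: k => [|k IH]; first by rewrite invr1.
rewrite gamS IH addr0 -natrD addn2 mulrA mulVf ?mul1r// pnatr_eq0.
Qed.

Theorem corollary2 (R : realType) (alpha : R) (Omega : set R[i])
    (phi h : R[i] -> R[i])
    (halpha : -1 < alpha)
    (hOmega : simply_connected_domain Omega)
    (harea : (area Omega < +oo)%E)
    (hphi : Riemann_mapping Omega phi)
    (hh : in_Bergman alpha phi Omega h) :
  exists u : R[i] -> R[i],
    [/\ in_L2 alpha phi Omega u,
        dbar_solution Omega u h &
        (sqnormL2 alpha phi Omega u <=
           area Omega * ((2 + alpha) * pi)^-1%:E * sqnormL2 alpha phi Omega h)%E].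
Proof.
have [[openO _ _] _] := hOmega.
have [holphi [phiD inj surj]] := hphi.
have [holh [_ _ hfin]] := hh.
have dphi z : Omega z -> cderiv phi z (derive1 phi z) by move=> /holphi /derivable_cderiv.
have dh z : Omega z -> cderiv h z (derive1 h z) by move=> /holh /derivable_cderiv.
have /choice[psi hpsi] : forall w : R[i], exists z, cabs w < 1 -> Omega z /\ phi z = w.
  move=> w; have [w1|w1] := ltP (cabs w) 1; last by exists 0.
  by have [z Oz <-] := surj w w1; exists z.
have psiO w : cabs w < 1 -> Omega (psi w) by move=> /hpsi[].
have phipsi w : cabs w < 1 -> phi (psi w) = w by move=> /hpsi[].
have psiphi z : Omega z -> psi (phi z) = z.
  move=> Oz; have z1 : cabs (phi z) < 1 by exact: phiD.
  by apply: inj; rewrite ?inE ?phipsi//; exact: psiO.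
have dpsi w : cabs w < 1 -> cderiv psi w (derive1 phi (psi w))^-1.
  move=> w1; have Oz := psiO w w1.
  have d0 := injective_deriv_neq0 openO dphi inj psiphi Oz.
  by have := inverse_cderiv openO dphi inj psiphi Oz d0; rewrite phipsi.
(* The subtraction makes the coefficient [A 0] vanish, as the bound on truncations requires; on the
   domain it replaces [cj z] by [cj (z - psi 0)], with the same [dbar]. *)
pose psi0 w := psi w - psi 0.
have dpsi0 w : cabs w < 1 -> cderiv psi0 w (derive1 phi (psi w))^-1.
  by move=> w1; rewrite -[_^-1]subr0; exact: cderivB (dpsi w w1) (cderiv_cst _ _).
have [A psiA] : exists A, has_ps psi0 A 1.
  by apply: disc_taylor => // w w1; eexists; exact: dpsi0.
have A0 : A 0%N = 0 by rewrite -(has_ps0 ltr01 psiA) /psi0 subrr.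
have [g gA hg] := has_ps_deriv psiA.
have gE w : cabs w < 1 -> g w = (derive1 phi (psi w))^-1.
  by move=> w1; exact: cderiv_unique (hg w w1) (dpsi0 w w1).
have g0 w : cabs w < 1 -> g w != 0.
  move=> w1; rewrite gE// invr_eq0.
  exact: (injective_deriv_neq0 openO dphi inj psiphi (psiO w w1)).
have dpsig w : cabs w < 1 -> cderiv psi w (g w) by move=> w1; rewrite gE//; exact: dpsi.
have [L holL hL] := holo_abs_powR (1 + alpha / 2) (has_ps_holo gA) g0.
have L0 w : cabs w < 1 -> L w != 0 by exact: (L_neq0 dphi psiO phipsi dpsig hL).
pose F w := h (psi w) * L w.
have [b Fb] : exists b, has_ps F b 1.
  apply: disc_taylor => // w w1; have [c hc] := holL w w1.
  by eexists; apply: cderivM hc; exact: cderiv_comp (dpsi w w1) (dh _ (psiO w w1)).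
have transport f := sqnormL2_transport openO dphi (fun z => phiD z) psiO phipsi psiphi dpsig halpha hL
  (f := f).
have al0 : 0 < 1 + alpha by move: halpha; lra.
have api : 0 < (1 + alpha) / pi by rewrite divr_gt0// pi_gt0.
have apiE : (0 <= ((1 + alpha) / pi)%:E)%E by rewrite lee_fin ltW.
have pi0 : (pi : R) != 0 by rewrite gt_eqF// pi_gt0.
have hE : sqnormL2 alpha phi Omega h = (fine (sqnormL2 alpha phi Omega h))%:E.
  rewrite fineK// ge0_fin_numE//; apply: integral_ge0 => p _.
  rewrite lee_fin mulr_ge0 ?sqr_ge0// divr_ge0 ?pi_ge0// mulr_ge0 ?divr_ge0 ?powR_ge0//; lra.
have api1 : (1 + alpha) / pi * (pi / (1 + alpha)) = 1.
  by rewrite mulrA divfK// divff// gt_eqF.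
set Sb := fine _ in hE.
have areaE : area Omega = (fine (area Omega))%:E by rewrite fineK// ge0_fin_numE.
set ar := fine _ in areaE.
have hSb N : \sum_(n < N) cabs (b n) ^+ 2 * gam (2 + alpha) n <= Sb.
  rewrite -lee_fin -hE transport; last by move=> z /dh /cderiv_cont.
  have := lee_wpmul2l apiE (bessel halpha N Fb).
  by rewrite -EFinM mulrA api1 mul1r.
(* Bessel's inequality with exponent 0 for the derivative [g]: its coefficients [k.+1%:R * A k.+1]
   against the moments [k.+1%:R^-1] leave exactly one factor [k.+1%:R]. *)
have hSa N : \sum_(m < N) m%:R * cabs (A m) ^+ 2 <= ar / pi.
  apply: (@le_trans _ _ (\sum_(m < N.+1) m%:R * cabs (A m) ^+ 2)).
    by rewrite big_ord_recr /= lerDl mulr_ge0 ?sqr_ge0.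
  rewrite big_ord_recl /= mul0r add0r ler_pdivlMr ?pi_gt0// -lee_fin -areaE.
  rewrite (area_transport (fun z => phiD z) psiO phipsi psiphi dpsig).
  have n10 : -1 < 0 :> R by lra.
  apply: le_trans (le_trans (bessel n10 N gA) _); last first.
    rewrite le_eqVlt; apply/orP; left; apply/eqP; apply: eq_integral => p _.
    by rewrite powRr0 mulr1.
  rewrite lee_fin addr0 divr1 mulrC ler_pM2l ?pi_gt0//; apply: ler_sum => k _.
  rewrite /pshift cabsM gam2 /bump leq0n add1n.
  have -> : cabs (k.+1%:R : R[i]) = k.+1%:R.
    by rewrite -(rmorph_nat (@real_complex R)) cabs_real normr_nat.
  rewrite exprMn mulrAC expr2 mulfK// pnatr_eq0//.
have [G holG Gle] := disc_solution halpha A0 psiA Fb hSa hSb.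
(* Transport multiplies by [L], so the holomorphic correction found on the disc is divided by [L]
   when pulled back. *)
pose gO z := G (phi z) / L (phi z).
have dgO z : Omega z -> exists d, cderiv gO z d.
  move=> Oz; have z1 : cabs (phi z) < 1 by exact: phiD.
  have [d hd] := holo_disc_div holG holL L0 z1.
  by eexists; exact: (cderiv_comp (dphi z Oz) hd).
pose u z := cj (z - psi 0) * h z - gO z.
have cu z : Omega z -> ccont u z.
  move=> Oz; apply: ccontB; last by have [d /cderiv_cont] := dgO z Oz.
  apply: ccontM; last exact: cderiv_cont (dh z Oz).
  apply: (ccont_comp (f := fun z => z - psi 0) (g := cj)); last exact: ccont_cj.
  by apply: ccontB; [exact: ccont_id|exact: ccont_cst].
have ule : (sqnormL2 alpha phi Omega u <=
    area Omega * ((2 + alpha) * pi)^-1%:E * sqnormL2 alpha phi Omega h)%E.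
  rewrite transport// hE areaE -!EFinM.
  (* The normalization of the measure and the total mass of the disc weight are inverse to each
     other; the remaining [pi] comes from the area bound. *)
  have -> : ar * ((2 + alpha) * pi)^-1 * Sb =
      (1 + alpha) / pi * (pi / (1 + alpha) * ((2 + alpha)^-1 * (ar / pi * Sb))).
    by rewrite [RHS]mulrA api1 mul1r invfM; ring.
  rewrite [X in (_ <= X)%E]EFinM; apply: lee_wpmul2l => //.
  apply: le_trans Gle; rewrite le_eqVlt; apply/orP; left; apply/eqP.
  apply: eq_integral => p /set_mem Dp; congr (cabs _ ^+ 2 * _)%:E.
  rewrite /u mulrBl /gO phipsi// divfK ?L0//.
  by rewrite -mulrA.
exists u; split => //.
- split.
  + exact: (measurable_domain openO (g := fun z => complex.Re (u z)) (fun z Oz => rcont_Re (cu z Oz))).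
  + exact: (measurable_domain openO (g := fun z => complex.Im (u z)) (fun z Oz => rcont_Im (cu z Oz))).
  + by apply: le_lt_trans ule _; rewrite hE areaE -!EFinM ltry.
- by move=> z Oz; have [d hd] := dgO z Oz; exact: dbar_combination (dh z Oz) hd.
Qed.
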